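(* Let $m_1,n\ge1$, let $0<r<m_1$ and $k\in\mathbb Z$. Consider the $osp(2m_1,2n)$-modules $\mathcal A^r_k,\mathcal H^r_k$ and the operator $\eta$ defined in the context. When $k\le n-m_1+r+1$, the submodule $\mathcal H^r_k$ is irreducible and $\mathcal A^r_k=\mathcal H^r_k\oplus\eta\mathcal A^r_{k-2}$. If $k>n-m_1+r+1$, we have the following composition series: $$\mathcal H^r_k\supset\eta^{\,k-n+m_1-r-1}\mathcal H^r_{-k+2(n-m_1+r+1)}\supset\{0\}\quad\text{if }r<m_1-1;$$ $$\mathcal H^{m_1-1}_k\supset\langle x_{m_1}^k\rangle\supset\eta^{\,k-n}\mathcal H^{m_1-1}_{-k+2n}\supset\{0\}\quad\text{if }r=m_1-1.$$ Moreover, for every $k\in\mathbb Z$, writing $N=\sum_{i=1}^{m_1-1}q_i+\sum_{j=1}^nl_j$, the space $\mathcal H^r_k$ has a basis consisting of all $$\sum_{\substack{q_1,\dots,q_{m_1-1}\in\mathbb N\\ l_1,\dots,l_n\in\{0,1\}}}\frac{(-1)^{\sum_{i=r+1}^{m_1-1}q_i+\sum_{j=1}^nl_j}\prod_{i=1}^r\binom{\alpha_{m_1+i}}{q_i}\prod_{i=r+1}^{m_1-1}\binom{\alpha_i}{q_i}\binom{\alpha_{m_1+i}}{q_i}\prod_{j=1}^n\binom{\beta_j}{l_j}\binom{\beta_{n+j}}{l_j}}{\binom{\alpha_{m_1}+N}{\alpha_{m_1}}\binom{\alpha_{2m_1}+N}{\alpha_{2m_1}}\cdot\frac{N!}{q_1!\cdots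 q_{m_1-1}!}\cdot\prod_{i=1}^rq_i!}$$ $$\times\prod_{i=1}^rx_i^{\alpha_i+q_i}x_{m_1+i}^{\alpha_{m_1+i}-q_i}\prod_{i=r+1}^{m_1-1}x_i^{\alpha_i-q_i}x_{m_1+i}^{\alpha_{m_1+i}-q_i}\prod_{j=1}^n(-1)^{\beta_jl_j}\theta_j^{\beta_j-l_j}\theta_{n+j}^{\beta_{n+j}-l_j}\;x_{m_1}^{\alpha_{m_1}+N}x_{2m_1}^{\alpha_{2m_1}+N}$$ with $\alpha_i\in\mathbb N$ ($1\le i\le2m_1$), $\beta_j\in\{0,1\}$ ($1\le j\le2n$), $\sum_{j=1}^{2n}\beta_j-\sum_{i=1}^r\alpha_i+\sum_{i=r+1}^{2m_1}\alpha_i=k$ and $\alpha_{m_1}\alpha_{2m_1}=0$. (Terms with zero coefficient are omitted; products over $j$ are taken in increasing order of $j$.)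
   Context: $\mathbb N$ is the set of nonnegative integers, $\overline{i,j}=\{i,\dots,j\}$. $E_{i,j}$ is the square matrix with $(i,j)$-entry $1$ and others zero. With $m=2m_1$, the Lie superalgebra $gl(m,2n)$ of $(m+2n)\times(m+2n)$ complex matrices has even part spanned by $E_{i,j}$ ($i,j\in\overline{1,m}$) and $E_{m+s,m+t}$ ($s,t\in\overline{1,2n}$), odd part spanned by $E_{i,m+s},E_{m+s,i}$, and bracket $[u,v]=uv-(-1)^{\iota_1\iota_2}vu$ for $u,v$ of parities $\iota_1,\iota_2$. $osp(2m_1,2n)$ is the subalgebra of matrices $$\begin{pmatrix}A&B&H&H_1\\ C&-A^T&K&K_1\\ K_1^T&H_1^T&D&E\\ -K^T&-H^T&F&-D^T\end{pmatrix}$$ with $A,B,C$ of size $m_1\times m_1$, $B=-B^T$, $C=-C^T$; $D,E,F$ of size $n\times n$, $E=E^T$, $F=F^T$; $H,H_1,K,K_1$ of size $m_1\times n$. $\mathcal A=\mathbb C[x_1,\dots,x_m,\theta_1,\dots,\theta_{2n}]$ with commuting $x_i$, anticommuting $\theta_p$, $x_i\theta_p=\theta_px_i$; $\partial_{\theta_p}$ is the odd (left) derivation with $\partial_{\theta_p}(\theta_q)=\delta_{p,q}$. For fixed $r$, $gl(m,2n)$ (restricted to $osp(2m_1,2n)$) acts on $\mathcal A$ by: - $E_{i,j}\mapsto -x_j\partial_{x_i}-\delta_{i,j}$ if $i,j\in\overline{1,r}$; $\partial_{x_i}\partial_{x_j}$ if $i\in\overline{1,r}$, $j\in\overline{r+1,m}$;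 $-x_ix_j$ if $j\in\overline{1,r}$, $i\in\overline{r+1,m}$; $x_i\partial_{x_j}$ if $i,j\in\overline{r+1,m}$; - for $p\in\overline{1,2n}$: $E_{i,m+p}\mapsto\partial_{x_i}\partial_{\theta_p}$ if $i\in\overline{1,r}$, and $x_i\partial_{\theta_p}$ if $i\in\overline{r+1,m}$; $E_{m+p,j}\mapsto-\theta_px_j$ if $j\in\overline{1,r}$, and $\theta_p\partial_{x_j}$ if $j\in\overline{r+1,m}$; - $E_{m+p,m+q}\mapsto\theta_p\partial_{\theta_q}$ for $p,q\in\overline{1,2n}$. For $k\in\mathbb Z$, $\mathcal A^r_k$ is the span of all $x^\alpha\theta_{i_1}\cdots\theta_{i_t}$ with $0\le t\le2n$, $i_1,\dots,i_t\in\overline{1,2n}$, $\alpha\in\mathbb N^m$ and $t-\sum_{i=1}^r\alpha_i+\sum_{j=r+1}^m\alpha_j=k$; it is an $osp(2m_1,2n)$-submodule. Define $$\Delta=-\sum_{i=1}^r x_i\partial_{x_{m_1+i}}+\sum_{i=r+1}^{m_1}\partial_{x_i}\partial_{x_{m_1+i}}+\sum_{j=1}^n\partial_{\theta_j}\partial_{\theta_{n+j}},$$ $$\eta=\sum_{i=1}^r x_{m_1+i}\partial_{x_i}+\sum_{i=r+1}^{m_1}x_ix_{m_1+i}+\sum_{j=1}^n\theta_j\theta_{n+j},$$ and $\mathcal H^r_k=\{f\in\mathcal A^r_k\mid\Delta(f)=0\}$. $\langle F\rangle$ denotes the $osp(2m_1,2n)$-submodule generated by $F$. *)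

(* Defs.v *)
From HB Require Import structures.
From mathcomp Require Import all_boot all_order all_algebra.
From mathcomp Require Import classical_sets reals.
From mathcomp Require Import complex mpoly.

Set Implicit Arguments.
Unset Strict Implicit.
Unset Printing Implicit Defensive.

Import Order.TTheory GRing.Theory Num.Theory.
Local Open Scope classical_set_scope.
Local Open Scope ring_scope.

Section Modules.
Variables (C : fieldType) (V : lmodType C).

Definition subspace (W : set V) : Prop :=
  W 0 /\ forall (a : C) (u v : V), W u -> W v -> W (a *: u + v).

Definition span (X : set V) : set V :=
  [set w | exists (s : seq V) (c : V -> C),
    (forall v, v \in s -> X v) /\ w = \sum_(v <- s) c v *: v].

Definition direct_sum (W U1 U2 : set V) : Prop :=
  W = [set u1 + u2 | u1 in U1 & u2 in U2] /\ U1 `&` U2 = [set 0].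

(* The family (v i), for i ranging over P, is a basis of W.  As the vectors
   are indexed, freeness includes that they are pairwise distinct. *)
Definition is_basis (I : eqType) (P : set I) (v : I -> V) (W : set V) : Prop :=
  [/\ forall i, P i -> W (v i),
      forall w, W w -> exists (s : seq I) (c : I -> C),
        (forall i, i \in s -> P i) /\ w = \sum_(i <- s) c i *: v i
    & forall (s : seq I) (c : I -> C), uniq s -> (forall i, i \in s -> P i) ->
        \sum_(i <- s) c i *: v i = 0 -> forall i, i \in s -> c i = 0].

(* Here the elements of g act on V through act. *)
Variables (G : Type) (g : set G) (act : G -> V -> V).

Definition submodule (W : set V) : Prop :=
  subspace W /\ forall x, g x -> forall v, W v -> W (act x v).

Definition generated (F : set V) : set V := smallest submodule F.

Definition irreducible (W : set V) : Prop :=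
  [/\ submodule W, W <> [set 0]
    & forall U, submodule U -> U `<=` W -> U = [set 0] \/ U = W].

(* W' is a proper submodule of W and the module W / W' is irreducible: the
   submodules of W / W' are the U / W' with U a submodule, W' <= U <= W. *)
Definition irreducible_quotient (W W' : set V) : Prop :=
  [/\ submodule W, submodule W', W' `<` W
    & forall U, submodule U -> W' `<=` U -> U `<=` W -> U = W' \/ U = W].

(* W, followed by the terms of s, is a composition series of W; in
   particular it ends with {0}. *)
Fixpoint composition_series (W : set V) (s : seq (set V)) : Prop :=
  if s is W' :: s' then
    irreducible_quotient W W' /\ composition_series W' s'
  else W = [set 0].

End Modules.

(* C[x_1, ..., x_M, theta_1, ..., theta_N]: the element f is the sum over
   S = {s_1 < ... < s_t} of (f S) theta_(s_1) ... theta_(s_t).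
   All indices are 0-based: the ordinal i stands for x_(i+1), theta_(i+1). *)
Notation superpoly C M N := {ffun {set 'I_N} -> {mpoly C[M]}}.

Section Superpoly.
Variables (C : fieldType) (M N : nat).
Local Notation A := (superpoly C M N).

Definition of_poly (f : {mpoly C[M]}) : A :=
  [ffun S : {set 'I_N} => if S == finset.set0 then f else 0].

Definition xmul (i : 'I_M) (f : A) : A := [ffun S : {set 'I_N} => 'X_i * f S].

Definition dx (i : 'I_M) (f : A) : A := [ffun S : {set 'I_N} => (f S)^`M(i)].

Definition theta_sign (p : 'I_N) (S : {set 'I_N}) : C :=
  (-1) ^+ #|[set q in S | (q < p)%N]%SET|.

(* left multiplication by theta_p *)
Definition theta (p : 'I_N) (f : A) : A :=
  [ffun S : {set 'I_N} =>
    if p \in S then theta_sign p S *: f (S :\ p)%SET else 0].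

(* The odd left derivation d/d(theta_p); it is characterized by the
   relations dtheta_of_poly and dtheta_theta below. *)
Definition dtheta (p : 'I_N) (f : A) : A :=
  [ffun S : {set 'I_N} =>
    if p \in S then 0 else theta_sign p S *: f (p |: S)%SET].

(* x^alpha theta_(i_1) ... theta_(i_t) for s = [:: i_1; ...; i_t] *)
Definition monomial (alpha : 'X_{1..M}) (s : seq 'I_N) : A :=
  foldr theta (of_poly 'X_[alpha]) s.

Lemma theta_signU1 (p q : 'I_N) (S : {set 'I_N}) : q \notin S ->
  theta_sign p (q |: S)%SET = (-1) ^+ (q < p)%N * theta_sign p S.
Proof.
move=> qS; rewrite /theta_sign -exprD; congr (_ ^+ _).
case: ltnP => qp; last first.
  rewrite add0n; apply: eq_card => s; rewrite !inE.
  by case: eqVneq => //= ->; rewrite (negbTE qS) ltnNge qp.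
rewrite -[X in (X + _)%N]/1%N.
have -> : [set s in (q |: S)%SET | (s < p)%N]%SET
        = (q |: [set s in S | (s < p)%N])%SET.
  by apply/setP => s; rewrite !inE; case: eqVneq => //= ->; rewrite qp.
by rewrite cardsU1 inE (negbTE qS).
Qed.

Lemma theta_signD1 (p q : 'I_N) (S : {set 'I_N}) : q \in S ->
  theta_sign p (S :\ q)%SET = (-1) ^+ (q < p)%N * theta_sign p S.
Proof.
move=> qS; rewrite -[in RHS](finset.setD1K qS) theta_signU1 ?finset.setD11 //.
by rewrite mulrA -expr2 sqrr_sign mul1r.
Qed.

Lemma theta_sign_sq (p : 'I_N) (S : {set 'I_N}) :
  theta_sign p S * theta_sign p S = 1.
Proof. by rewrite /theta_sign -expr2 sqrr_sign. Qed.

Lemma dtheta_of_poly p f : dtheta p (of_poly f) = 0.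
Proof.
apply/ffunP => S; rewrite !ffunE; case: ifP => // _.
case: eqP => [E|_]; last by rewrite scaler0.
by have := finset.setU11 p S; rewrite E inE.
Qed.

Lemma theta_theta p q f : theta p (theta q f) = - theta q (theta p f).
Proof.
apply/ffunP => S; rewrite !ffunE !inE.
case: (eqVneq p q) => [->|pq].
  by rewrite /= scaler0; case: ifP => _; rewrite oppr0.
rewrite /=.
have [pS|pS] := boolP (p \in S); have [qS|qS] := boolP (q \in S);
  rewrite ?scaler0 ?oppr0 //.
rewrite !theta_signD1 // !scalerA -scaleNr.
have -> : (S :\ p :\ q = S :\ q :\ p)%SET.
  by apply/setP => s; rewrite !inE andbCA.
congr (_ *: _).
have: (p != q :> nat) by [].
rewrite neq_ltn => /orP[] h; rewrite h ltnNge (ltnW h) /= expr1 expr0;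
  by rewrite !mulN1r !mul1r ?mulrN ?opprK mulrC.
Qed.

Lemma dtheta_theta p q f :
  dtheta p (theta q f) = (p == q)%:R *: f - theta q (dtheta p f).
Proof.
apply/ffunP => S; rewrite !ffunE !inE.
case: (eqVneq p q) => [<-|pq].
  rewrite /= scale1r.
  have [pS|pS] := boolP (p \in S).
    rewrite ?inE ?eqxx /= scalerA theta_signD1 // ltnn mul1r theta_sign_sq.
    by rewrite scale1r finset.setD1K // subrr.
  rewrite scalerA theta_signU1 // ltnn mul1r theta_sign_sq scale1r.
  by rewrite finset.setU1K // subr0.
rewrite /= scale0r add0r.
have [pS|pS] := boolP (p \in S); have [qS|qS] := boolP (q \in S);
  rewrite ?scaler0 ?oppr0 //.
rewrite theta_signU1 // theta_signD1 // !scalerA -scaleNr.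
have -> : ((p |: S) :\ q = p |: S :\ q)%SET.
  apply/setP => s; rewrite !inE.
  by case: (eqVneq s q) => //= ->; rewrite eq_sym (negbTE pq).
congr (_ *: _).
have: (p != q :> nat) by [].
rewrite neq_ltn => /orP[] h; rewrite h ltnNge (ltnW h) /= expr1 expr0;
  by rewrite !mulN1r !mul1r ?mulrN ?opprK mulrC.
Qed.

End Superpoly.

Section Osp.
Variables (C : fieldType) (m1 n : nat).
Local Notation gl := 'M[C]_((m1 + m1) + (n + n)).

(* The members of osp(2 m1, 2 n), homogeneous or not. *)
Definition osp : set gl :=
  [set X | exists (A B C' : 'M[C]_m1) (D E F : 'M[C]_n)
                  (H H1 K K1 : 'M[C]_(m1, n)),
    [/\ B = - B^T, C' = - C'^T, E = E^T, F = F^T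
      & X = block_mx
              (block_mx A B C' (- A^T))
              (block_mx H H1 K K1)
              (block_mx K1^T H1^T (- K^T) (- H^T))
              (block_mx D E F (- D^T))]].

Variable r : nat.
Local Notation A := (superpoly C (m1 + m1) (n + n)).

(* The operator by which the matrix unit E_(i,j) acts. *)
Definition gl_unit_act (i j : 'I_((m1 + m1) + (n + n))) (f : A) : A :=
  match split i, split j with
  | inl i, inl j =>
      match (i < r)%N, (j < r)%N with
      | true, true => - xmul j (dx i f) - (i == j)%:R *: f
      | true, false => dx i (dx j f)
      | false, true => - xmul i (xmul j f)
      | false, false => xmul i (dx j f)
      end
  | inl i, inr p =>
      if (i < r)%N then dx i (dtheta p f) else xmul i (dtheta p f)
  | inr p, inl j =>
      if (j < r)%N then - theta p (xmul j f) else theta p (dx j f)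
  | inr p, inr q => theta p (dtheta q f)
  end.

Definition gl_act (X : gl) (f : A) : A :=
  \sum_i \sum_j X i j *: gl_unit_act i j f.

Definition super_deg (alpha : 'X_{1..m1 + m1}) (t : nat) : int :=
  t%:Z - \sum_(i < m1 + m1 | (i < r)%N) (alpha i)%:Z
       + \sum_(i < m1 + m1 | (r <= i)%N) (alpha i)%:Z.

Definition A_ (k : int) : set A :=
  span [set f | exists (alpha : 'X_{1..m1 + m1}) (s : seq 'I_(n + n)),
    [/\ (size s <= n + n)%N, super_deg alpha (size s) = k
      & f = monomial C alpha s]].

Definition Delta (f : A) : A :=
  - \sum_(i < m1 | (i < r)%N) xmul (lshift m1 i) (dx (rshift m1 i) f)
  + \sum_(i < m1 | (r <= i)%N) dx (lshift m1 i) (dx (rshift m1 i) f)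
  + \sum_(j < n) dtheta (lshift n j) (dtheta (rshift n j) f).

Definition eta_op (f : A) : A :=
  \sum_(i < m1 | (i < r)%N) xmul (rshift m1 i) (dx (lshift m1 i) f)
  + \sum_(i < m1 | (r <= i)%N) xmul (lshift m1 i) (xmul (rshift m1 i) f)
  + \sum_(j < n) theta (lshift n j) (theta (rshift n j) f).

Definition H_ (k : int) : set A := [set f | A_ k f /\ Delta f = 0].

End Osp.

(* From here on m1 = p + 1, so that x_(m1) and x_(2 m1) have the indices ord_max
   in the first and the second half of the variables, and the indices
   1, ..., m1 - 1 of the q_i form 'I_p. *)
Section HarmonicBasis.
Variables (C : fieldType) (p n r : nat).
Local Notation m1 := p.+1.
Local Notation A := (superpoly C (m1 + m1) (n + n)).

Definition x_last_pow (k : nat) : A :=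
  of_poly (n + n) ('X_(lshift m1 ord_max) ^+ k).

Definition basis_index (k : int) :
    set ('X_{1..m1 + m1} * {ffun 'I_(n + n) -> bool}) :=
  [set ab : 'X_{1..m1 + m1} * {ffun 'I_(n + n) -> bool} |
    super_deg r ab.1 (\sum_j ab.2 j)%N = k
    /\ (ab.1 (lshift m1 ord_max) * ab.1 (rshift m1 ord_max) = 0)%N].

Section Vector.
Variables (alpha : 'X_{1..m1 + m1}) (beta : {ffun 'I_(n + n) -> bool}).

(* a i, b i, a', b' are alpha_i, alpha_(m1+i), alpha_(m1), alpha_(2 m1);
   likewise for the variables x i, y i, x', y'. *)
Let a (i : 'I_p) : nat := alpha (lshift m1 (widen_ord (leqnSn p) i)).
Let b (i : 'I_p) : nat := alpha (rshift m1 (widen_ord (leqnSn p) i)).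
Let a' : nat := alpha (lshift m1 ord_max).
Let b' : nat := alpha (rshift m1 ord_max).
Let x (i : 'I_p) : {mpoly C[m1 + m1]} :=
  'X_(lshift m1 (widen_ord (leqnSn p) i)).
Let y (i : 'I_p) : {mpoly C[m1 + m1]} :=
  'X_(rshift m1 (widen_ord (leqnSn p) i)).
Let x' : {mpoly C[m1 + m1]} := 'X_(lshift m1 ord_max).
Let y' : {mpoly C[m1 + m1]} := 'X_(rshift m1 ord_max).
Let bt (j : 'I_n) : nat := beta (lshift n j).
Let bt' (j : 'I_n) : nat := beta (rshift n j).

(* The q_i are bounded by |alpha|: beyond it 'C(b i, q i) is 0 and so is the
   coefficient.  For the same reason the truncated subtractions in exponents
   only matter where they are exact. *)
Definition basis_vector : A :=
  \sum_(q : {ffun 'I_p -> 'I_(mdeg alpha).+1})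
  \sum_(l : {ffun 'I_n -> bool})
    let N := (\sum_i q i + \sum_j l j)%N in
    let num : C :=
      (-1) ^+ (\sum_(i < p | (r <= i)%N) q i + \sum_j l j)%N
      * \prod_(i < p | (i < r)%N) 'C(b i, q i)%:R
      * \prod_(i < p | (r <= i)%N) ('C(a i, q i)%:R * 'C(b i, q i)%:R)
      * \prod_(j < n) ('C(bt j, l j)%:R * 'C(bt' j, l j)%:R) in
    let den : C :=
      'C(a' + N, a')%:R * 'C(b' + N, b')%:R
      * ((N`!)%:R / \prod_(i < p) ((q i)`!)%:R)
      * \prod_(i < p | (i < r)%N) ((q i)`!)%:R in
    let xpart : {mpoly C[m1 + m1]} :=
      \prod_(i < p | (i < r)%N) (x i ^+ (a i + q i) * y i ^+ (b i - q i))
      * \prod_(i < p | (r <= i)%N) (x i ^+ (a i - q i) * y i ^+ (b i - q i))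
      * (x' ^+ (a' + N) * y' ^+ (b' + N)) in
    (num / den) *:
    foldr (fun (j : 'I_n) (f : A) =>
             (-1) ^+ (bt j * l j) *:
             iter (bt j - l j) (theta (lshift n j))
               (iter (bt' j - l j) (theta (rshift n j)) f))
          (of_poly (n + n) xpart) (enum 'I_n).

End Vector.
End HarmonicBasis.

(* Main.v *)
(* Delta and eta commute with osp and span an sl2-triple: [Delta, eta] acts on A_k
   by k - c + 1, and Delta is locally nilpotent. Hence H_k meets eta A_(k-2)
   trivially for k <= c, and in eta^(k-c) H_(2c-k) for k > c.

   A harmonic f is determined by its boundary, the part of f on which x_m or x_(2m)
   does not occur: the other coefficients are obtained by integrating Delta f = 0
   with respect to d/dx_m d/dx_(2m). The basis vectors are the harmonic functions
   with a monomial as boundary.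

   For a suitable nondegenerate form, eta is the adjoint of Delta and osp is stable
   under taking adjoints, so a member of A_k orthogonal to H_k lies in eta A_(k-2).
   Let v = x_m^k (or x_1^(-k)) and v' the same with x_(2m); an element of the Cartan
   algebra isolates their coefficients, so a submodule of H_k either contains v or is
   orthogonal to it. If v generates H_k, then every submodule not contained in the
   image of eta contains v, whence everything for r < m - 1 or k <= n.

   If r = m - 1 and k > n, then v and v' together generate H_k. The submodule
   <v> does not contain v': an element of <v> has, modulo the image of eta, only
   monomials with more x_m than x_(2m). *)

Require Import Defs.
From HB Require Import structures.
From mathcomp Require Import all_boot all_order all_algebra.
From mathcomp Require Import classical_sets reals.
From mathcomp Require Import complex mpoly.
From mathcomp Require Import zify ring.
Import Order.TTheory GRing.Theory Num.Theory.
Local Open Scope classical_set_scope.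
Local Open Scope ring_scope.

Set Implicit Arguments.
Unset Strict Implicit.
Unset Printing Implicit Defensive.

(** The action is a partial Fourier transform of the standard oscillator action: E_(a,b) acts as
    [Zop a \o Dop b], where x_i and d/dx_i are exchanged for i < r, and the relations between these
    operators do not depend on r. Delta and eta are the invariant quadratic forms in the D's and the
    Z's, so their commutation with osp is one computation with signs. The index r enters through
    normal ordering: each product -d_i x_i contributes -1, whence c = n - m + r + 1. Complete
    reducibility fails, and the form is degenerate on H_k for k > c. The shape of the series depends
    on whether x_m^k can be carried to x_(2m)^k inside H_k. This is done through a harmonic monomial
    of degree k free of both variables: x_(r+1)^k for r < m - 1, or theta_1 ... theta_k for k <= n.
    Otherwise neither is available; harmonics whose monomials contain x_m and x_(2m) equally often
    then lie in the image of eta, by hard Lefschetz in the inner variables: there all x_i have i <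
    r, so that the inner part of eta is locally nilpotent. *)

Section Coefficients.
Variables (C : fieldType) (M N : nat).
Local Notation A := (superpoly C M N).
Implicit Types (f g : A) (al : 'X_{1..M}) (S : {set 'I_N}).

(** * Coefficients and the elementary operators *)

Definition cf (al : 'X_{1..M}) (S : {set 'I_N}) (f : A) : C := (f S)@_al.

Lemma cf_is_linear al S : linear_for *%R (cf al S).
Proof. by move=> a f g; rewrite /cf !ffunE mcoeffD mcoeffZ. Qed.

HB.instance Definition _ al S :=
  GRing.isLinear.Build C A C *%R (cf al S) (cf_is_linear al S).

Lemma cfP f g : (forall al S, cf al S f = cf al S g) -> f = g.
Proof. by move=> h; apply/ffunP => S; apply/mpolyP => al; exact: h. Qed.

Lemma xmul_is_linear i : linear (@xmul C M N i).
Proof.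
by move=> a f g; apply/ffunP => S; rewrite !ffunE mulrDr -scalerAr.
Qed.
HB.instance Definition _ i :=
  GRing.isLinear.Build C A A *:%R (xmul i) (@xmul_is_linear i).

Lemma dx_is_linear i : linear (@dx C M N i).
Proof. by move=> a f g; apply/ffunP => S; rewrite !ffunE linearP. Qed.
HB.instance Definition _ i :=
  GRing.isLinear.Build C A A *:%R (dx i) (@dx_is_linear i).

Lemma theta_is_linear p : linear (@theta C M N p).
Proof.
move=> a f g; apply/ffunP => S; rewrite !ffunE; case: ifP => _.
  by rewrite scalerDr !scalerA mulrC.
by rewrite scaler0 addr0.
Qed.
HB.instance Definition _ p :=
  GRing.isLinear.Build C A A *:%R (theta p) (@theta_is_linear p).

Lemma dtheta_is_linear p : linear (@dtheta C M N p).
Proof.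
move=> a f g; apply/ffunP => S; rewrite !ffunE; case: ifP => _.
  by rewrite scaler0 addr0.
by rewrite scalerDr !scalerA mulrC.
Qed.
HB.instance Definition _ p :=
  GRing.isLinear.Build C A A *:%R (dtheta p) (@dtheta_is_linear p).

Lemma cf_xmul i al S f :
  cf al S (xmul i f) = if al i == 0%N then 0 else cf (al - U_(i))%MM S f.
Proof.
rewrite /cf ffunE mulrC; case: eqP => [h|/eqP h].
  rewrite mcoeffM big1 // => k /eqP hk; move/mnmP: hk => /(_ i).
  rewrite mnmDE h => /eqP; rewrite eq_sym addn_eq0 => /andP[_ /eqP h2].
  rewrite mcoeffX; case: eqP => [e|_]; last by rewrite mulr0.
  by move: h2; rewrite -e mnm1E eqxx.
have le : (U_(i) <= al)%MM.
  apply/mnm_lepP => j; rewrite mnm1E; case: eqP => [<-|//].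
  by rewrite lt0n.
by rewrite -{1}(submK le) addmC mcoeffMX.
Qed.

Lemma cf_dx i al S f : cf al S (dx i f) = (al i).+1%:R * cf (al + U_(i))%MM S f.
Proof. by rewrite /cf ffunE mcoeff_deriv mulr_natl. Qed.

Lemma cf_theta p al S f : cf al S (theta p f) =
  if p \in S then theta_sign C p S * cf al (S :\ p)%SET f else 0.
Proof.
by rewrite /cf ffunE; case: ifP => _; rewrite ?mcoeffZ ?mcoeff0.
Qed.

Lemma cf_dtheta p al S f : cf al S (dtheta p f) =
  if p \in S then 0 else theta_sign C p S * cf al (p |: S)%SET f.
Proof.
by rewrite /cf ffunE; case: ifP => _; rewrite ?mcoeffZ ?mcoeff0.
Qed.

Definition elem al S : A := [ffun T => if T == S then 'X_[al] else 0].

Lemma cf_elem al S be T :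
  cf be T (elem al S) = ((be == al) && (T == S))%:R.
Proof.
rewrite /cf ffunE; case: (T == S); first by rewrite mcoeffX andbT eq_sym.
by rewrite mcoeff0 andbF.
Qed.

Lemma elem_expand f :
  f = \sum_S \sum_(al <- msupp (f S)) cf al S f *: elem al S.
Proof.
apply/ffunP => S; rewrite sum_ffunE (bigD1 S) //= [X in _ + X]big1 ?addr0.
  rewrite sum_ffunE [LHS]mpolyE; apply: eq_bigr => al _.
  by rewrite !ffunE eqxx.
move=> T TS; rewrite sum_ffunE big1 // => al _; rewrite !ffunE.
by rewrite eq_sym (negPf TS) scaler0.
Qed.

(** Only the monomials that occur in f have to be treated, so conditions on the degree or the
    support of f are available for each of them. *)
Lemma elem_ind (P : A -> Prop) :
  P 0 -> (forall a f g, P f -> P g -> P (a *: f + g)) ->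
  forall f, (forall al S, cf al S f != 0 -> P (elem al S)) -> P f.
Proof.
move=> P0 Plin f Pel; rewrite (elem_expand f).
have Pa f1 g1 : P f1 -> P g1 -> P (f1 + g1).
  by move=> h1 h2; rewrite -[f1]scale1r; exact: Plin.
elim/big_ind: _ => // S _; rewrite big_seq; elim/big_ind: _ => // al.
by rewrite mcoeff_msupp => h; rewrite -[_ *: _]addr0; apply: Plin => //; apply: Pel.
Qed.

Lemma xmul_elem i al S : xmul i (elem al S) = elem (al + U_(i)) S.
Proof.
apply/ffunP => T; rewrite !ffunE; case: ifP => _; last by rewrite mulr0.
by rewrite -mpolyXD addmC.
Qed.

Lemma dx_elem i al S :
  dx i (elem al S) = (al i)%:R *: elem (al - U_(i)) S.
Proof.
apply/ffunP => T; rewrite !ffunE; case: ifP => _.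
  by rewrite mderivX.
by rewrite mderiv0 scaler0.
Qed.

Lemma theta_elem p al S : theta p (elem al S) =
  if p \in S then 0 else theta_sign C p S *: elem al (p |: S)%SET.
Proof.
apply: cfP => be T; rewrite cf_theta; case: (boolP (p \in T)) => pT; last first.
  case: (boolP (p \in S)) => pS; first by rewrite raddf0.
  rewrite linearZ /= cf_elem; case: (T =P _) => [e|_]; last by rewrite andbF mulr0.
  by move: pT; rewrite e finset.setU11.
rewrite cf_elem; case: (boolP (p \in S)) => pS.
  rewrite raddf0; case: ((_ :\ _)%SET =P _) => [e|_]; last by rewrite andbF mulr0.
  by move: pS; rewrite -e finset.setD11.
rewrite linearZ /= cf_elem.
have -> : (T :\ p == S)%SET = (T == p |: S)%SET.
  by apply/eqP/eqP => [<-|->]; rewrite ?finset.setD1K ?finset.setU1K.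
case: (T =P _) => [->|_]; last by rewrite andbF !mulr0.
by rewrite theta_signU1 // ltnn mul1r.
Qed.

Lemma dtheta_elem p al S : dtheta p (elem al S) =
  if p \in S then theta_sign C p S *: elem al (S :\ p)%SET else 0.
Proof.
apply: cfP => be T; rewrite cf_dtheta; case: (boolP (p \in T)) => pT.
  case: (boolP (p \in S)) => pS; last by rewrite raddf0.
  rewrite linearZ /= cf_elem; case: (T =P _) => [e|_]; last by rewrite andbF mulr0.
  by move: pT; rewrite e finset.setD11.
rewrite cf_elem; case: (boolP (p \in S)) => pS; last first.
  rewrite raddf0; case: ((_ |: _)%SET =P _) => [e|_]; last by rewrite andbF mulr0.
  by move: pS; rewrite -e finset.setU11.
rewrite linearZ /= cf_elem.
have -> : (p |: T == S)%SET = (T == S :\ p)%SET.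
  by apply/eqP/eqP => [<-|->]; rewrite ?finset.setD1K ?finset.setU1K.
case: (T =P _) => [->|_]; last by rewrite andbF !mulr0.
by rewrite theta_signD1 // ltnn mul1r.
Qed.

Lemma xmulN i f : xmul i (- f) = - xmul i f.
Proof. exact: raddfN. Qed.

Lemma dxN i f : dx i (- f) = - dx i f.
Proof. exact: raddfN. Qed.

Lemma thetaN p f : theta p (- f) = - theta p f.
Proof. exact: raddfN. Qed.

Lemma dthetaN p f : dtheta p (- f) = - dtheta p f.
Proof. exact: raddfN. Qed.

Lemma xmul_xmul i j f : xmul i (xmul j f) = xmul j (xmul i f).
Proof. by apply/ffunP => S; rewrite !ffunE mulrCA. Qed.

Lemma dx_dx i j f : dx i (dx j f) = dx j (dx i f).
Proof. by apply/ffunP => S; rewrite !ffunE mderiv_comm. Qed.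

Lemma dx_xmul i j f : dx i (xmul j f) = (i == j)%:R *: f + xmul j (dx i f).
Proof.
apply/ffunP => S; rewrite !ffunE mderivM mderivX; congr (_ + _).
rewrite mnm1E eq_sym; case: eqP => [->|_]; last by rewrite !scale0r mul0r.
by rewrite -{1}[U_(j)%MM]add0m addmK mpolyX0 !scale1r mul1r.
Qed.

Lemma theta_xmul p i f : theta p (xmul i f) = xmul i (theta p f).
Proof.
apply/ffunP => S; rewrite !ffunE; case: ifP => _; last by rewrite mulr0.
by rewrite scalerAr.
Qed.

Lemma dtheta_xmul p i f : dtheta p (xmul i f) = xmul i (dtheta p f).
Proof.
apply/ffunP => S; rewrite !ffunE; case: ifP => _; first by rewrite mulr0.
by rewrite scalerAr.
Qed.

Lemma theta_dx p i f : theta p (dx i f) = dx i (theta p f).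
Proof.
by apply/ffunP => S; rewrite !ffunE; case: ifP => _; rewrite ?linearZ ?linear0.
Qed.

Lemma dtheta_dx p i f : dtheta p (dx i f) = dx i (dtheta p f).
Proof.
by apply/ffunP => S; rewrite !ffunE; case: ifP => _; rewrite ?linearZ ?linear0.
Qed.

Lemma dtheta_dtheta p q f : dtheta p (dtheta q f) = - dtheta q (dtheta p f).
Proof.
apply/ffunP => S; rewrite !ffunE !inE.
case: (eqVneq p q) => [->|pq].
  by rewrite /= scaler0; case: ifP => _; rewrite oppr0.
rewrite /=.
have [pS|pS] := boolP (p \in S); have [qS|qS] := boolP (q \in S);
  rewrite ?scaler0 ?oppr0 //.
rewrite !theta_signU1 // !scalerA -scaleNr finset.setUCA.
congr (_ *: _).
have: (p != q :> nat) by [].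
rewrite neq_ltn => /orP[] h; rewrite h ltnNge (ltnW h) /= expr1 expr0;
  by rewrite !mulN1r !mul1r ?mulrN ?opprK mulrC.
Qed.

End Coefficients.

(* Otherwise unification unfolds the operators down to monomials. *)
#[global] Opaque xmul dx theta dtheta cf elem.

(** * The action through operators with canonical commutation relations *)

Section Oscillators.
Variables (C : fieldType) (M N r : nat).
Local Notation A := (superpoly C M N).
Local Notation I := 'I_(M + N).
Implicit Types (f g : A) (al : 'X_{1..M}) (S : {set 'I_N}) (a b : I).

(* The matrix unit E_(a,b) acts as Zop a \o Dop b: the variables x_i with i < r
   are replaced by d/dx_i and d/dx_i by - x_i. *)
Definition Zop (a : I) (f : A) : A :=
  match split a with
  | inl i => if (i < r)%N then dx i f else xmul i f
  | inr p => theta p f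
  end.

Definition Dop (a : I) (f : A) : A :=
  match split a with
  | inl i => if (i < r)%N then - xmul i f else dx i f
  | inr p => dtheta p f
  end.

Definition odd_index (a : I) : bool := if split a is inr _ then true else false.

Lemma Zop_is_linear a : linear (Zop a).
Proof.
by rewrite /Zop => c f g; case: split => [i|p]; try (case: ifP => _); rewrite linearP.
Qed.
HB.instance Definition _ a :=
  GRing.isLinear.Build C A A *:%R (Zop a) (@Zop_is_linear a).

Lemma Dop_is_linear a : linear (Dop a).
Proof.
rewrite /Dop => c f g; case: split => [i|p]; try (case: ifP => _); rewrite linearP //.
by rewrite opprD scalerN.
Qed.
HB.instance Definition _ a :=
  GRing.isLinear.Build C A A *:%R (Dop a) (@Dop_is_linear a).

Lemma ZopP a z f g : Zop a (z *: f + g) = z *: Zop a f + Zop a g.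
Proof. exact: linearP. Qed.
Lemma ZopZ a z f : Zop a (z *: f) = z *: Zop a f.
Proof. exact: linearZ. Qed.
Lemma ZopD a f g : Zop a (f + g) = Zop a f + Zop a g.
Proof. exact: linearD. Qed.
Lemma DopP a z f g : Dop a (z *: f + g) = z *: Dop a f + Dop a g.
Proof. exact: linearP. Qed.
Lemma DopZ a z f : Dop a (z *: f) = z *: Dop a f.
Proof. exact: linearZ. Qed.
Lemma DopD a f g : Dop a (f + g) = Dop a f + Dop a g.
Proof. exact: linearD. Qed.

Lemma split_lshift' (i : 'I_M) : split (lshift N i) = inl i.
Proof. by rewrite -[lshift N i]/(unsplit (inl i)) unsplitK. Qed.

Lemma split_rshift' (p : 'I_N) : split (rshift M p) = inr p.
Proof. by rewrite -[rshift M p]/(unsplit (inr p)) unsplitK. Qed.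

Lemma Zop_x (i : 'I_M) f :
  Zop (lshift N i) f = if (i < r)%N then dx i f else xmul i f.
Proof. by rewrite /Zop split_lshift'. Qed.

Lemma Zop_theta (p : 'I_N) f : Zop (rshift M p) f = theta p f.
Proof. by rewrite /Zop split_rshift'. Qed.

Lemma Dop_x (i : 'I_M) f :
  Dop (lshift N i) f = if (i < r)%N then - xmul i f else dx i f.
Proof. by rewrite /Dop split_lshift'. Qed.

Lemma Dop_theta (p : 'I_N) f : Dop (rshift M p) f = dtheta p f.
Proof. by rewrite /Dop split_rshift'. Qed.

Lemma odd_x (i : 'I_M) : odd_index (lshift N i) = false.
Proof. by rewrite /odd_index split_lshift'. Qed.

Lemma odd_theta (p : 'I_N) : odd_index (rshift M p) = true.
Proof. by rewrite /odd_index split_rshift'. Qed.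

Let opE := (Zop_x, Dop_x, Zop_theta, Dop_theta, odd_x, odd_theta).

Definition ssign (b : bool) : C := (-1) ^+ b.

Lemma ZopZop a b f :
  Zop a (Zop b f) = ssign (odd_index a && odd_index b) *: Zop b (Zop a f).
Proof.
rewrite /ssign.
case: (split_ordP a) => [i|p] ->; case: (split_ordP b) => [j|q] ->; rewrite !opE ?scale1r.
- case: ifP => hi; case: ifP => hj; first exact: dx_dx; last exact: xmul_xmul;
    rewrite dx_xmul; case: eqP => [e|_]; rewrite ?scale0r ?add0r //;
    by move: hi hj; rewrite e => ->.
- by case: ifP => hi; rewrite ?theta_dx ?theta_xmul.
- by case: ifP => hi; rewrite ?theta_dx ?theta_xmul.
- by rewrite scaleN1r theta_theta.
Qed.

Lemma DopDop a b f :
  Dop a (Dop b f) = ssign (odd_index a && odd_index b) *: Dop b (Dop a f).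
Proof.
rewrite /ssign.
case: (split_ordP a) => [i|p] ->; case: (split_ordP b) => [j|q] ->; rewrite !opE ?scale1r.
- case: ifP => hi; case: ifP => hj; rewrite ?xmulN ?dxN.
  + by rewrite xmul_xmul.
  + rewrite dx_xmul; case: eqP => [e|_]; rewrite ?scale0r ?add0r //;
      by move: hi hj; rewrite e => ->.
  + rewrite dx_xmul; case: eqP => [e|_]; rewrite ?scale0r ?add0r //;
      by move: hi hj; rewrite e => ->.
  + by rewrite dx_dx.
- by case: ifP => hi; rewrite ?(xmulN, dxN, thetaN, dthetaN) ?dtheta_dx ?dtheta_xmul.
- by case: ifP => hi; rewrite ?(xmulN, dxN, thetaN, dthetaN) ?dtheta_dx ?dtheta_xmul.
- by rewrite scaleN1r dtheta_dtheta.
Qed.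

(** The relations are the same for i < r, because the substitution x_i -> d_i, d_i -> - x_i is
    symplectic. *)
Lemma DopZop a b f : Dop a (Zop b f) =
  (a == b)%:R *: f + ssign (odd_index a && odd_index b) *: Zop b (Dop a f).
Proof.
rewrite /ssign.
case: (split_ordP a) => [i|p] ->; case: (split_ordP b) => [j|q] ->; rewrite !opE ?scale1r.
- rewrite (inj_eq (@lshift_inj _ _)).
  case: (eqVneq i j) => [<-|ij].
    rewrite !scale1r; case: (i < r)%N; rewrite ?dxN dx_xmul eqxx scale1r //.
    by rewrite opprD addrA subrr add0r.
  rewrite scale0r add0r.
  case: ifP => hi; case: ifP => hj; rewrite ?xmulN ?dxN.
  + by rewrite dx_xmul eq_sym (negPf ij) scale0r add0r.
  + by rewrite xmul_xmul.
  + by rewrite dx_dx.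
  + by rewrite dx_xmul (negPf ij) scale0r add0r.
- rewrite eq_lrshift scale0r add0r.
  by case: ifP => hi; rewrite ?(xmulN, dxN, thetaN, dthetaN) ?theta_dx ?theta_xmul.
- rewrite eq_rlshift scale0r add0r.
  by case: ifP => hi; rewrite ?(xmulN, dxN, thetaN, dthetaN) ?dtheta_dx ?dtheta_xmul.
- by rewrite (inj_eq (@rshift_inj _ _)) dtheta_theta scaleN1r.
Qed.

(** The change that [Zop a] makes to the exponent of the variable a. Taken as a weight, it is the
    degree that defines the spaces [A_ k]. *)
Definition zsign (a : I) : int :=
  if split a is inl i then if (i < r)%N then -1 else 1 else 1.

Lemma zsign_x (i : 'I_M) : zsign (lshift N i) = if (i < r)%N then -1 else 1.
Proof. by rewrite /zsign split_lshift'. Qed.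

Lemma zsign_theta (p : 'I_N) : zsign (rshift M p) = 1.
Proof. by rewrite /zsign split_rshift'. Qed.

Section Weights.
Variable om : I -> int.

(** The total degree, the exponents of x_m and x_(2m), their difference and the weights that bound
    nilpotency are all instances for some [om], so the effect of the operators on them is computed
    only once. *)
Definition wt al S : int :=
  \sum_(i < M) om (lshift N i) * (al i)%:Z
  + \sum_(p < N) om (rshift M p) * (p \in S)%:Z.

Lemma wtDU al i S : wt (al + U_(i))%MM S = wt al S + om (lshift N i).
Proof.
rewrite /wt [in RHS]addrAC; congr (_ + _).
rewrite [LHS](bigD1 i) // [in RHS](bigD1 i) //= [RHS]addrAC.
congr (_ + _); first by rewrite mnmDE mnm1E eqxx PoszD mulrDr mulr1.
by apply: eq_bigr => j ji; rewrite mnmDE mnm1E eq_sym (negPf ji) addn0.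
Qed.

Lemma wtBU al i S : al i != 0%N ->
  wt (al - U_(i))%MM S = wt al S - om (lshift N i).
Proof. by rewrite -lep1mP => h; rewrite -[in RHS](submK h) wtDU addrK. Qed.

Lemma wt_setU al p S : p \notin S ->
  wt al (p |: S)%SET = wt al S + om (rshift M p).
Proof.
move=> pS; rewrite /wt -addrA; congr (_ + _).
rewrite [LHS](bigD1 p) // [in RHS](bigD1 p) //= (negPf pS) mulr0 add0r addrC.
rewrite finset.setU11 mulr1; congr (_ + _).
by apply: eq_bigr => q qp; rewrite !inE (negPf qp).
Qed.

Lemma wt_setD al p S : p \in S ->
  wt al (S :\ p)%SET = wt al S - om (rshift M p).
Proof.
move=> pS; rewrite -{2}(finset.setD1K pS) wt_setU ?addrK //.
by rewrite finset.setD11.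
Qed.

Definition supp (Q : 'X_{1..M} -> {set 'I_N} -> Prop) f :=
  forall al S, cf al S f != 0 -> Q al S.

Lemma supp0 Q : supp Q 0.
Proof. by move=> al S; rewrite raddf0 eqxx. Qed.

Lemma suppP Q c f g : supp Q f -> supp Q g -> supp Q (c *: f + g).
Proof.
move=> hf hg al S; rewrite linearP /=.
case: (eqVneq (cf al S f) 0) => [->|/hf //]; rewrite mulr0 add0r; exact: hg.
Qed.

Lemma suppD Q f g : supp Q f -> supp Q g -> supp Q (f + g).
Proof. by rewrite -{2}[f]scale1r; exact: suppP. Qed.

Lemma suppZ Q c f : supp Q f -> supp Q (c *: f).
Proof. by move=> h; rewrite -[_ *: f]addr0; apply: suppP => //; exact: supp0. Qed.

Lemma suppB Q f g : supp Q f -> supp Q g -> supp Q (f - g).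
Proof. by move=> hf hg; rewrite addrC -scaleN1r; exact: suppP. Qed.

Lemma supp_sum Q (J : Type) (s : seq J) (P : pred J) (F : J -> A) :
  (forall j, P j -> supp Q (F j)) -> supp Q (\sum_(j <- s | P j) F j).
Proof.
by move=> h; elim/big_ind: _ => //; [exact: supp0|exact: suppD].
Qed.

Lemma sub_supp (Q Q' : 'X_{1..M} -> {set 'I_N} -> Prop) f :
  (forall al S, Q al S -> Q' al S) -> supp Q f -> supp Q' f.
Proof. by move=> h hf al S /hf; exact: h. Qed.

Lemma supp_elem Q al S : Q al S -> supp Q (elem C al S).
Proof.
move=> h be T; rewrite cf_elem; case: andP => [[/eqP -> /eqP ->] //|_].
by rewrite eqxx.
Qed.

Variable Q : int -> Prop.

Lemma supp_xmul i f : supp (fun al S => Q (wt al S)) f ->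
  supp (fun al S => Q (wt al S - om (lshift N i))) (xmul i f).
Proof.
move=> h al S; rewrite cf_xmul; case: (eqVneq (al i) 0%N) => [_|hi].
  by rewrite eqxx.
by move/h; rewrite wtBU.
Qed.

Lemma supp_dx i f : supp (fun al S => Q (wt al S)) f ->
  supp (fun al S => Q (wt al S + om (lshift N i))) (dx i f).
Proof.
move=> h al S; rewrite cf_dx mulf_eq0 negb_or => /andP[_ /h].
by rewrite wtDU.
Qed.

Lemma supp_theta p f : supp (fun al S => Q (wt al S)) f ->
  supp (fun al S => Q (wt al S - om (rshift M p))) (theta p f).
Proof.
move=> h al S; rewrite cf_theta; case: ifP => [pS|_]; last by rewrite eqxx.
by rewrite mulf_eq0 negb_or => /andP[_ /h]; rewrite wt_setD.
Qed.

Lemma supp_dtheta p f : supp (fun al S => Q (wt al S)) f ->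
  supp (fun al S => Q (wt al S + om (rshift M p))) (dtheta p f).
Proof.
move=> h al S; rewrite cf_dtheta; case: ifP => [_|/negbT pS].
  by rewrite eqxx.
by rewrite mulf_eq0 negb_or => /andP[_ /h]; rewrite wt_setU.
Qed.

Lemma supp_Zop a f : supp (fun al S => Q (wt al S)) f ->
  supp (fun al S => Q (wt al S - zsign a * om a)) (Zop a f).
Proof.
case: (split_ordP a) => [i|p] -> h.
  rewrite Zop_x zsign_x; case: ifP => _; first by rewrite mulN1r opprK; exact: supp_dx.
  by rewrite mul1r; exact: supp_xmul.
by rewrite Zop_theta zsign_theta mul1r; exact: supp_theta.
Qed.

Lemma supp_Dop a f : supp (fun al S => Q (wt al S)) f ->
  supp (fun al S => Q (wt al S + zsign a * om a)) (Dop a f).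
Proof.
case: (split_ordP a) => [i|p] -> h.
  rewrite Dop_x zsign_x; case: ifP => _.
    rewrite mulN1r -scaleN1r; apply: suppZ; exact: supp_xmul.
  by rewrite mul1r; exact: supp_dx.
by rewrite Dop_theta zsign_theta mul1r; exact: supp_dtheta.
Qed.

End Weights.

(* The eigenvalue of Zop a \o Dop a. *)
Definition occ a al S : int :=
  match split a with
  | inl i => if (i < r)%N then - (al i).+1%:Z else (al i)%:Z
  | inr p => (p \in S)%:Z
  end.

Lemma occ_x (i : 'I_M) al S :
  occ (lshift N i) al S = if (i < r)%N then - (al i).+1%:Z else (al i)%:Z.
Proof. by rewrite /occ split_lshift'. Qed.

Lemma occ_theta (p : 'I_N) al S : occ (rshift M p) al S = (p \in S)%:Z.
Proof. by rewrite /occ split_rshift'. Qed.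

Lemma cf_ZopDop a al S f :
  cf al S (Zop a (Dop a f)) = (occ a al S)%:~R * cf al S f.
Proof.
case: (split_ordP a) => [i|p] ->.
  (* For i < r the product is - d_i x_i, with eigenvalue - (al i + 1). This shift by one is the
     source of the summand r in the critical value. *)
  rewrite Zop_x Dop_x occ_x; case: (i < r)%N.
    rewrite cf_dx raddfN /= cf_xmul mnmDE mnm1E eqxx addn1 /= addmK.
    by rewrite mulrN mulrNz mulNr.
  rewrite cf_xmul; case: eqP => [->|/eqP h]; first by rewrite mul0r.
  rewrite cf_dx submK ?lep1mP // mnmBE mnm1E eqxx subn1 prednK // lt0n //.
rewrite Zop_theta Dop_theta occ_theta cf_theta; case: ifP => pS; last by rewrite mul0r.
rewrite cf_dtheta finset.setD11 finset.setD1K // mulrA theta_signD1 // ltnn mul1r.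
by rewrite theta_sign_sq.
Qed.

End Oscillators.

#[global] Opaque Zop Dop.

(** * The Lie superalgebra osp, entry by entry *)

Section Orthosymplectic.
Variables (C : fieldType) (m n r : nat).
Local Notation A := (superpoly C (m + m) (n + n)).
Local Notation I := 'I_((m + m) + (n + n)).
Local Notation gl := 'M[C]_((m + m) + (n + n)).
Local Notation Z := (@Zop C (m + m) (n + n) r).
Local Notation D := (@Dop C (m + m) (n + n) r).
Local Notation odd := (@odd_index (m + m) (n + n)).
Implicit Types (f g : A) (a b c d : I).

Definition ix (i : 'I_m) : I := lshift (n + n) (lshift m i).
Definition iy (i : 'I_m) : I := lshift (n + n) (rshift m i).
Definition iT (j : 'I_n) : I := rshift (m + m) (lshift n j).
Definition iS (j : 'I_n) : I := rshift (m + m) (rshift n j).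

Variant index_spec : I -> Type :=
  | IndexX i : index_spec (ix i)
  | IndexY i : index_spec (iy i)
  | IndexT j : index_spec (iT j)
  | IndexS j : index_spec (iS j).

Lemma indexP a : index_spec a.
Proof.
case: (split_ordP a) => i ->; case: (split_ordP i) => j ->; constructor.
Qed.

(* The dual index with respect to the invariant form. *)
Definition star a : I :=
  match split a with
  | inl i => lshift (n + n)
      (match split i with inl j => rshift m j | inr j => lshift m j end)
  | inr i => rshift (m + m)
      (match split i with inl j => rshift n j | inr j => lshift n j end)
  end.

Definition lower_theta a : bool :=
  if split a is inr i then if split i is inl _ then true else false else false.

Lemma star_x i : star (ix i) = iy i.
Proof. by rewrite /star /ix !split_lshift'. Qed.
Lemma star_y i : star (iy i) = ix i.
Proof. by rewrite /star /iy split_lshift' split_rshift'. Qed.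
Lemma star_t j : star (iT j) = iS j.
Proof. by rewrite /star /iT split_rshift' split_lshift'. Qed.
Lemma star_s j : star (iS j) = iT j.
Proof. by rewrite /star /iS !split_rshift'. Qed.
Definition starE := (star_x, star_y, star_t, star_s).

Lemma starK : involutive star.
Proof. by move=> a; case: (indexP a) => i; rewrite !starE. Qed.

Lemma lower_x i : lower_theta (ix i) = false.
Proof. by rewrite /lower_theta /ix !split_lshift'. Qed.
Lemma lower_y i : lower_theta (iy i) = false.
Proof. by rewrite /lower_theta /iy split_lshift'. Qed.
Lemma lower_t j : lower_theta (iT j) = true.
Proof. by rewrite /lower_theta /iT split_rshift' split_lshift'. Qed.
Lemma lower_s j : lower_theta (iS j) = false.
Proof. by rewrite /lower_theta /iS !split_rshift'. Qed.

Lemma odd_ix i : odd (ix i) = false. Proof. exact: odd_x. Qed.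
Lemma odd_iy i : odd (iy i) = false. Proof. exact: odd_x. Qed.
Lemma odd_iT i : odd (iT i) = true. Proof. exact: odd_theta. Qed.
Lemma odd_iS i : odd (iS i) = true. Proof. exact: odd_theta. Qed.

Lemma eq_xx i j : (ix i == ix j) = (i == j).
Proof. by rewrite (inj_eq (@lshift_inj _ _)) (inj_eq (@lshift_inj _ _)). Qed.
Lemma eq_yy i j : (iy i == iy j) = (i == j).
Proof. by rewrite (inj_eq (@lshift_inj _ _)) (inj_eq (@rshift_inj _ _)). Qed.
Lemma eq_tt i j : (iT i == iT j) = (i == j).
Proof. by rewrite (inj_eq (@rshift_inj _ _)) (inj_eq (@lshift_inj _ _)). Qed.
Lemma eq_ss i j : (iS i == iS j) = (i == j).
Proof. by rewrite (inj_eq (@rshift_inj _ _)) (inj_eq (@rshift_inj _ _)). Qed.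
Lemma eq_xy i j : (ix i == iy j) = false.
Proof. by rewrite (inj_eq (@lshift_inj _ _)) eq_lrshift. Qed.
Lemma eq_yx i j : (iy i == ix j) = false.
Proof. by rewrite (inj_eq (@lshift_inj _ _)) eq_rlshift. Qed.
Lemma eq_ts i j : (iT i == iS j) = false.
Proof. by rewrite (inj_eq (@rshift_inj _ _)) eq_lrshift. Qed.
Lemma eq_st i j : (iS i == iT j) = false.
Proof. by rewrite (inj_eq (@rshift_inj _ _)) eq_rlshift. Qed.
Lemma eq_xt i j : (ix i == iT j) = false. Proof. exact: eq_lrshift. Qed.
Lemma eq_xs i j : (ix i == iS j) = false. Proof. exact: eq_lrshift. Qed.
Lemma eq_yt i j : (iy i == iT j) = false. Proof. exact: eq_lrshift. Qed.
Lemma eq_ys i j : (iy i == iS j) = false. Proof. exact: eq_lrshift. Qed.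
Lemma eq_tx i j : (iT j == ix i) = false. Proof. exact: eq_rlshift. Qed.
Lemma eq_sx i j : (iS j == ix i) = false. Proof. exact: eq_rlshift. Qed.
Lemma eq_ty i j : (iT j == iy i) = false. Proof. exact: eq_rlshift. Qed.
Lemma eq_sy i j : (iS j == iy i) = false. Proof. exact: eq_rlshift. Qed.
Definition eq_indexE := (eq_xx, eq_yy, eq_tt, eq_ss, eq_xy, eq_yx, eq_ts, eq_st,
  eq_xt, eq_xs, eq_yt, eq_ys, eq_tx, eq_sx, eq_ty, eq_sy).

Definition indexE := (starE, (lower_x, lower_y, lower_t, lower_s),
  (odd_ix, odd_iy, odd_iT, odd_iS), eq_indexE).

Lemma odd_star a : odd (star a) = odd a.
Proof. by case: (indexP a) => i; rewrite !indexE. Qed.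

Definition sgs a : C := ssign C (lower_theta a).

Lemma ssignM (b1 b2 : bool) : ssign C b1 * ssign C b2 = ssign C (b1 (+) b2).
Proof. by rewrite /ssign -signr_addb. Qed.

Lemma ssign_sq (b : bool) : ssign C b * ssign C b = 1.
Proof. by rewrite ssignM addbb. Qed.

Lemma sgs_sq a : sgs a * sgs a = 1. Proof. exact: ssign_sq. Qed.

(** The sign of the supertranspose with respect to the invariant form, which is symmetric on the
    even indices and alternating on the odd ones. *)
Definition eps a b : C := ssign C (odd a && odd b) * sgs a * sgs (star b).

Lemma eps_star a b : eps (star b) (star a) = eps a b.
Proof. by rewrite /eps !odd_star starK andbC mulrAC. Qed.

Lemma eps_sq a b : eps a b * eps a b = 1.
Proof. by rewrite /eps mulrACA sgs_sq mulr1 mulrACA sgs_sq mulr1 ssign_sq. Qed.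

Definition osp_entries (X : gl) : Prop :=
  forall a b, X a b = - eps a b * X (star b) (star a).

(** Trades the sixteen blocks for one skewness relation between an entry and its dual, which later
    sums over indices can use without a case distinction. *)
Lemma ospP X : @osp C m n X <-> osp_entries X.
Proof.
split.
  move=> [X11 [X12 [X21 [D' [E [F [H [H1 [K [K1 [hB hC hE hF ->]]]]]]]]]]] a b.
  have hB' i j : X12 i j = - X12 j i by rewrite [in LHS]hB !mxE.
  have hC' i j : X21 i j = - X21 j i by rewrite [in LHS]hC !mxE.
  have hE' i j : E i j = E j i by rewrite [in LHS]hE !mxE.
  have hF' i j : F i j = F j i by rewrite [in LHS]hF !mxE.
  case: (indexP a) => i; case: (indexP b) => j;
    rewrite /eps /sgs !indexE /ssign /ix /iy /iT /iS
      ?(block_mxEul, block_mxEur, block_mxEdl, block_mxEdr) ?mxE /=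
      ?(expr0, expr1, mul1r, mulr1, mulrN1, mulNr, opprK) //.
move=> h.
exists (\matrix_(i, j) X (ix i) (ix j)), (\matrix_(i, j) X (ix i) (iy j)),
  (\matrix_(i, j) X (iy i) (ix j)), (\matrix_(i, j) X (iT i) (iT j)),
  (\matrix_(i, j) X (iT i) (iS j)), (\matrix_(i, j) X (iS i) (iT j)),
  (\matrix_(i, j) X (ix i) (iT j)), (\matrix_(i, j) X (ix i) (iS j)),
  (\matrix_(i, j) X (iy i) (iT j)), (\matrix_(i, j) X (iy i) (iS j)).
split; try (apply/matrixP => i j; rewrite !mxE h /eps /sgs !indexE /ssign /=
      ?(expr0, expr1, mul1r, mulr1, mulrN1, mulNr, opprK) //; fail).
apply/matrixP => a b.
case: (indexP a) => i; case: (indexP b) => j;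
    rewrite {2}/ix {2}/iy {2}/iT {2}/iS
      ?(block_mxEul, block_mxEur, block_mxEdl, block_mxEdr) ?mxE //;
  rewrite h /eps /sgs !indexE /ssign /=
      ?(expr0, expr1, mul1r, mulr1, mulrN1, mulNr, opprK) //.
Qed.

(** The constant - delta_(i,j) in the action for i, j < r is what appears when d_i is moved past x_j
    in - d_i x_j. *)
Lemma gl_unit_actE a b f : gl_unit_act r a b f = Z a (D b f).
Proof.
rewrite /gl_unit_act; case: (split_ordP a) => i ->; case: (split_ordP b) => j ->;
  rewrite ?Zop_x ?Zop_theta ?Dop_x ?Dop_theta ?(inj_eq (@lshift_inj _ _)).
- case: (i < r)%N; case: (j < r)%N => //; last by rewrite xmulN.
  by rewrite dxN dx_xmul opprD addrC.
- by [].
- by case: (j < r)%N => //; rewrite thetaN.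
- by [].
Qed.

Lemma gl_actE X f : gl_act r X f = \sum_a \sum_b X a b *: Z a (D b f).
Proof. by do 2 (apply: eq_bigr => ? _); rewrite gl_unit_actE. Qed.

Lemma gl_act_is_linear X : linear (@gl_act C m n r X).
Proof.
move=> c f g; rewrite !gl_actE scaler_sumr -big_split; apply: eq_bigr => a _.
rewrite scaler_sumr -big_split; apply: eq_bigr => b _ /=.
by rewrite DopP ZopP scalerDr !scalerA mulrC.
Qed.
HB.instance Definition _ X :=
  GRing.isLinear.Build C A A *:%R (gl_act r X) (@gl_act_is_linear X).

Lemma gl_actP (z : C) (X Y : gl) f :
  gl_act r (z *: X + Y) f = z *: gl_act r X f + gl_act r Y f.
Proof.
rewrite !gl_actE scaler_sumr -big_split; apply: eq_bigr => a _.
rewrite scaler_sumr -big_split; apply: eq_bigr => b _ /=.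
by rewrite !mxE scalerDl scalerA.
Qed.

Lemma gl_act_delta a b f : gl_act r (delta_mx a b) f = Z a (D b f).
Proof.
rewrite gl_actE (bigD1 a) //= (bigD1 b) //= mxE !eqxx scale1r big1 ?addr0.
  rewrite big1 ?addr0 // => a' h; rewrite big1 // => b' _.
  by rewrite mxE (negPf h) scale0r.
by move=> b' h; rewrite mxE (negPf h) andbF scale0r.
Qed.

(** Twice the projection of a matrix unit to osp. These elements serve to move explicitly from one
    monomial to another. *)
Definition osp_gen a b : gl := - eps a b *: delta_mx (star b) (star a) + delta_mx a b.

Lemma osp_gen_osp a b : @osp C m n (osp_gen a b).
Proof.
apply/ospP => a' b'; rewrite !mxE.
rewrite ![star _ == star _](inj_eq (inv_inj starK)).
have e x y : (star x == y) = (x == star y) by rewrite (inv_eq starK).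
rewrite !e mulrDr [in RHS]addrC (andbC (b' == star a)) (andbC (b' == b)).
congr (_ + _).
  case: andP => [[/eqP -> /eqP ->]|_]; last by rewrite !mulr0.
  by rewrite eps_star.
case: andP => [[/eqP -> /eqP ->]|_]; last by rewrite !mulr0.
by rewrite mulr1 mulrNN eps_sq.
Qed.

Lemma gl_act_gen a b f :
  gl_act r (osp_gen a b) f = Z a (D b f) - eps a b *: Z (star b) (D (star a) f).
Proof. by rewrite gl_actP !gl_act_delta addrC scaleNr. Qed.

End Orthosymplectic.

(** * Delta and eta as invariant quadratic forms *)

Section Laplacian.
Variables (C : fieldType) (m n r : nat).
Local Notation A := (superpoly C (m + m) (n + n)).
Local Notation I := 'I_((m + m) + (n + n)).
Local Notation Z := (@Zop C (m + m) (n + n) r).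
Local Notation D := (@Dop C (m + m) (n + n) r).
Local Notation odd := (@odd_index (m + m) (n + n)).
Implicit Types (f g : A) (a b c d : I) (Q : pred 'I_m).

(** The predicate Q allows the pair x_m, x_(2m) to be left out; the inner operators so obtained are
    needed besides Delta and eta. *)
Definition lap Q f : A :=
  \sum_(i | Q i) D (ix n i) (D (iy n i) f) + \sum_j D (iT m j) (D (iS m j) f).

Definition mulform Q f : A :=
  \sum_(i | Q i) Z (ix n i) (Z (iy n i) f) + \sum_j Z (iT m j) (Z (iS m j) f).

Lemma lap_is_linear Q : linear (lap Q).
Proof.
move=> z f g; rewrite /lap scalerDr addrACA !scaler_sumr -!big_split.
by congr (_ + _); apply: eq_bigr => i _; rewrite DopP DopP.
Qed.
HB.instance Definition _ Q := GRing.isLinear.Build C A A *:%R (lap Q) (lap_is_linear Q).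

Lemma mulform_is_linear Q : linear (mulform Q).
Proof.
move=> z f g; rewrite /mulform scalerDr addrACA !scaler_sumr -!big_split.
by congr (_ + _); apply: eq_bigr => i _; rewrite ZopP ZopP.
Qed.
HB.instance Definition _ Q :=
  GRing.isLinear.Build C A A *:%R (mulform Q) (mulform_is_linear Q).

Lemma Delta_lap f : (r <= m)%N -> Delta r f = lap xpredT f.
Proof.
move=> rm; rewrite /Delta /lap; congr (_ + _); last first.
  by apply: eq_bigr => j _; rewrite !Dop_theta.
rewrite [RHS](bigID (fun i : 'I_m => (i < r)%N)) /= -sumrN; congr (_ + _).
  apply: eq_bigr => i hi; rewrite !Dop_x /= hi ifF //.
  by apply/negbTE; rewrite -leqNgt (leq_trans rm) // leq_addr.
apply: eq_big => [i|i hi]; first by rewrite -leqNgt.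
rewrite !Dop_x /= !ifF //; apply/negbTE; rewrite -leqNgt //.
by rewrite (leq_trans rm) // leq_addr.
Qed.

Lemma eta_mulform f : (r <= m)%N -> eta_op r f = mulform xpredT f.
Proof.
move=> rm; rewrite /eta_op /mulform; congr (_ + _); last first.
  by apply: eq_bigr => j _; rewrite !Zop_theta.
rewrite [RHS](bigID (fun i : 'I_m => (i < r)%N)) /=; congr (_ + _).
  apply: eq_bigr => i hi; rewrite !Zop_x /= hi ifF //.
    by rewrite dx_xmul eq_lrshift scale0r add0r.
  by apply/negbTE; rewrite -leqNgt (leq_trans rm) // leq_addr.
apply: eq_big => [i|i hi]; first by rewrite -leqNgt.
rewrite !Zop_x /= !ifF //; apply/negbTE; rewrite -leqNgt //.
by rewrite (leq_trans rm) // leq_addr.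
Qed.

Definition in_form Q a : bool :=
  match split a with
  | inl i => match split i with inl j => Q j | inr j => Q j end
  | inr _ => true
  end.

Lemma in_form_x Q i : in_form Q (ix n i) = Q i.
Proof. by rewrite /in_form /ix !split_lshift'. Qed.
Lemma in_form_y Q i : in_form Q (iy n i) = Q i.
Proof. by rewrite /in_form /iy split_lshift' split_rshift'. Qed.
Lemma in_form_t Q j : in_form Q (iT m j) = true.
Proof. by rewrite /in_form /iT split_rshift'. Qed.
Lemma in_form_s Q j : in_form Q (iS m j) = true.
Proof. by rewrite /in_form /iS split_rshift'. Qed.
Lemma in_formT a : in_form xpredT a.
Proof. by rewrite /in_form; case: split => // i; case: split. Qed.

Definition in_formE := (in_form_x, in_form_y, in_form_t, in_form_s).

Lemma sum_delta_l (J : finType) (P : pred J) (j : J) (V : lmodType C) (F : J -> V) :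
  \sum_(i | P i) (j == i)%:R *: F i = (P j)%:R *: F j.
Proof.
case: (boolP (P j)) => hj.
  rewrite (bigD1 j) //= eqxx big1 ?addr0 // => i /andP[_ h].
  by rewrite eq_sym (negPf h) scale0r.
rewrite scale0r big1 // => i hi; case: eqP => [e|_]; last exact: scale0r.
by move: hj; rewrite e hi.
Qed.

Lemma DZZ a b c f : odd b = odd c -> D a (Z b (Z c f)) =
  (a == b)%:R *: Z c f + ssign C (odd a && odd b) *: ((a == c)%:R *: Z b f)
  + Z b (Z c (D a f)).
Proof.
move=> e; rewrite DopZop DopZop ZopP scalerDr addrA; congr (_ + _).
by rewrite ZopZ scalerA -e ssign_sq scale1r.
Qed.

Lemma DDZ a b c f : odd b = odd c -> D b (D c (Z a f)) =
  Z a (D b (D c f)) + (c == a)%:R *: D b f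
  + ssign C (odd a && odd b) *: ((b == a)%:R *: D c f).
Proof.
move=> e; rewrite DopZop DopP DopZ DopZop.
rewrite scalerDr [X in _ + (_ + X) = _]scalerA -e (andbC (odd a)) ssign_sq scale1r.
by rewrite addrA [LHS]addrC addrA.
Qed.

Lemma scale_false (V : lmodType C) (v : V) : (false%:R : C) *: v = 0.
Proof. exact: scale0r. Qed.

(** The commutator is a partial derivative of the quadratic form: a occurs in one pair only, and the
    partner in this pair survives. The sign arises when the second odd factor of a pair is the one
    removed. *)
Lemma Dop_mulform Q a f : D a (mulform Q f) =
  mulform Q (D a f) + ((in_form Q a)%:R * sgs C (star a)) *: Z (star a) f.
Proof.
rewrite /mulform raddfD !raddf_sum /=.
under eq_bigr => i _ do rewrite DZZ ?indexE // addrC.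
under [X in _ + X]eq_bigr => i _ do rewrite DZZ ?indexE // addrC.
rewrite !big_split /= addrACA; congr (_ + _).
case: (indexP a) => i; rewrite /sgs !indexE in_formE /ssign ?expr0 ?expr1 ?mulr1.
- under [X in X + _ + _]eq_bigr => j _ do rewrite !indexE.
  rewrite sum_delta_l !big1 ?(addr0, add0r) //;
    by move=> j _; rewrite !indexE scale_false ?scaler0.
- under [X in _ + X + _]eq_bigr => j _ do rewrite !indexE scale1r.
  rewrite sum_delta_l !big1 ?(addr0, add0r) //;
    by move=> j _; rewrite !indexE scale_false ?scaler0.
- under [X in _ + (X + _)]eq_bigr => j _ do rewrite !indexE.
  rewrite sum_delta_l !big1 ?(addr0, add0r) //;
    by move=> j _; rewrite !indexE scale_false ?scaler0.
- under [X in _ + (_ + X)]eq_bigr => j _ do rewrite !indexE scaleN1r.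
  rewrite sumrN sum_delta_l !big1 ?(addr0, add0r) ?mulrN1 ?scaleNr //;
    by move=> j _; rewrite !indexE scale_false ?scaler0.
Qed.

Lemma lap_Zop Q a f : lap Q (Z a f) =
  Z a (lap Q f) + ((in_form Q a)%:R * sgs C a) *: D (star a) f.
Proof.
rewrite /lap raddfD !raddf_sum /=.
under eq_bigr => i _ do rewrite DDZ ?indexE // -addrA.
under [X in _ + X]eq_bigr => i _ do rewrite DDZ ?indexE // -addrA.
rewrite !big_split /= addrACA; congr (_ + _).
have es (J : eqType) (x y : J) : (x == y)%:R = (y == x)%:R :> C by rewrite eq_sym.
case: (indexP a) => i; rewrite /sgs !indexE in_formE /ssign ?expr0 ?expr1 ?mulr1.
- under [X in _ + X + _]eq_bigr => j _ do rewrite !indexE scale1r es.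
  rewrite sum_delta_l !big1 ?(addr0, add0r) //;
    by move=> j _; rewrite !indexE scale_false ?scaler0.
- under [X in X + _ + _]eq_bigr => j _ do rewrite !indexE es.
  rewrite sum_delta_l !big1 ?(addr0, add0r) //;
    by move=> j _; rewrite !indexE scale_false ?scaler0.
- under [X in _ + (_ + X)]eq_bigr => j _ do rewrite !indexE scaleN1r es.
  rewrite sumrN sum_delta_l !big1 ?(addr0, add0r) ?mulrN1 ?scaleNr //;
    by move=> j _; rewrite !indexE scale_false ?scaler0.
- under [X in _ + (X + _)]eq_bigr => j _ do rewrite !indexE es.
  rewrite sum_delta_l !big1 ?(addr0, add0r) //;
    by move=> j _; rewrite !indexE scale_false ?scaler0.
Qed.

Lemma lap_Dop Q a f : lap Q (D a f) = D a (lap Q f).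
Proof.
have h b c : odd b = odd c -> D b (D c (D a f)) = D a (D b (D c f)).
  move=> e; rewrite (DopDop _ c a) DopZ (DopDop _ b a) scalerA.
  by rewrite e ssign_sq scale1r.
rewrite /lap raddfD !raddf_sum; congr (_ + _); apply: eq_bigr => i _;
  by rewrite h ?indexE.
Qed.

Lemma mulform_Zop Q a f : mulform Q (Z a f) = Z a (mulform Q f).
Proof.
have h b c : odd b = odd c -> Z b (Z c (Z a f)) = Z a (Z b (Z c f)).
  move=> e; rewrite (ZopZop _ c a) ZopZ (ZopZop _ b a) scalerA.
  by rewrite e ssign_sq scale1r.
rewrite /mulform raddfD !raddf_sum; congr (_ + _); apply: eq_bigr => i _;
  by rewrite h ?indexE.
Qed.

Hypothesis two_neq0 : (2%:R : C) != 0.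

Lemma eq_opp_0 (V : lmodType C) (v : V) : v = - v -> v = 0.
Proof.
move=> h; have : (2%:R : C) *: v = 0 by rewrite scaler_nat mulr2n {1}h addNr.
by move/eqP; rewrite scaler_eq0 (negPf two_neq0) => /eqP.
Qed.

(** The commutator is the sum of X a b times [sgs a] D (star a) D b. Replacing (a, b) by (star b,
    star a) reverses its sign, since D (star a) and D b supercommute while X is skew; as 2 is
    invertible, it vanishes. *)
Lemma lap_gl_act X f : @osp C m n X ->
  lap xpredT (gl_act r X f) = gl_act r X (lap xpredT f).
Proof.
move/ospP => hX; rewrite !gl_actE raddf_sum /=.
under eq_bigr => a _ do rewrite raddf_sum /=.
under eq_bigr => a _ do under eq_bigr => b _ do
  rewrite linearZ /= lap_Zop lap_Dop in_formT mul1r scalerDr scalerA.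
under eq_bigr => a _ do rewrite big_split.
rewrite big_split /= -[RHS]addr0; congr (_ + _); apply: eq_opp_0.
rewrite [in RHS](reindex_inj (inv_inj (@starK m n))) /= [LHS]exchange_big /=.
rewrite -sumrN; apply: eq_bigr => a _.
rewrite [in RHS](reindex_inj (inv_inj (@starK m n))) /= -sumrN.
apply: eq_bigr => b _.
rewrite hX DopDop odd_star scalerA -scaleNr starK; congr (_ *: _).
rewrite /eps !mulNr; congr (- _).
rewrite (_ : ssign C (odd b && odd a) * sgs C b * sgs C (star a)
   * X (star a) (star b) * sgs C b * ssign C (odd b && odd a)
   = (ssign C (odd b && odd a) * ssign C (odd b && odd a))
     * (sgs C b * sgs C b) * (X (star a) (star b) * sgs C (star a))); last by ring.
by rewrite ssign_sq sgs_sq !mul1r.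
Qed.

Lemma mulform_gl_act X f : @osp C m n X ->
  mulform xpredT (gl_act r X f) = gl_act r X (mulform xpredT f).
Proof.
move/ospP => hX; rewrite !gl_actE raddf_sum /=; apply/esym.
under eq_bigr => a _ do under eq_bigr => b _ do
  rewrite Dop_mulform ZopD ZopZ in_formT mul1r -mulform_Zop
   scalerDr scalerA.
under eq_bigr => a _ do rewrite big_split /=.
rewrite big_split /= -[RHS]addr0; congr (_ + _).
  by apply: eq_bigr => a _; rewrite raddf_sum; apply: eq_bigr => b _ /=; rewrite [RHS]linearZ.
apply: eq_opp_0.
rewrite [in RHS](reindex_inj (inv_inj (@starK m n))) /= [LHS]exchange_big /=.
rewrite -sumrN; apply: eq_bigr => a _.
rewrite [in RHS](reindex_inj (inv_inj (@starK m n))) /= -sumrN.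
apply: eq_bigr => b _.
rewrite hX ZopZop odd_star scalerA -scaleNr starK; congr (_ *: _).
rewrite /eps !mulNr; congr (- _).
rewrite (_ : ssign C (odd b && odd a) * sgs C b * sgs C (star a)
   * X (star a) (star b) * sgs C (star a) * ssign C (odd b && odd a)
   = (ssign C (odd b && odd a) * ssign C (odd b && odd a))
     * (sgs C (star a) * sgs C (star a)) * (X (star a) (star b) * sgs C b)); last by ring.
by rewrite ssign_sq sgs_sq !mul1r.
Qed.

(** Reordering contributes + f for each even pair and - f for each odd one; over all pairs this is
    the part m - n of the commutator. *)
Lemma lap_mulform Q f : lap Q (mulform Q f) = mulform Q (lap Q f)
  + (\sum_(i | Q i) (Z (ix n i) (D (ix n i) f) + Z (iy n i) (D (iy n i) f) + f)
     + \sum_j (Z (iT m j) (D (iT m j) f) + Z (iS m j) (D (iS m j) f) - f)).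
Proof.
have h b : in_form Q b -> D b (D (star b) (mulform Q f)) = mulform Q (D b (D (star b) f))
    + (sgs C (star b) *: Z (star b) (D (star b) f) + sgs C b *: f
     + (sgs C b * ssign C (odd b)) *: Z b (D b f)).
  have hs : in_form Q (star b) = in_form Q b.
    by case: (indexP b) => i; rewrite !indexE !in_formE.
  move=> hb; rewrite !Dop_mulform hs hb !mul1r starK DopD DopZ.
  rewrite Dop_mulform hb mul1r DopZop eqxx scale1r scalerDr scalerA andbb.
  by rewrite -!addrA.
have hx i : Q i -> D (ix n i) (D (iy n i) (mulform Q f))
    = mulform Q (D (ix n i) (D (iy n i) f))
      + (Z (ix n i) (D (ix n i) f) + Z (iy n i) (D (iy n i) f) + f).
  move=> hi; rewrite -star_x h ?in_formE // /sgs !indexE /ssign expr0 mulr1 !scale1r.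
  by congr (_ + _); rewrite addrC addrA.
have ht j : D (iT m j) (D (iS m j) (mulform Q f))
    = mulform Q (D (iT m j) (D (iS m j) f))
      + (Z (iT m j) (D (iT m j) f) + Z (iS m j) (D (iS m j) f) - f).
  rewrite -star_t h ?in_formE // /sgs !indexE /ssign expr0 expr1 mulrNN mulr1 !scale1r.
  by rewrite scaleN1r; congr (_ + _); rewrite addrC addrA.
rewrite {1}/lap (eq_bigr _ hx) (eq_bigr _ (fun j _ => ht j)) big_split /=.
rewrite [X in _ + X = _]big_split /= addrACA; congr (_ + _).
by rewrite /lap (linearD (mulform Q)) /= !raddf_sum.
Qed.

End Laplacian.

(** * The sl2-triple of Delta and eta *)

Section SL2.
Variables (C : fieldType) (V : lmodType C).
Hypothesis char0 : [pchar C] =i pred0.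

Lemma intr_eq0_char0 (z : int) : (z%:~R == 0 :> C) = (z == 0).
Proof.
have h := (pcharf0P C).1 char0.
by case: z => k; rewrite ?NegzE ?mulrNz ?oppr_eq0 -?pmulrn h.
Qed.

Section Subspaces.
Variable W : set V.
Hypothesis hW : subspace W.

Lemma subspace0 : W 0. Proof. exact: hW.1. Qed.
Lemma subspaceZ a v : W v -> W (a *: v).
Proof. by move=> h; rewrite -[_ *: _]addr0; exact: hW.2 _ _ _ h hW.1. Qed.
Lemma subspaceD u v : W u -> W v -> W (u + v).
Proof. by move=> hu hv; rewrite -[u]scale1r; exact: hW.2. Qed.
Lemma subspaceB u v : W u -> W v -> W (u - v).
Proof. by move=> hu hv; rewrite addrC -scaleN1r; exact: hW.2. Qed.
Lemma subspace_sum (J : eqType) (s : seq J) (P : pred J) (F : J -> V) :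
  (forall j, j \in s -> P j -> W (F j)) -> W (\sum_(j <- s | P j) F j).
Proof.
move=> h; rewrite big_seq_cond; elim/big_ind: _ => [|u v|j /andP[]].
- exact: subspace0.
- exact: subspaceD.
- exact: h.
Qed.
End Subspaces.

Lemma iterP (E : {linear V -> V}) N a u v :
  iter N E (a *: u + v) = a *: iter N E u + iter N E v.
Proof. by elim: N => //= N ->; rewrite linearP. Qed.

Lemma iter0 (E : {linear V -> V}) N : iter N E 0 = 0.
Proof. by elim: N => //= N ->; rewrite linear0. Qed.

Lemma iterZ (E : {linear V -> V}) N a u : iter N E (a *: u) = a *: iter N E u.
Proof. by rewrite -[a *: u]addr0 iterP iter0 addr0. Qed.

Lemma iterB (E : {linear V -> V}) N u v : iter N E (u - v) = iter N E u - iter N E v.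
Proof. by rewrite addrC -scaleN1r iterP scaleN1r addrC. Qed.

(** The setting is abstract because it is used twice: with E = Delta, F = eta, and with the inner
    operators in exchanged roles, E being the inner part of eta. *)
Variables (G : int -> set V) (E F : {linear V -> V}) (c : int).
Hypotheses (hG : forall k, subspace (G k))
  (hE : forall k v, G k v -> G (k - 2) (E v))
  (hF : forall k v, G k v -> G (k + 2) (F v))
  (hEF : forall k v, G k v -> E (F v) = F (E v) + (k - c + 1)%:~R *: v).

Lemma graded_iterF k v t : G k v -> G (k + 2 * t%:Z) (iter t F v).
Proof.
move=> h; elim: t => [|t IH]; first by rewrite mulr0 addr0.
by rewrite iterS; have := hF IH; congr (G _ _); lia.
Qed.

Lemma graded_iterE k v t : G k v -> G (k - 2 * t%:Z) (iter t E v).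
Proof.
move=> h; elim: t => [|t IH]; first by rewrite mulr0 subr0.
by rewrite iterS; have := hE IH; congr (G _ _); lia.
Qed.

(** The commutators met in the degrees k, k + 2, ..., k + 2t form an arithmetic progression with sum
    (t + 1)(k + t + 1 - c). *)
Lemma raise_lowest k u t : G k u -> E u = 0 ->
  E (iter t.+1 F u) = (t.+1%:Z * (k + t%:Z + 1 - c))%:~R *: iter t F u.
Proof.
move=> hu Eu; elim: t => [|t IH].
  by rewrite /= (hEF hu) Eu linear0 add0r; congr (_%:~R *: _); lia.
rewrite iterS (hEF (graded_iterF t.+1 hu)) IH linearZ /= -scalerDl -intrD.
by congr (_%:~R *: _); lia.
Qed.

Lemma raise_lower k u t : G k u -> E u = 0 ->
  (forall i, (i < t)%N -> k + i%:Z + 1 != c) ->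
  exists2 a : C, a != 0 & iter t E (iter t F u) = a *: u.
Proof.
move=> hu Eu; elim: t => [|t IH] ht; first by exists 1; rewrite ?oner_neq0 ?scale1r.
have [i hi|a a0 ha] := IH; first by apply: ht; rewrite ltnW.
exists ((t.+1%:Z * (k + t%:Z + 1 - c))%:~R * a).
  rewrite mulf_neq0 // intr_eq0_char0 mulf_neq0 // subr_eq0.
  exact: ht.
by rewrite iterSr (raise_lowest _ hu Eu) iterZ ha scalerA.
Qed.

(** Induction on the order of nilpotency. The last iterate u = E^(N+1) f is killed by E, and
    subtracting a suitable multiple of F^(N+1) u from f makes E^(N+1) vanish. For k <= c none of the
    factors in [raise_lower] is zero, so the multiple exists. *)
Lemma harmonic_decomposition k f N : k <= c -> G k f -> iter N E f = 0 ->
  exists2 g, G (k - 2) g & E (f - F g) = 0.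
Proof.
move=> kc; elim: N f => [|N IH] f hf.
  by move=> /= ->; exists 0; [exact: subspace0|rewrite linear0 subr0 linear0].
case: N IH => [|N] IH hN.
  by exists 0; [exact: subspace0|rewrite linear0 subr0].
have hu := graded_iterE N.+1 hf; rewrite iterS in hN.
have [|a a0 ha] := @raise_lower _ _ N.+1 hu hN; first by move=> i hi; lia.
set u := iter N.+1 E f in hu hN ha.
have hg : G (k - 2) (a^-1 *: iter N F u).
  by apply: subspaceZ => //; have := graded_iterF N hu; congr (G _ _); lia.
have hFg : G k (F (a^-1 *: iter N F u)).
  by have := hF hg; congr (G _ _); lia.
have [||g g1 g2] := IH (f - F (a^-1 *: iter N F u)).
- exact: subspaceB.
- have -> : F (a^-1 *: iter N F u) = a^-1 *: iter N.+1 F u by rewrite linearZ.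
  by rewrite iterB iterZ ha scalerA mulVf // scale1r subrr.
exists (g + a^-1 *: iter N F u); first exact: subspaceD.
by rewrite (linearD F) /= opprD addrA addrAC.
Qed.

Lemma lower_raise j g N : G j g ->
  iter N.+1 E (F g) = F (iter N.+1 E g)
    + (N.+1%:Z * (j - c + 1 - N%:Z))%:~R *: iter N E g.
Proof.
move=> hg; elim: N => [|N IH].
  by rewrite /= (hEF hg); congr (_ + _%:~R *: _); lia.
rewrite [LHS]iterS IH linearD /= (hEF (graded_iterE N.+1 hg)) linearZ /= -addrA -scalerDl.
by rewrite -intrD; congr (_ + _%:~R *: _); lia.
Qed.

(** When E^(N+1) is applied to F g, only (N + 1)(k - c - 1 - N) E^N g remains, and it must be
    zero. *)
Lemma nilpotency_descent k g N : G (k - 2) g -> E (F g) = 0 ->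
  iter N.+1 E g = 0 -> k - c != N.+1%:Z -> iter N E g = 0.
Proof.
move=> hg EFg hN kN; have := lower_raise N hg.
rewrite iterSr EFg iter0 hN linear0 add0r => /esym/eqP; rewrite scaler_eq0.
rewrite intr_eq0_char0 mulf_eq0 => /orP[h|/eqP //]; exfalso; lia.
Qed.

Lemma harmonic_cap_image_low k g N : k <= c -> G (k - 2) g -> E (F g) = 0 ->
  iter N E g = 0 -> g = 0.
Proof.
move=> kc hg EFg; elim: N => // N IH hN; apply: IH.
by apply: (@nilpotency_descent k) hN _ => //; lia.
Qed.

(** The descent can get stuck only at the exponent k - c = s + 1, so E^(s+1) g = 0 and u = E^s g is
    harmonic of degree 2c - k. A multiple of F^s u has the same image under E^s as g; their
    difference is below the obstruction, so the descent brings it to zero. *)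
Lemma harmonic_cap_image_high k (s : nat) g N : k - c = s.+1%:Z ->
  G (k - 2) g -> E (F g) = 0 -> iter N E g = 0 ->
  exists2 h, G (2 * c - k) h /\ E h = 0 & F g = iter s.+1 F h.
Proof.
move=> ks hg EFg hN.
have {N hN} hs : iter s.+1 E g = 0.
  have : forall M, iter (M + s.+1) E g = 0 -> iter s.+1 E g = 0.
    elim=> // M IH; rewrite addSn => h; apply: IH.
    by apply: (@nilpotency_descent k) h _ => //; lia.
  by move=> H; apply: (H N); rewrite addnC iterD hN iter0.
have descend g' M : (M <= s)%N -> G (k - 2) g' -> E (F g') = 0 ->
    iter M E g' = 0 -> g' = 0.
  move=> Ms hg' EFg'; elim: M Ms => // M IH Ms hM; apply: IH; first exact: ltnW.
  by apply: (@nilpotency_descent k) hM _ => //; lia.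
have hu : G (2 * c - k) (iter s E g).
  by have := graded_iterE s hg; congr (G _ _); lia.
have Eu : E (iter s E g) = 0 by rewrite -iterS.
have [|a a0 ha] := @raise_lower _ _ s hu Eu; first by move=> i hi; lia.
exists (a^-1 *: iter s E g).
  by split; [exact: subspaceZ|rewrite linearZ /= Eu scaler0].
have hFu : G (k - 2) (iter s F (iter s E g)).
  by have := graded_iterF s hu; congr (G _ _); lia.
have EFu : E (F (iter s F (iter s E g))) = 0.
  rewrite -iterS (raise_lowest s hu Eu) (_ : _ * _ = 0) ?scale0r //; lia.
rewrite iterS iterZ; congr (F _); apply/eqP; rewrite -subr_eq0; apply/eqP.
apply: (descend _ s) => //.
- by apply: subspaceB => //; exact: subspaceZ.
- by rewrite linearB linearZ /= linearB linearZ /= EFg EFu scaler0 subr0.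
- by rewrite iterB iterZ ha scalerA mulVf // scale1r subrr.
Qed.

Lemma raise_harmonic k (s : nat) h : k - c = s%:Z ->
  G (2 * c - k) h -> E h = 0 -> G k (iter s F h) /\ E (iter s F h) = 0.
Proof.
move=> ks hh Eh; split.
  by have := graded_iterF s hh; congr (G _ _); lia.
case: s ks => [//|s] ks.
rewrite (raise_lowest s hh Eh) (_ : _ * _ = 0) ?scale0r //; lia.
Qed.

(** Hard Lefschetz: E^s is onto from weight s to weight k - c + 1 = - s. The preimage is built from
    the last iterate w = E^N g: E^(s+N) F^(s+N) w is a nonzero multiple of w, as every factor of
    [raise_lower] comes from a degree that stays below c. *)
Lemma lefschetz_onto k (s : nat) g N : k = c - 1 - s%:Z -> G k g ->
  iter N E g = 0 -> exists2 h, G (k + 2 * s%:Z) h & g = iter s E h.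
Proof.
move=> ks; elim: N g => [|N IH] g hg.
  by move=> /= ->; exists 0; [exact: subspace0|rewrite iter0].
move=> hN; have hw := graded_iterE N hg; rewrite iterS in hN.
have [|a a0 ha] := @raise_lower _ _ (s + N) hw hN; first by move=> i hi; lia.
set w := iter N E g in hw hN ha.
have hh : G (k + 2 * s%:Z) (a^-1 *: iter (s + N) F w).
  by apply: subspaceZ => //; have := graded_iterF (s + N) hw; congr (G _ _); lia.
have [||h h1 h2] := IH (g - iter s E (a^-1 *: iter (s + N) F w)).
- apply: subspaceB => //; have := graded_iterE s hh; congr (G _ _); lia.
- by rewrite iterB -iterD addnC iterZ ha scalerA mulVf // scale1r subrr.
exists (a^-1 *: iter (s + N) F w + h); first exact: subspaceD.
by rewrite -[X in iter s E (X + _)]scale1r iterP scale1r -h2 addrC subrK.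
Qed.

End SL2.

(** * Spans, gradings and local nilpotency *)

Section Span.
Variables (C : fieldType) (V : lmodType C) (B : set V).

Lemma span_subspace : subspace (Defs.span B).
Proof.
split; first by exists [::], (fun=> 0); split => //; rewrite big_nil.
move=> a u v [s1 [c1 [h1 ->]]] [s2 [c2 [h2 ->]]].
(* In a span the coefficient is a function of the vector, so a repeated entry counts with its
   multiplicity; [d] moves this multiplicity into the coefficient and permits a list without
   duplicates. *)
pose d (s : seq V) (c : V -> C) x := c x *+ count_mem x s.
have e (s t : seq V) c : uniq t -> {subset s <= t} ->
    \sum_(x <- t) d s c x *: x = \sum_(x <- s) c x *: x.
  move=> ut st; rewrite -[RHS]big_undup_iterop_count /=.
  rewrite (bigID (mem s)) /= [X in _ + X]big1 ?addr0; last first.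
    by move=> x /count_memPn; rewrite /d => ->; rewrite scale0r.
  rewrite -big_filter (perm_big (undup s)) /=.
    by apply: eq_bigr => x _; rewrite /d -scalerMnl.
  apply: uniq_perm; rewrite ?filter_uniq ?undup_uniq // => x.
  by rewrite mem_filter mem_undup andb_idr //; exact: st.
pose t := undup (s1 ++ s2).
exists t, (fun x => a * d s1 c1 x + d s2 c2 x); split.
  by move=> x; rewrite mem_undup mem_cat => /orP[/h1|/h2].
rewrite -(e s1 t) ?undup_uniq //; last by move=> x h; rewrite mem_undup mem_cat h.
rewrite -(e s2 t) ?undup_uniq //; last by move=> x h; rewrite mem_undup mem_cat h orbT.
rewrite scaler_sumr -big_split; apply: eq_bigr => x _ /=.
by rewrite scalerDl scalerA.
Qed.

Lemma span_mem v : B v -> Defs.span B v.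
Proof.
move=> h; exists [:: v], (fun=> 1); split; last by rewrite big_seq1 scale1r.
by move=> x; rewrite inE => /eqP ->.
Qed.

End Span.

Section Grading.
Variables (C : fieldType) (m n r : nat).
Local Notation A := (superpoly C (m + m) (n + n)).
Local Notation I := 'I_((m + m) + (n + n)).
Local Notation Z := (@Zop C (m + m) (n + n) r).
Local Notation D := (@Dop C (m + m) (n + n) r).
Local Notation zs := (@zsign (m + m) (n + n) r).
Local Notation lap := (@lap C m n r).
Local Notation mulform := (@mulform C m n r).
Local Notation deg := (wt zs).
Implicit Types (f g : A) (a b c d : I) (Q : pred 'I_m) (om : I -> int)
  (al : 'X_{1..m + m}) (S : {set 'I_(n + n)}).

Lemma wtE om al S : wt om al S =
  \sum_i om (ix n i) * (al (lshift m i))%:Z + \sum_i om (iy n i) * (al (rshift m i))%:Z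
  + \sum_j om (iT m j) * (lshift n j \in S)%:Z + \sum_j om (iS m j) * (rshift n j \in S)%:Z.
Proof. by rewrite /wt !big_split_ord addrA. Qed.

Definition omega (fx fy : 'I_m -> int) (ft fs : 'I_n -> int) (a : I) : int :=
  match split a with
  | inl i => match split i with inl j => fx j | inr j => fy j end
  | inr i => match split i with inl j => ft j | inr j => fs j end
  end.

Lemma omega_x fx fy ft fs i : omega fx fy ft fs (ix n i) = fx i.
Proof. by rewrite /omega /ix !split_lshift'. Qed.
Lemma omega_y fx fy ft fs i : omega fx fy ft fs (iy n i) = fy i.
Proof. by rewrite /omega /iy split_lshift' split_rshift'. Qed.
Lemma omega_t fx fy ft fs j : omega fx fy ft fs (iT m j) = ft j.
Proof. by rewrite /omega /iT split_rshift' split_lshift'. Qed.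
Lemma omega_s fx fy ft fs j : omega fx fy ft fs (iS m j) = fs j.
Proof. by rewrite /omega /iS !split_rshift'. Qed.
Definition omegaE := (omega_x, omega_y, omega_t, omega_s).

Lemma zs_x i : zs (ix n i) = if (i < r)%N then -1 else 1.
Proof. exact: zsign_x. Qed.
Lemma zs_y i : (r <= m)%N -> zs (iy n i) = 1.
Proof.
move=> rm; rewrite zsign_x ifF //; apply/negbTE.
by rewrite -leqNgt (leq_trans rm) // leq_addr.
Qed.
Lemma zs_t j : zs (iT m j) = 1. Proof. exact: zsign_theta. Qed.
Lemma zs_s j : zs (iS m j) = 1. Proof. exact: zsign_theta. Qed.

Lemma zs_sq a : zs a * zs a = 1.
Proof.
by case: (split_ordP a) => i ->; rewrite ?zsign_theta ?zsign_x //; case: ifP.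
Qed.

Lemma super_degE al S : super_deg r al #|S| = deg al S.
Proof.
rewrite /super_deg /wt -addrA addrC; congr (_ + _).
  rewrite [RHS](bigID (fun i : 'I_(m + m) => (i < r)%N)) /= -sumrN; congr (_ + _).
    by apply: eq_bigr => i hi; rewrite zsign_x hi mulN1r.
  apply: eq_big => [i|i hi]; first by rewrite -leqNgt.
  by rewrite zsign_x ltnNge hi mul1r.
rewrite -sum1_card (big_morph Posz PoszD (erefl _)) big_mkcond.
by apply: eq_bigr => p _; rewrite zsign_theta mul1r; case: (p \in S).
Qed.

Lemma of_poly_elem al : of_poly (n + n) 'X_[al] = elem C al finset.set0.
Proof. by apply/ffunP => S; rewrite !ffunE. Qed.

Lemma monomial_elem al (s : seq 'I_(n + n)) : uniq s ->
  exists2 z : C, z * z = 1 & monomial C al s = z *: elem C al [set p in s]%SET.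
Proof.
elim: s => [|p s IH] /=.
  exists 1; rewrite ?mulr1 // scale1r /monomial /= of_poly_elem.
  by congr (elem C _ _); apply/setP => q; rewrite !inE.
move=> /andP[ps us]; have [z z1 e] := IH us.
exists (z * theta_sign C p [set q in s]%SET); first by rewrite mulrACA z1 theta_sign_sq mulr1.
rewrite /monomial /= -/(monomial C al s) e linearZ /= theta_elem inE (negPf ps) scalerA.
by congr (_ *: elem C _ _); apply/setP => q; rewrite !inE.
Qed.

Lemma monomial_dup al (s : seq 'I_(n + n)) : ~~ uniq s -> monomial C al s = 0.
Proof.
elim: s => [//|p s IH] /=; rewrite /monomial /= -/(monomial C al s).
case: (boolP (uniq s)) => [us|/IH -> _]; last by rewrite linear0.
rewrite andbT negbK => ps; have [z _ ->] := monomial_elem al us.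
by rewrite linearZ /= theta_elem inE ps scaler0.
Qed.

Lemma A_P k f : @A_ C m n r k f <-> supp (fun al S => deg al S = k) f.
Proof.
split.
  move=> [s [c [hs ->]]]; rewrite big_seq; apply: supp_sum => v /hs.
  move=> [al [t [ht hd ->]]]; apply: suppZ.
  case: (boolP (uniq t)) => [ut|/monomial_dup ->]; last exact: supp0.
  have [z _ ->] := monomial_elem al ut; apply: suppZ; apply: supp_elem.
  rewrite -super_degE -hd; congr super_deg.
  by rewrite cardsE; apply/card_uniqP.
move=> hf; have hA := span_subspace.
apply: (@elem_ind _ _ _ (@A_ C m n r k)).
- exact: subspace0 (hA _ _ _).
- by move=> a g h hg hh; apply: (hA _ _ _).2.
move=> al S /hf hd.
have [z z1 e] := monomial_elem al (enum_uniq S).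
have -> : elem C al S = z *: monomial C al (enum S).
  by rewrite e scalerA z1 scale1r; congr elem; apply/setP => p; rewrite inE mem_enum.
apply: subspaceZ; first exact: hA.
apply: span_mem; exists al, (enum S); split => //.
  by rewrite -cardE -[X in (_ <= X)%N]card_ord max_card.
by rewrite -cardE super_degE.
Qed.

Lemma A_subspace k : subspace (@A_ C m n r k).
Proof. exact: span_subspace. Qed.

Lemma A_Zop k a f : @A_ C m n r k f -> @A_ C m n r (k + 1) (Z a f).
Proof.
move=> /A_P h; apply/A_P => al S.
by move/(supp_Zop (Q := fun x => x = k) h); rewrite zs_sq => <-; rewrite subrK.
Qed.

Lemma A_Dop k a f : @A_ C m n r k f -> @A_ C m n r (k - 1) (D a f).
Proof.
move=> /A_P h; apply/A_P => al S.
by move/(supp_Dop (Q := fun x => x = k) h); rewrite zs_sq => <-; rewrite addrK.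
Qed.

Lemma A_lap Q k f : @A_ C m n r k f -> @A_ C m n r (k - 2) (lap Q f).
Proof.
move=> h; rewrite (_ : k - 2 = k - 1 - 1); last by lia.
apply: subspaceD; [exact: A_subspace| |];
  by apply: subspace_sum => *; [exact: A_subspace|do 2 apply: A_Dop].
Qed.

Lemma A_mulform Q k f : @A_ C m n r k f -> @A_ C m n r (k + 2) (mulform Q f).
Proof.
move=> h; rewrite (_ : k + 2 = k + 1 + 1); last by lia.
apply: subspaceD; [exact: A_subspace| |];
  by apply: subspace_sum => *; [exact: A_subspace|do 2 apply: A_Zop].
Qed.

Lemma A_gl_act X k f : @A_ C m n r k f -> @A_ C m n r k (gl_act r X f).
Proof.
move=> h; rewrite gl_actE; apply: subspace_sum => [|a _ _]; first exact: A_subspace.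
apply: subspace_sum => [|b _ _]; first exact: A_subspace.
apply: subspaceZ; first exact: A_subspace.
by rewrite -[k](subrK 1); apply: A_Zop; apply: A_Dop.
Qed.

Section Shift.
Variables (om : I -> int) (P : int -> Prop) (Q : pred 'I_m) (t : int).
Hypotheses (hx : forall i, Q i -> zs (ix n i) * om (ix n i) + zs (iy n i) * om (iy n i) = t)
  (ht : forall j, om (iT m j) + om (iS m j) = t).

Lemma supp_lap f : supp (fun al S => P (wt om al S)) f ->
  supp (fun al S => P (wt om al S + t)) (lap Q f).
Proof.
have h a b : zs a * om a + zs b * om b = t -> supp (fun al S => P (wt om al S)) f ->
    supp (fun al S => P (wt om al S + t)) (D a (D b f)).
  move=> e hf.
  have := supp_Dop (r := r) (Q := fun x => P (x + zs b * om b)) (a := a)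
    (supp_Dop (r := r) (a := b) hf).
  by apply: sub_supp => al S; rewrite -addrA e.
move=> hf; apply: suppD; apply: supp_sum => i hi; apply: h => //; first exact: hx.
by rewrite zs_t zs_s !mul1r.
Qed.

Lemma supp_mulform f : supp (fun al S => P (wt om al S)) f ->
  supp (fun al S => P (wt om al S - t)) (mulform Q f).
Proof.
have h a b : zs a * om a + zs b * om b = t -> supp (fun al S => P (wt om al S)) f ->
    supp (fun al S => P (wt om al S - t)) (Z a (Z b f)).
  move=> e hf.
  have := supp_Zop (r := r) (Q := fun x => P (x - zs b * om b)) (a := a)
    (supp_Zop (r := r) (a := b) hf).
  by apply: sub_supp => al S; rewrite -addrA -opprD e.
move=> hf; apply: suppD; apply: supp_sum => i hi; apply: h => //; first exact: hx.
by rewrite zs_t zs_s !mul1r.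
Qed.

End Shift.

Lemma wt_bounded om f : exists d : int, supp (fun al S => wt om al S <= d) f.
Proof.
apply: (elem_ind (P := fun f => exists d : int, supp (fun al S => wt om al S <= d) f)).
- by exists 0; exact: supp0.
- move=> a g h [d1 h1] [d2 h2]; exists (Num.max d1 d2); apply: suppP.
    by apply: sub_supp h1 => al S; lia.
  by apply: sub_supp h2 => al S; lia.
- by move=> al S _; exists (wt om al S); apply: supp_elem.
Qed.

Lemma locally_nilpotent om (B : int) (T : {linear A -> A}) :
  (forall al S, B <= wt om al S) ->
  (forall (d : int) f, supp (fun al S => wt om al S <= d) f ->
     supp (fun al S => wt om al S + 1 <= d) (T f)) ->
  forall f, exists N, iter N T f = 0.
Proof.
move=> hB hT f; have [d hd] := wt_bounded om f.
have h N : supp (fun al S => wt om al S + N%:Z <= d) (iter N T f).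
  elim: N => [|N IH]; first by apply: sub_supp hd => al S; lia.
  have := hT (d - N%:Z) (iter N T f).
  move=> /(_ _)/(sub_supp (Q' := fun al S => wt om al S + N.+1%:Z <= d)); apply.
    by move=> al S; lia.
  by apply: sub_supp IH => al S; lia.
exists `|d - B|.+1; apply: cfP => al S; rewrite raddf0; apply/eqP.
apply/contraT => /(h _) hh; have := hB al S; lia.
Qed.

Lemma lap_nilpotent Q : (r <= m)%N -> forall f, exists N, iter N (lap Q) f = 0.
Proof.
(* Counts the x_(m+i) and the first half of the theta's: every summand of [lap] differentiates by
   exactly one of them. The degree itself would not do, as it is unbounded below. *)
move=> rm; pose om := omega (fun=> 0) (fun=> 1) (fun=> 1) (fun=> 0).
apply: (locally_nilpotent (om := om) (B := 0)) => [al S|d f].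
  rewrite wtE /om; under eq_bigr do rewrite omegaE mul0r.
  under [X in _ + X + _ + _]eq_bigr do rewrite omegaE mul1r.
  under [X in _ + X + _]eq_bigr do rewrite omegaE mul1r.
  under [X in _ + X]eq_bigr do rewrite omegaE mul0r.
  by rewrite !big1_eq add0r addr0 addr_ge0 // sumr_ge0.
apply: (supp_lap (P := fun x => x <= d)) => [i _|j]; rewrite /om !omegaE //.
by rewrite zs_y // mulr0 mulr1.
Qed.

Definition weight_shift Q al S : int :=
  \sum_(i | Q i) (occ r (ix n i) al S + occ r (iy n i) al S + 1)
  + \sum_j (occ r (iT m j) al S + occ r (iS m j) al S - 1).

Lemma cf_lap_mulform Q f al S : cf al S (lap Q (mulform Q f)) =
  cf al S (mulform Q (lap Q f)) + (weight_shift Q al S)%:~R * cf al S f.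
Proof.
rewrite lap_mulform raddfD; congr (_ + _); rewrite raddfD !raddf_sum.
rewrite /weight_shift intrD mulrDl !rmorph_sum !mulr_suml /=; congr (_ + _).
  by apply: eq_bigr => i _; rewrite !raddfD /= !cf_ZopDop !mulrDl mulr1z mul1r.
apply: eq_bigr => j _; rewrite !raddfD !raddfN /= !cf_ZopDop !mulrDl mulr1z.
by rewrite mulN1r.
Qed.

Lemma occ_index al S (i : 'I_m) : (r <= m)%N ->
  occ r (ix n i) al S = zs (ix n i) * (al (lshift m i))%:Z - (i < r)%N%:Z
  /\ occ r (iy n i) al S = zs (iy n i) * (al (rshift m i))%:Z.
Proof.
move=> rm; rewrite zs_y // zs_x /ix /iy !occ_x /=.
have -> : (m + i < r)%N = false.
  by apply/negbTE; rewrite -leqNgt (leq_trans rm) // leq_addr.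
rewrite mul1r; case: ifP => _; split=> //; lia.
Qed.

(** The origin of c = n - m + r + 1: each even pair gives + 1, each odd pair - 1, and each of the r
    operators - d_i x_i another - 1. *)
Lemma weight_shiftT al S : (r <= m)%N ->
  weight_shift xpredT al S = deg al S - (n%:Z - m%:Z + r%:Z + 1) + 1.
Proof.
move=> rm; rewrite /weight_shift wtE.
under eq_bigr => i _ do rewrite (occ_index _ _ _ rm).1 (occ_index _ _ _ rm).2.
under [X in _ + X]eq_bigr => j _ do rewrite !occ_theta.
under [X in _ = _ + X + _ - _ + _]eq_bigr => j _ do rewrite zs_t mul1r.
under [X in _ = _ + X - _ + _]eq_bigr => j _ do rewrite zs_s mul1r.
rewrite !big_split /= !sumrN !sumr_const !card_ord.
have -> : \sum_(i < m) (i < r)%N%:Z = r%:Z.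
  rewrite -(big_morph Posz PoszD (erefl _)) /=; congr Posz.
  transitivity (\sum_(i < m | (i < r)%N) 1)%N.
    by rewrite [RHS]big_mkcond; apply: eq_bigr => i _; case: ltnP.
  by rewrite -(big_ord_widen m (fun=> 1%N)) // sum1_card card_ord.
by rewrite ?mulNrn !natz; ring.
Qed.

End Grading.

Section Operators.
Variables (C : fieldType) (m n r : nat).
Local Notation A := (superpoly C (m + m) (n + n)).
Local Notation Z := (@Zop C (m + m) (n + n) r).
Local Notation D := (@Dop C (m + m) (n + n) r).
Hypothesis rm : (r <= m)%N.
Implicit Types (i : 'I_m) (j : 'I_n).

Lemma Zop_lo i (f : A) : (i < r)%N -> Z (ix n i) f = dx (lshift m i) f.
Proof. by move=> h; rewrite Zop_x /= h. Qed.
Lemma Dop_lo i (f : A) : (i < r)%N -> D (ix n i) f = - xmul (lshift m i) f.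
Proof. by move=> h; rewrite Dop_x /= h. Qed.
Lemma Zop_hi i (f : A) : (r <= i)%N -> Z (ix n i) f = xmul (lshift m i) f.
Proof. by move=> h; rewrite Zop_x /= ltnNge h. Qed.
Lemma Dop_hi i (f : A) : (r <= i)%N -> D (ix n i) f = dx (lshift m i) f.
Proof. by move=> h; rewrite Dop_x /= ltnNge h. Qed.
Lemma Zop_y i (f : A) : Z (iy n i) f = xmul (rshift m i) f.
Proof. by rewrite Zop_x /= ltnNge (leq_trans rm) // leq_addr. Qed.
Lemma Dop_y i (f : A) : D (iy n i) f = dx (rshift m i) f.
Proof. by rewrite Dop_x /= ltnNge (leq_trans rm) // leq_addr. Qed.
Lemma Zop_t j (f : A) : Z (iT m j) f = theta (lshift n j) f.
Proof. exact: Zop_theta. Qed.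
Lemma Dop_t j (f : A) : D (iT m j) f = dtheta (lshift n j) f.
Proof. exact: Dop_theta. Qed.
Lemma Dop_s j (f : A) : D (iS m j) f = dtheta (rshift n j) f.
Proof. exact: Dop_theta. Qed.

End Operators.

(** * Reindexing sums over the q_i and l_j *)

Section Reindexing.
Variables (C : fieldType) (V : lmodType C) (J : finType).

Definition bump1 (i : J) (q : {ffun J -> nat}) : {ffun J -> nat} :=
  [ffun j => (q j + (j == i))%N].

Definition natf (K : nat) (q : {ffun J -> 'I_K}) : {ffun J -> nat} :=
  [ffun j => nat_of_ord (q j)].

Definition natb (l : {ffun J -> bool}) : {ffun J -> nat} :=
  [ffun j => nat_of_bool (l j)].

(** Shifts q i by one. At the lower end the factor q i vanishes, at the upper end H does. *)
Lemma sum_bump_ord (K : nat) (i : J) (H : {ffun J -> nat} -> V) :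
  (forall q : {ffun J -> nat}, (K < q i)%N -> H q = 0) ->
  \sum_(q : {ffun J -> 'I_K.+1}) ((q i).+1)%:R *: H (bump1 i (natf q))
  = \sum_(q : {ffun J -> 'I_K.+1}) (q i)%:R *: H (natf q).
Proof.
move=> H0.
pose up (q : {ffun J -> 'I_K.+1}) : {ffun J -> 'I_K.+1} :=
  [ffun j => if j == i then inord (q j).+1 else q j].
pose down (q : {ffun J -> 'I_K.+1}) : {ffun J -> 'I_K.+1} :=
  [ffun j => if j == i then inord (q j).-1 else q j].
have hup (q : {ffun J -> 'I_K.+1}) : (q i < K)%N -> up q i = (q i).+1 :> nat.
  by move=> h; rewrite ffunE eqxx inordK.
rewrite [RHS](bigID (fun q : {ffun J -> 'I_K.+1} => (0 < q i)%N)) /=.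
rewrite [X in _ = _ + X]big1 ?addr0; last first.
  by move=> q; rewrite lt0n negbK => /eqP ->; rewrite scale0r.
rewrite [RHS](reindex_onto up down) /=; last first.
  move=> q hq; apply/ffunP => j; rewrite !ffunE; case: eqP => [->|//].
  apply: val_inj => /=.
  have e : (inord (q i).-1 : 'I_K.+1) = (q i).-1 :> nat.
    by rewrite inordK // (leq_ltn_trans (leq_pred _)).
  by rewrite e prednK // inordK.
rewrite [LHS](bigID (fun q : {ffun J -> 'I_K.+1} => (q i < K)%N)) /=.
rewrite [X in _ + X = _]big1 ?addr0; last first.
  move=> q; rewrite -leqNgt => h; rewrite H0 ?scaler0 // !ffunE eqxx addn1 ltnS.
  exact: h.
apply: eq_big => q.
  case: (ltnP (q i) K) => h.
    rewrite hup //=; apply/esym/eqP/ffunP => j; rewrite !ffunE; case: eqP => [->|//].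
    by apply: val_inj; rewrite /= !inordK //= ltnW.
  (* For q i = K the successor is out of range and [inord] falls back to 0, so the condition 0 < up
     q i excludes exactly these q. *)
  have -> : up q i = 0%N :> nat.
    rewrite ffunE eqxx /inord /insubd insubF //=.
    by rewrite ltnS; apply/negbTE; rewrite -ltnNge.
  by rewrite ltnn.
move=> h; rewrite hup //; congr (_ *: H _); apply/ffunP => j; rewrite !ffunE.
case: eqP => [->|_]; last by rewrite addn0.
by rewrite inordK ?addn1.
Qed.

Lemma sum_bump_bool (i : J) (H : {ffun J -> nat} -> V) :
  (forall q : {ffun J -> nat}, (1 < q i)%N -> H q = 0) ->
  \sum_(q : {ffun J -> bool}) ((q i).+1)%:R *: H (bump1 i (natb q))
  = \sum_(q : {ffun J -> bool}) (q i)%:R *: H (natb q).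
Proof.
move=> H0.
pose tog (q : {ffun J -> bool}) : {ffun J -> bool} :=
  [ffun j => if j == i then ~~ q j else q j].
have togK : involutive tog.
  by move=> q; apply/ffunP => j; rewrite !ffunE; case: eqP => // ->; rewrite negbK.
rewrite [RHS](reindex_inj (inv_inj togK)) /=; apply: eq_bigr => q _.
rewrite [in RHS]ffunE eqxx; case: (boolP (q i)) => h /=.
  by rewrite H0 ?scaler0 ?scale0r // !ffunE h eqxx.
congr (_ *: H _); apply/ffunP => j; rewrite !ffunE.
by case: eqP => [->|_]; rewrite ?addn0 // (negPf h).
Qed.

End Reindexing.

Section TotalReindexing.
Variables (C : fieldType) (V : lmodType C) (J J' : finType).
Implicit Types (q : {ffun J -> nat}) (l : {ffun J' -> nat}).

Definition total (q : {ffun J -> nat}) (l : {ffun J' -> nat}) : nat :=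
  (\sum_i q i + \sum_j l j)%N.

Lemma sum_bump1 (T : finType) (i : T) (s : {ffun T -> nat}) :
  (\sum_j bump1 i s j = (\sum_j s j).+1)%N.
Proof.
under eq_bigr => j _ do rewrite ffunE.
rewrite big_split /= -addn1; congr (_ + _)%N.
by rewrite (bigD1 i) //= eqxx big1 ?addn0 // => j /negPf ->.
Qed.

Lemma total_bumpl i q l : total (bump1 i q) l = (total q l).+1.
Proof. by rewrite /total sum_bump1. Qed.

Lemma total_bumpr j q l : total q (bump1 j l) = (total q l).+1.
Proof. by rewrite /total sum_bump1 addnS. Qed.

(** The factor [total] is split into its summands q i and l j, and each is absorbed by one shift.
    This is the cancellation that makes the basis vectors harmonic: the left side comes from d/dx_m
    d/dx_(2m), the right side from the other pairs. N is a separate argument of G since the two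
    sides change it differently. *)
Lemma sum_bump_total (K : nat) (G : {ffun J -> nat} -> {ffun J' -> nat} -> nat -> V) :
  (forall q l N i, (K < q i)%N -> G q l N = 0) ->
  (forall q l N j, (1 < l j)%N -> G q l N = 0) ->
  \sum_(q : {ffun J -> 'I_K.+1}) \sum_(l : {ffun J' -> bool})
    (total (natf q) (natb l))%:R *: G (natf q) (natb l) (total (natf q) (natb l)).-1
  = \sum_(q : {ffun J -> 'I_K.+1}) \sum_(l : {ffun J' -> bool})
    (\sum_i (natf q i).+1%:R *: G (bump1 i (natf q)) (natb l) (total (natf q) (natb l))
     + \sum_j (natb l j).+1%:R *: G (natf q) (bump1 j (natb l)) (total (natf q) (natb l))).
Proof.
move=> Gq Gl.
transitivity (\sum_(q : {ffun J -> 'I_K.+1}) \sum_(l : {ffun J' -> bool})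
   (\sum_i (q i)%:R *: G (natf q) (natb l) (total (natf q) (natb l)).-1
    + \sum_j (l j)%:R *: G (natf q) (natb l) (total (natf q) (natb l)).-1)).
  apply: eq_bigr => q _; apply: eq_bigr => l _; rewrite -!scaler_suml -scalerDl /total.
  congr (_ *: _); rewrite natrD !natr_sum.
  by congr (_ + _); apply: eq_bigr => i _; rewrite ffunE.
under [LHS]eq_bigr => q _ do rewrite big_split /=.
under [RHS]eq_bigr => q _ do rewrite big_split /=.
rewrite !big_split /=; congr (_ + _).
  rewrite exchange_big [RHS]exchange_big; apply: eq_bigr => l _ /=.
  rewrite exchange_big [RHS]exchange_big; apply: eq_bigr => i _ /=.
  rewrite -(sum_bump_ord (H := fun q => G q (natb l) (total q (natb l)).-1)).
    apply: eq_bigr => q _; have -> : natf q i = q i by rewrite ffunE.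
    by rewrite total_bumpl.
  by move=> q h; apply: Gq h.
apply: eq_bigr => q _ /=.
rewrite exchange_big [RHS]exchange_big; apply: eq_bigr => j _ /=.
rewrite -(sum_bump_bool (H := fun l => G (natf q) l (total (natf q) l).-1)).
  apply: eq_bigr => l _; have -> : natb l j = l j by rewrite ffunE.
  by rewrite total_bumpr.
by move=> l h; apply: Gl h.
Qed.

End TotalReindexing.

(** * The theta factors of the basis vectors *)

Section ThetaBlocks.
Variables (C : fieldType) (M n : nat) (beta : {ffun 'I_(n + n) -> bool}).
Local Notation A := (superpoly C M (n + n)).
Implicit Types (f : A) (l : {ffun 'I_n -> nat}) (s : seq 'I_n).
Local Notation bt j := (nat_of_bool (beta (lshift n j))).
Local Notation bt' j := (nat_of_bool (beta (rshift n j))).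

(** Here l takes values in the natural numbers so that it can be shifted; values above one are
    killed by the coefficient [psi]. *)
Definition block l (j : 'I_n) f : A :=
  (-1) ^+ (bt j * l j) *: iter (bt j - l j) (theta (lshift n j))
               (iter (bt' j - l j) (theta (rshift n j)) f).

Definition pair_dtheta (j : 'I_n) f : A :=
  dtheta (lshift n j) (dtheta (rshift n j) f).

Definition psi (j : 'I_n) (k : nat) : C :=
  (-1) ^+ k * ('C(bt j, k)%:R * 'C(bt' j, k)%:R).

Definition pair_index (q : 'I_(n + n)) : 'I_n :=
  match split q with inl j => j | inr j => j end.

Lemma pair_index_l j : pair_index (lshift n j) = j.
Proof. by rewrite /pair_index split_lshift'. Qed.
Lemma pair_index_r j : pair_index (rshift n j) = j.
Proof. by rewrite /pair_index split_rshift'. Qed.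

Lemma pair_dtheta_theta j q f : pair_index q != j ->
  pair_dtheta j (theta q f) = theta q (pair_dtheta j f).
Proof.
move=> h; rewrite /pair_dtheta dtheta_theta.
have -> : (rshift n j == q) = false.
  by apply: contraNF h => /eqP <-; rewrite pair_index_r.
rewrite scale0r sub0r dthetaN dtheta_theta.
have -> : (lshift n j == q) = false.
  by apply: contraNF h => /eqP <-; rewrite pair_index_l.
by rewrite scale0r sub0r opprK.
Qed.

Lemma pair_dtheta_block l j j' f : j' != j ->
  pair_dtheta j (block l j' f) = block l j' (pair_dtheta j f).
Proof.
have it k q g : pair_index q != j ->
    pair_dtheta j (iter k (theta q) g) = iter k (theta q) (pair_dtheta j g).
  by move=> h; elim: k => //= k IH; rewrite pair_dtheta_theta // IH.
move=> h; rewrite /block -!it ?pair_index_l ?pair_index_r //.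
by rewrite /pair_dtheta !linearZ.
Qed.

Lemma dtheta_block q l j f : pair_index q != j -> dtheta q f = 0 ->
  dtheta q (block l j f) = 0.
Proof.
have it k q' g : q != q' -> dtheta q g = 0 -> dtheta q (iter k (theta q') g) = 0.
  move=> h hg; elim: k => //= k IH.
  by rewrite dtheta_theta (negPf h) scale0r sub0r IH linear0 oppr0.
move=> h hf; rewrite /block linearZ /= !it ?scaler0 //;
  by apply: contraNneq h => ->; rewrite ?pair_index_l ?pair_index_r.
Qed.

Definition blocks l s f : A := foldr (block l) f s.

Lemma dtheta_blocks q l s f : pair_index q \notin s -> dtheta q f = 0 ->
  dtheta q (blocks l s f) = 0.
Proof.
move=> h hf; elim: s h => //= j s IH; rewrite inE negb_or => /andP[h1 h2].
by apply: dtheta_block => //; exact: IH.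
Qed.

(** The double derivative is even, so it passes through the other blocks. In block j it gives
    something only if l j = 0 and both theta_j and theta_(n+j) are present; the result - 1 is then
    the sign (-1)^(beta_j l_j) of the block with l j = 1. *)
Lemma pair_dtheta_blocks l s j f : uniq s -> j \in s -> (forall q, dtheta q f = 0) ->
  psi j (l j) *: pair_dtheta j (blocks l s f)
  = - ((l j).+1%:R * psi j (l j).+1) *: blocks (bump1 j l) s f.
Proof.
move=> + + hf; elim: s => //= j0 s IH /andP[js us]; rewrite inE.
case: (eqVneq j j0) => [e {IH} _|jj0 /= hj].
  rewrite -{j0}e in js *.
  have -> : blocks (bump1 j l) s f = blocks l s f.
    elim: s js us => //= j1 s IH; rewrite inE negb_or => /andP[h1 h2] /andP[_ us].
    rewrite IH // /block ffunE (_ : (j1 == j) = false) ?addn0 //.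
    by apply/negbTE; rewrite eq_sym.
  have h1 : dtheta (lshift n j) (blocks l s f) = 0.
    by apply: dtheta_blocks; rewrite ?pair_index_l.
  have h2 : dtheta (rshift n j) (blocks l s f) = 0.
    by apply: dtheta_blocks; rewrite ?pair_index_r.
  move: (blocks l s f) h1 h2 => g h1 h2.
  rewrite /block ffunE eqxx addn1 /psi /pair_dtheta.
  case: (l j) => [|k] /=.
    rewrite !subn0 muln0 !bin0 !bin1 expr0 scale1r !mul1r scale1r.
    case: (beta (lshift n j)); case: (beta (rshift n j)) => /=;
      rewrite ?(mulr0, mul0r) ?oppr0 ?scale0r ?h1 ?h2 ?linear0 //.
      rewrite dtheta_theta eq_rlshift scale0r sub0r dtheta_theta eqxx scale1r h2.
      rewrite linear0 subr0 dthetaN dtheta_theta eqxx scale1r h1 linear0 subr0.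
      by rewrite !mulr1 muln1 !expr1 opprK scale1r scaleN1r.
    - by rewrite dtheta_theta eq_rlshift scale0r sub0r h2 linear0 oppr0 linear0.
    - by rewrite dtheta_theta eqxx scale1r h2 linear0 subr0.
  have b0 (b : bool) : (b - k.+1 = 0)%N by case: b; rewrite ?subn_eq0 // subSS sub0n.
  have c0 (b : bool) : 'C(b, k.+2) = 0%N by case: b.
  rewrite !b0 /= !c0 mulr0 mulr0 mulr0 oppr0 scale0r !linearZ /= h2 linear0.
  by rewrite !scaler0.
rewrite pair_dtheta_block 1?eq_sym // [block (bump1 _ _) _ _]/block ffunE.
rewrite (_ : (j0 == j) = false) ?addn0; last by apply/negbTE; rewrite eq_sym.
rewrite -/(block l j0 _).
have bZ z g : z *: block l j0 g = block l j0 (z *: g).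
  have iZ k q h : iter k (@theta C M (n + n) q) (z *: h) = z *: iter k (theta q) h.
    by elim: k => //= k ->; rewrite linearZ.
  by rewrite /block !iZ !scalerA mulrC.
by rewrite !bZ IH.
Qed.

Lemma blocks_xmul l s i f : xmul i (blocks l s f) = blocks l s (xmul i f).
Proof.
elim: s => //= j s <-; rewrite /block linearZ /=; congr (_ *: _).
have it k q g : xmul i (iter k (theta q) g) = iter k (theta q) (xmul i g).
  by elim: k => //= k <-; rewrite theta_xmul.
by rewrite !it.
Qed.

Lemma blocks_dx l s i f : dx i (blocks l s f) = blocks l s (dx i f).
Proof.
elim: s => //= j s <-; rewrite /block linearZ /=; congr (_ *: _).
have it k q g : dx i (iter k (theta q) g) = iter k (theta q) (dx i g).
  by elim: k => //= k <-; rewrite theta_dx.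
by rewrite !it.
Qed.

Lemma blocks_is_linear l s : linear (blocks l s).
Proof.
move=> a f g; elim: s => //= j s ->.
have it k q h1 h2 : iter k (@theta C M (n + n) q) (a *: h1 + h2)
    = a *: iter k (theta q) h1 + iter k (theta q) h2.
  by elim: k => //= k ->; rewrite linearP.
by rewrite /block !it scalerDr !scalerA mulrC.
Qed.
HB.instance Definition _ l s :=
  GRing.isLinear.Build C A A *:%R (blocks l s) (@blocks_is_linear l s).

Lemma blocksZ l s (z : C) f : blocks l s (z *: f) = z *: blocks l s f.
Proof. exact: linearZ. Qed.

Definition theta_set : {set 'I_(n + n)} := [set q | beta q]%SET.

Lemma blocks0_elem al :
  exists2 z : C, z * z = 1 &
    blocks [ffun=> 0%N] (enum 'I_n) (elem C al finset.set0) = z *: elem C al theta_set.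
Proof.
suff h s : uniq s -> exists2 z : C, z * z = 1 &
    blocks [ffun=> 0%N] s (elem C al finset.set0)
    = z *: elem C al [set q | beta q && (pair_index q \in s)]%SET.
  have [z z1 ->] := h _ (enum_uniq 'I_n); exists z => //; congr (_ *: elem C _ _).
  by apply/setP => q; rewrite !inE mem_enum andbT.
elim: s => [_|j s IH /= /andP[js /IH[z z1 ->]]].
  exists 1; rewrite ?mulr1 // scale1r; congr elem.
  by apply/setP => q; rewrite !inE andbF.
have step (q : 'I_(n + n)) (S : {set 'I_(n + n)}) (g : A) :
    q \notin S -> (exists2 z : C, z * z = 1 & g = z *: elem C al S) ->
    exists2 z : C, z * z = 1 & iter (beta q) (theta q) g
      = z *: elem C al (if beta q then q |: S else S)%SET.
  move=> qS [y y1 ->]; case: (beta q); last by exists y.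
  exists (y * theta_sign C q S); first by rewrite mulrACA y1 theta_sign_sq mulr1.
  by rewrite /= linearZ /= theta_elem (negPf qS) scalerA.
rewrite /block ffunE muln0 expr0 scale1r !subn0.
set S := [set q | _]%SET.
have hr : rshift n j \notin S by rewrite inE pair_index_r (negPf js) andbF.
have hl : lshift n j \notin S by rewrite inE pair_index_l (negPf js) andbF.
have hi := step (rshift n j) S _ hr (ex_intro2 _ _ z z1 erefl).
have ho : lshift n j \notin (if beta (rshift n j) then rshift n j |: S else S)%SET.
  by case: ifP => // _; rewrite finset.in_setU1 (negPf hl) eq_lrshift.
have [y y1 ->] := step (lshift n j) _ _ ho hi.
exists y => //; congr (_ *: elem C _ _); apply/setP => q; rewrite !inE.
case: (split_ordP q) => i ->; rewrite ?pair_index_l ?pair_index_r.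
  case: (boolP (beta (lshift n j))) => hb; case: (boolP (beta (rshift n j))) => hb';
  rewrite !inE ?pair_index_l ?(inj_eq (@lshift_inj _ _)) ?eq_lrshift //=;
  by case: (eqVneq i j) => [->|]; rewrite ?hb ?(negPf hb).
case: (boolP (beta (lshift n j))) => hb; case: (boolP (beta (rshift n j))) => hb';
rewrite !inE ?pair_index_r ?(inj_eq (@rshift_inj _ _)) ?eq_rlshift //=;
by case: (eqVneq i j) => [->|]; rewrite ?hb' ?(negPf hb').
Qed.

End ThetaBlocks.

(** * The bilinear form *)

Section Form.
Variables (C : fieldType) (M N r : nat).
Local Notation A := (superpoly C M N).
Local Notation I := 'I_(M + N).
Implicit Types (f g : A) (al : 'X_{1..M}) (S : {set 'I_N}) (a b : I).

Variable rho : I -> C.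
Hypothesis rho_sq : forall a, rho a * rho a = 1.

(** The square norm of a monomial for the Fischer form, twisted by the signs [rho]. *)
Definition mweight al S : C :=
  \prod_i (((al i)`!)%:R * rho (lshift N i) ^+ al i) * \prod_(q in S) rho (rshift M q).

(* Multiplication by a variable and the corresponding derivation are adjoint
   up to the sign rho. *)
Definition form f g : C :=
  \sum_S \sum_(al <- msupp (f S)) mweight al S * (cf al S f * cf al S g).

Lemma mweight_addU al i S : mweight (al + U_(i)) S
  = mweight al S * ((al i).+1%:R * rho (lshift N i)).
Proof.
rewrite /mweight [RHS]mulrAC; congr (_ * _).
rewrite (bigD1 i) //= [in RHS](bigD1 i) //= mnmDE mnm1E eqxx addn1 factS natrM exprS.
rewrite (eq_bigr (fun j => ((al j)`!)%:R * rho (lshift N j) ^+ al j)); first by ring.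
by move=> j ji; rewrite mnmDE mnm1E eq_sym (negPf ji) addn0.
Qed.

Lemma mweight_setU al p S : p \notin S ->
  mweight al (p |: S)%SET = mweight al S * rho (rshift M p).
Proof.
move=> h; rewrite /mweight -mulrA; congr (_ * _).
by rewrite big_setU1 //= mulrC.
Qed.

(** The form sums over the support of its first argument; enlarging the list to a common one makes
    linearity in that argument accessible. *)
Lemma form_support f g S (s : seq 'X_{1..M}) : uniq s -> {subset msupp (f S) <= s} ->
  \sum_(al <- s) mweight al S * (cf al S f * cf al S g)
  = \sum_(al <- msupp (f S)) mweight al S * (cf al S f * cf al S g).
Proof.
move=> us hs; rewrite (bigID (mem (msupp (f S)))) /= [X in _ + X]big1 ?addr0; last first.
  move=> al; rewrite -mcoeff_eq0 => /eqP h.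
  by rewrite (_ : cf al S f = 0) ?mul0r ?mulr0.
rewrite -big_filter; apply: perm_big; apply: uniq_perm.
- by rewrite filter_uniq.
- exact: msupp_uniq.
- by move=> al; rewrite mem_filter andb_idr //; exact: hs.
Qed.

Lemma formPl z f1 f2 g : form (z *: f1 + f2) g = z * form f1 g + form f2 g.
Proof.
rewrite /form mulr_sumr -big_split; apply: eq_bigr => S _ /=.
pose s := undup (msupp ((z *: f1 + f2) S) ++ msupp (f1 S) ++ msupp (f2 S)).
have us : uniq s by exact: undup_uniq.
rewrite -(form_support _ us); last by move=> al h; rewrite mem_undup mem_cat h.
rewrite -(form_support (f := f1) _ us); last first.
  by move=> al h; rewrite mem_undup !mem_cat h orbT.
rewrite -(form_support (f := f2) _ us); last first.
  by move=> al h; rewrite mem_undup !mem_cat h !orbT.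
rewrite mulr_sumr -big_split; apply: eq_bigr => al _ /=.
by rewrite linearP /=; ring.
Qed.

Lemma formPr z f g1 g2 : form f (z *: g1 + g2) = z * form f g1 + form f g2.
Proof.
rewrite /form mulr_sumr -big_split; apply: eq_bigr => S _ /=.
rewrite mulr_sumr -big_split; apply: eq_bigr => al _ /=.
by rewrite linearP /=; ring.
Qed.

Lemma form0l g : form 0 g = 0.
Proof.
rewrite /form big1 // => S _; rewrite big1 // => al _.
by rewrite raddf0 mul0r mulr0.
Qed.

Lemma form0r f : form f 0 = 0.
Proof.
rewrite /form big1 // => S _; rewrite big1 // => al _.
by rewrite raddf0 !mulr0.
Qed.

Lemma formDl f1 f2 g : form (f1 + f2) g = form f1 g + form f2 g.
Proof. by rewrite -[f1]scale1r formPl mul1r scale1r. Qed.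

Lemma formZl z f g : form (z *: f) g = z * form f g.
Proof. by rewrite -[z *: f]addr0 formPl form0l addr0. Qed.

Lemma formDr f g1 g2 : form f (g1 + g2) = form f g1 + form f g2.
Proof. by rewrite -[g1]scale1r formPr mul1r scale1r. Qed.

Lemma formZr z f g : form f (z *: g) = z * form f g.
Proof. by rewrite -[z *: g]addr0 formPr form0r addr0. Qed.

Lemma form_suml (J : Type) (s : seq J) (P : pred J) (F : J -> A) g :
  form (\sum_(j <- s | P j) F j) g = \sum_(j <- s | P j) form (F j) g.
Proof. by apply: (big_morph (form^~ g)) => [x y|]; rewrite ?formDl ?form0l. Qed.

Lemma form_sumr (J : Type) (s : seq J) (P : pred J) (F : J -> A) f :
  form f (\sum_(j <- s | P j) F j) = \sum_(j <- s | P j) form f (F j).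
Proof. by apply: (big_morph (form f)) => [x y|]; rewrite ?formDr ?form0r. Qed.

Lemma form_elem al S g : form (elem C al S) g = mweight al S * cf al S g.
Proof.
rewrite /form (bigD1 S) //= [X in _ + X]big1 ?addr0; last first.
  move=> T TS; rewrite big1 // => be _.
  by rewrite cf_elem (negPf TS) andbF mul0r mulr0.
rewrite -(@form_support _ _ _ (undup (al :: msupp (elem C al S S)))) ?undup_uniq //;
  last by move=> be h; rewrite mem_undup inE h orbT.
rewrite (bigD1_seq al) ?undup_uniq ?mem_undup ?inE ?eqxx //= big1 ?addr0.
  by rewrite cf_elem !eqxx mul1r.
by move=> be h; rewrite cf_elem (negPf h) mul0r mulr0.
Qed.

Lemma formC f g : form f g = form g f.
Proof.
apply: (elem_ind (P := fun f => form f g = form g f)) => [|z f1 f2 h1 h2|al S _].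
- by rewrite form0l form0r.
- by rewrite formPl formPr h1 h2.
apply: (elem_ind (P := fun g => form (elem C al S) g = form g (elem C al S))).
- by rewrite form0l form0r.
- by move=> z g1 g2 h1 h2; rewrite formPl formPr h1 h2.
move=> be T _; rewrite !form_elem !cf_elem.
case: (eqVneq al be) => [->|]; rewrite ?mulr0 //=.
by case: (eqVneq S T) => [->|]; rewrite ?mulr0.
Qed.

Lemma form_ext (T : {linear A -> A}) g h :
  (forall al S, form (T (elem C al S)) g = form (elem C al S) h) ->
  forall f, form (T f) g = form f h.
Proof.
move=> e f; apply: (elem_ind (P := fun f => form (T f) g = form f h)) => //.
- by rewrite linear0 !form0l.
- by move=> z f1 f2 h1 h2; rewrite linearP !formPl h1 h2.
Qed.

Lemma form_xmul i f g : form (xmul i f) g = rho (lshift N i) * form f (dx i g).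
Proof.
rewrite -formZr; apply: (form_ext (T := xmul i)) => al S.
by rewrite /= xmul_elem !form_elem mweight_addU linearZ /= cf_dx; ring.
Qed.

Lemma form_theta p f g : form (theta p f) g = rho (rshift M p) * form f (dtheta p g).
Proof.
rewrite -formZr; apply: (form_ext (T := theta p)) => al S.
rewrite /= theta_elem form_elem linearZ /= cf_dtheta.
case: (boolP (p \in S)) => pS; first by rewrite form0l !mulr0.
by rewrite formZl form_elem mweight_setU //; ring.
Qed.

Lemma form_dx i f g : form (dx i f) g = rho (lshift N i) * form f (xmul i g).
Proof. by rewrite [in RHS]formC form_xmul mulrA rho_sq mul1r formC. Qed.

(** For i < r the additional sign is that of [Dop], which is - x_i there. *)
Definition adj_sign a : C :=
  if split a is inl i then if (i < r)%N then - rho a else rho a else rho a.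

Lemma adj_sign_sq a : adj_sign a * adj_sign a = 1.
Proof.
by rewrite /adj_sign; case: split => [i|q]; try case: ifP => _; rewrite ?mulrNN rho_sq.
Qed.

Lemma form_Zop a f g : form (Zop r a f) g = adj_sign a * form f (Dop r a g).
Proof.
rewrite /adj_sign; case: (split_ordP a) => i ->.
  rewrite Zop_x Dop_x; case: ifP => _; last by rewrite form_xmul.
  by rewrite form_dx -scaleN1r formZr mulN1r mulrNN.
by rewrite Zop_theta Dop_theta form_theta.
Qed.

Lemma form_Dop a f g : form (Dop r a f) g = adj_sign a * form f (Zop r a g).
Proof. by rewrite [in RHS]formC form_Zop mulrA adj_sign_sq mul1r formC. Qed.

Lemma form_disjoint f g : (forall al S, cf al S f * cf al S g = 0) -> form f g = 0.
Proof.
by move=> h; rewrite /form big1 // => S _; rewrite big1 // => al _; rewrite h mulr0.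
Qed.

End Form.

(** * Boundary monomials and division by eta *)

Section Modules.
Variables (C : fieldType) (p n r : nat).
Local Notation m := p.+1.
Local Notation A := (superpoly C (m + m) (n + n)).
Local Notation I := 'I_((m + m) + (n + n)).
Local Notation gl := 'M[C]_((m + m) + (n + n)).
Local Notation Z := (@Zop C (m + m) (n + n) r).
Local Notation D := (@Dop C (m + m) (n + n) r).
Local Notation zs := (@zsign (m + m) (n + n) r).
Local Notation deg := (wt zs).
Local Notation A_ := (@A_ C m n r).
Local Notation H_ := (@H_ C m n r).
Local Notation osp := (@osp C m n).
Local Notation submodule := (submodule osp (@gl_act C m n r)).
Local Notation irreducible := (irreducible osp (@gl_act C m n r)).
Local Notation irreducible_quotient := (irreducible_quotient osp (@gl_act C m n r)).
Local Notation lapT := (@lap C m n r xpredT).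
Local Notation mulT := (@mulform C m n r xpredT).
Hypotheses (char0 : [pchar C] =i pred0) (two_neq0 : (2%:R : C) != 0)
  (r0 : (0 < r)%N) (rp : (r <= p)%N).

Let rm : (r <= m)%N. Proof. exact: leqW. Qed.

Implicit Types (f g h : A) (a b : I) (Q : pred 'I_m) (om : I -> int)
  (al be : 'X_{1..m + m}) (S : {set 'I_(n + n)}).

Definition xm : 'I_(m + m) := lshift m ord_max.
Definition ym : 'I_(m + m) := rshift m ord_max.
Definition inner : pred 'I_m := fun i => i != ord_max.

Lemma natr_neq0 k : (k.+1%:R != 0 :> C).
Proof. by rewrite (pcharf0P C).1. Qed.

Lemma xm_neq_ym : xm != ym. Proof. by rewrite eq_lrshift. Qed.

Lemma lap_split f : lapT f = dx xm (dx ym f) + lap r inner f.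
Proof.
rewrite /lap (bigD1 ord_max) //= Dop_hi // Dop_y // -addrA; congr (_ + (_ + _)).
Qed.

Lemma mulform_split f : mulT f = xmul xm (xmul ym f) + mulform r inner f.
Proof.
rewrite /mulform (bigD1 ord_max) //= Zop_hi // Zop_y // -addrA; congr (_ + (_ + _)).
Qed.

Definition on_boundary al : bool := (al xm == 0%N) || (al ym == 0%N).

Definition om_xm : I -> int := omega (fun i => (i == ord_max)%:Z) (fun=> 0) (fun=> 0) (fun=> 0).
Definition om_ym : I -> int := omega (fun=> 0) (fun i => (i == ord_max)%:Z) (fun=> 0) (fun=> 0).

Lemma sum_max (F : 'I_m -> int) : \sum_i (i == ord_max)%:Z * F i = F ord_max.
Proof.
rewrite (bigD1 ord_max) // eqxx mul1r big1 /= ?addr0 // => i h.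
by rewrite (negPf h) mul0r.
Qed.

Lemma wt_xm al S : wt om_xm al S = (al xm)%:Z.
Proof.
rewrite wtE /om_xm.
under eq_bigr => i _ do rewrite omega_x.
rewrite sum_max !big1 ?addr0 // => i _; by rewrite ?omegaE mul0r.
Qed.

Lemma wt_ym al S : wt om_ym al S = (al ym)%:Z.
Proof.
rewrite wtE /om_ym.
under [X in _ + X + _ + _]eq_bigr => i _ do rewrite omega_y.
rewrite sum_max !big1 ?addr0 ?add0r // => i _; by rewrite ?omegaE mul0r.
Qed.

Lemma supp_xm_lap_inner (P : int -> Prop) f : supp (fun al S => P (al xm)) f ->
  supp (fun al S => P (al xm)) (lap r inner f).
Proof.
move=> hf; apply: (sub_supp (Q := fun al S => P (wt om_xm al S + 0))).
  by move=> al S; rewrite wt_xm addr0.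
apply: supp_lap => [i hi|j|]; rewrite /om_xm ?omegaE ?(negPf hi) ?mulr0 //.
by apply: sub_supp hf => al S; rewrite wt_xm.
Qed.

Lemma supp_xm_mulform_inner (P : int -> Prop) f : supp (fun al S => P (al xm)) f ->
  supp (fun al S => P (al xm)) (mulform r inner f).
Proof.
move=> hf; apply: (sub_supp (Q := fun al S => P (wt om_xm al S - 0))).
  by move=> al S; rewrite wt_xm subr0.
apply: supp_mulform => [i hi|j|]; rewrite /om_xm ?omegaE ?(negPf hi) ?mulr0 //.
by apply: sub_supp hf => al S; rewrite wt_xm.
Qed.

Lemma supp_ym_mulform_inner (P : int -> Prop) f : supp (fun al S => P (al ym)) f ->
  supp (fun al S => P (al ym)) (mulform r inner f).
Proof.
move=> hf; apply: (sub_supp (Q := fun al S => P (wt om_ym al S - 0))).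
  by move=> al S; rewrite wt_ym subr0.
apply: supp_mulform => [i hi|j|]; rewrite /om_ym ?omegaE ?(negPf hi) ?mulr0 //.
by apply: sub_supp hf => al S; rewrite wt_ym.
Qed.

Definition drop_corner al : 'X_{1..m + m} := (al - U_(xm) - U_(ym))%MM.

Lemma drop_cornerK al : ~~ on_boundary al ->
  (drop_corner al + U_(ym) + U_(xm) = al)%MM.
Proof.
rewrite negb_or => /andP[hx hy]; rewrite /drop_corner !submK // lep1mP ?hx //.
by rewrite mnmBE mnm1E (negPf xm_neq_ym) subn0.
Qed.

Lemma drop_corner_xm al : ~~ on_boundary al -> al xm = (drop_corner al xm).+1.
Proof.
move=> h; rewrite -{1}(drop_cornerK h) !mnmDE !mnm1E eqxx.
by rewrite eq_sym (negPf xm_neq_ym) addn0 addn1.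
Qed.

(* A harmonic superpolynomial is determined by its monomials on which x_m or
   x_(2m) does not occur: the other ones are obtained by integrating. *)
Lemma boundary_inj h : lapT h = 0 ->
  (forall al S, on_boundary al -> cf al S h = 0) -> h = 0.
Proof.
move=> lh hb.
have hd d : forall al S, al xm = d -> cf al S h = 0.
  elim: d => [|d IH] al S hal; first by apply: hb; rewrite /on_boundary hal.
  have [/hb //|nb] := boolP (on_boundary al).
  have := congr1 (cf (drop_corner al) S) lh.
  rewrite lap_split raddfD raddf0 /= !cf_dx -addmA [(U_(xm) + _)%MM]addmC addmA drop_cornerK //.
  (* The inner Laplacian leaves the exponent of x_m unchanged, here d, and by induction h has no
     monomial with this exponent. *)
  have hs : supp (fun be _ => (be xm)%:Z <> d%:Z) h.
    by move=> be T hc [e]; rewrite IH // eqxx in hc.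
  rewrite [X in _ + X](_ : _ = 0); last first.
    apply/eqP/contraT => /(supp_xm_lap_inner (P := fun x => x <> d%:Z) hs) [].
    by move: (drop_corner_xm nb); rewrite hal => -[->].
  rewrite addr0 => /eqP; rewrite !mulf_eq0 !(negPf (natr_neq0 _)) /=.
  by move/eqP.
by apply: cfP => al S; rewrite raddf0 (hd _ _ _ erefl).
Qed.

Lemma wt_xm_bounded f : exists d : nat, supp (fun al S => (al xm < d)%N) f.
Proof.
have [d hd] := wt_bounded om_xm f; exists `|d|.+1.
by apply: sub_supp hd => al S; rewrite wt_xm; lia.
Qed.

Lemma cf_corner al S f :
  cf (al + U_(ym) + U_(xm))%MM S (xmul xm (xmul ym f)) = cf al S f.
Proof.
rewrite !cf_xmul mnmDE mnm1E eqxx addn1 /= addmK mnmDE mnm1E eqxx addn1 /= addmK.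
by [].
Qed.

(** The part of f with the highest exponent of x_m survives: x_m x_(2m) raises this exponent, the
    inner part of eta does not. *)
Lemma mulform_inj f : mulT f = 0 -> f = 0.
Proof.
move=> ef; have [d] := wt_xm_bounded f; elim: d => [|d IH] hd.
  by apply: cfP => al S; rewrite raddf0; apply/eqP/contraT => /hd.
apply: IH => al S hc; have := hd _ _ hc; rewrite ltnS leq_eqVlt => /orP[/eqP e|//].
have := congr1 (cf (al + U_(ym) + U_(xm))%MM S) ef.
have hs : supp (fun be _ => (be xm)%:Z <= d%:Z) f by move=> be T /hd; rewrite lez_nat.
rewrite mulform_split raddfD raddf0 /= cf_corner [X in _ + X](_ : _ = 0); last first.
  apply/eqP/contraT => /(supp_xm_mulform_inner (P := fun x => x <= d%:Z) hs).
  by rewrite !mnmDE !mnm1E eqxx e; lia.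
by rewrite addr0 => h0; move: hc; rewrite h0 eqxx.
Qed.

Lemma A_elem k al S : deg al S = k -> A_ k (elem C al S).
Proof. by move=> h; apply/A_P; apply: supp_elem. Qed.

Lemma A_elem_inv k f al S : A_ k f -> cf al S f != 0 -> deg al S = k.
Proof. by move/A_P; apply. Qed.

Lemma wt_add_corner om al S : wt om (al + U_(ym) + U_(xm))%MM S
  = wt om al S + om (iy n ord_max) + om (ix n ord_max).
Proof. by rewrite !wtDU. Qed.

(** Division with leading term x_m x_(2m): a monomial off the boundary is replaced by the inner part
    of eta applied to its quotient, which has fewer x_m. *)
Lemma mulform_division k f : A_ k f ->
  exists2 g, A_ (k - 2) g & supp (fun al _ => on_boundary al) (f - mulT g).
Proof.
move=> hf; have [d hd] := wt_xm_bounded f; elim: d f hf hd => [|d IH] f hf hd.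
  exists 0; first exact: subspace0 (A_subspace _ _ _ _ _).
  by rewrite raddf0 subr0 => al S /hd.
apply: (elem_ind (P := fun f => exists2 g, A_ (k - 2) g &
    supp (fun al _ => on_boundary al) (f - mulT g))).
- exists 0; first exact: subspace0 (A_subspace _ _ _ _ _).
  by rewrite raddf0 subr0; exact: supp0.
- move=> a f1 f2 [g1 h1 e1] [g2 h2 e2]; exists (a *: g1 + g2).
    by apply: (A_subspace _ _ _ _ _).2.
  rewrite linearP /= opprD addrACA -scalerBr.
  exact: suppP.
move=> al S hc; have hk := A_elem_inv hf hc; have hle := hd _ _ hc.
have [bd|nb] := boolP (on_boundary al).
  exists 0; first exact: subspace0 (A_subspace _ _ _ _ _).
  by rewrite raddf0 subr0; apply: supp_elem.
pose be := drop_corner al.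
have hbe : deg be S = k - 2.
  rewrite -hk -[in RHS](drop_cornerK nb) wt_add_corner zs_y // zs_x ltnNge rp /=.
  by rewrite -/be; lia.
have he : mulT (elem C be S) = elem C al S + mulform r inner (elem C be S).
  by rewrite mulform_split !xmul_elem drop_cornerK.
have [||g hg hs] := IH (mulform r inner (elem C be S)).
- by rewrite -[k](subrK 2); apply: A_mulform; apply: A_elem.
- apply: (supp_xm_mulform_inner (P := fun x => x < d%:Z)).
  apply: supp_elem; have := drop_corner_xm nb; rewrite -/be; lia.
exists (elem C be S - g).
  by apply: subspaceB => //; [exact: A_subspace|exact: A_elem].
rewrite (_ : _ - _ = -1 *: (mulform r inner (elem C be S) - mulT g)).
  exact: suppZ.
by rewrite scaleN1r raddfB /= he -addrA opprD addrA subrr add0r.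
Qed.

Definition wd (i : 'I_p) : 'I_m := widen_ord (leqnSn p) i.

Variant ord_spec : 'I_m -> Type :=
  | OrdWiden i : ord_spec (wd i)
  | OrdMax : ord_spec ord_max.

Lemma ord_wdP i : ord_spec i.
Proof.
case: (unliftP ord_max i) => [j|] ->; last exact: OrdMax.
rewrite (_ : lift _ _ = wd j); first exact: OrdWiden.
by apply: val_inj; exact: lift_max.
Qed.

Lemma wd_max i : (wd i == ord_max) = false.
Proof. by apply/negbTE; rewrite -val_eqE /= neq_ltn ltn_ord. Qed.

Lemma eq_wd i j : (wd i == wd j) = (i == j).
Proof. by rewrite -!val_eqE. Qed.

Lemma big_inner (V : nmodType) (F : 'I_m -> V) :
  \sum_(i | inner i) F i = \sum_(i < p) F (wd i).
Proof.
rewrite big_mkcond big_ord_recr /= /inner eqxx addr0; apply: eq_bigr => i _.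
by rewrite -/(wd i) wd_max.
Qed.

(** * The basis vectors are harmonic *)

Section BasisVector.
Variables (alpha : 'X_{1..m + m}) (beta : {ffun 'I_(n + n) -> bool}).
Implicit Types (q : {ffun 'I_p -> nat}) (l : {ffun 'I_n -> nat}) (N : nat).
Local Notation a i := (alpha (lshift m (wd i))).
Local Notation b i := (alpha (rshift m (wd i))).
Local Notation a' := (alpha xm).
Local Notation b' := (alpha ym).

Definition extend q N (i : 'I_m) : nat :=
  if insub (val i) is Some j then q j else N.

Lemma extend_wd q N i : extend q N (wd i) = q i.
Proof. by rewrite /extend /= valK. Qed.

Definition mono q N : 'X_{1..m + m} := [multinom
  match split j with
  | inl i => if i == ord_max then a' + N
             else if (i < r)%N then alpha (lshift m i) + extend q N i
             else alpha (lshift m i) - extend q N i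
  | inr i => if i == ord_max then b' + N else alpha (rshift m i) - extend q N i
  end%N | j < m + m].

Lemma mono_x q N i : mono q N (lshift m (wd i)) = (if (i < r) then a i + q i else a i - q i)%N.
Proof. by rewrite mnmE split_lshift' wd_max extend_wd. Qed.
Lemma mono_y q N i : mono q N (rshift m (wd i)) = (b i - q i)%N.
Proof. by rewrite mnmE split_rshift' wd_max extend_wd. Qed.
Lemma mono_xm q N : mono q N xm = (a' + N)%N.
Proof. by rewrite mnmE split_lshift' eqxx. Qed.
Lemma mono_ym q N : mono q N ym = (b' + N)%N.
Proof. by rewrite mnmE split_rshift' eqxx. Qed.
Definition monoE := (mono_x, mono_y, mono_xm, mono_ym).

Lemma mono_ext (al be : 'X_{1..m + m}) :
  (forall i, al (lshift m (wd i)) = be (lshift m (wd i))) ->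
  (forall i, al (rshift m (wd i)) = be (rshift m (wd i))) ->
  al xm = be xm -> al ym = be ym -> al = be.
Proof.
move=> hx hy hxm hym; apply/mnmP => j; case: (split_ordP j) => i ->;
  by case: (ord_wdP i).
Qed.

Lemma mono_wd_shift q N i : (q i < b i)%N -> (i < r)%N ->
  (mono q N - U_(rshift m (wd i)) + U_(lshift m (wd i)) = mono (bump1 i q) N)%MM.
Proof.
move=> hb hi; apply: mono_ext => [j|j||]; rewrite mnmDE mnmBE !monoE !mnm1E
  ?ffunE ?(inj_eq (@lshift_inj _ _)) ?(inj_eq (@rshift_inj _ _)) ?eq_lrshift ?eq_rlshift
  ?eq_wd ?wd_max ?subn0 ?addn0 //.
- case: (eqVneq i j) => [<-|_]; last by rewrite ?addn0.
  by rewrite hi addnA.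
- case: (eqVneq i j) => [<-|_]; last by rewrite ?addn0 ?subn0.
  by rewrite addn1 subnS subn1.
Qed.

Lemma mono_wd_drop q N i : (q i < b i)%N -> (q i < a i)%N -> (r <= i)%N ->
  (mono q N - U_(rshift m (wd i)) - U_(lshift m (wd i)) = mono (bump1 i q) N)%MM.
Proof.
move=> hb ha hi; apply: mono_ext => [j|j||]; rewrite !mnmBE !monoE !mnm1E
  ?ffunE ?(inj_eq (@lshift_inj _ _)) ?(inj_eq (@rshift_inj _ _)) ?eq_lrshift ?eq_rlshift
  ?eq_wd ?wd_max ?subn0 ?addn0 //.
- case: (eqVneq i j) => [<-|_]; last by rewrite ?addn0 ?subn0.
  by rewrite addn1 subnS subn1 ltnNge hi.
- case: (eqVneq i j) => [<-|_]; last by rewrite ?addn0 ?subn0.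
  by rewrite addn1 subnS subn1.
Qed.

(** The factors of the coefficient that involve q_i alone. When the multinomial coefficient is
    cancelled against the q_i! with i < r, the numerator keeps q_i! just for r <= i. *)
Definition phi (i : 'I_p) (k : nat) : C :=
  if (i < r)%N then 'C(b i, k)%:R
  else (-1) ^+ k * ('C(a i, k)%:R * 'C(b i, k)%:R) * (k`!)%:R.

Lemma bin_step (x k : nat) : (x - k)%:R * 'C(x, k)%:R = k.+1%:R * 'C(x, k.+1)%:R :> C.
Proof. by rewrite -!natrM -mul_bin_left. Qed.

(** With the normalization by [phi], the operators - x_i d/dx_(m+i) and d/dx_i d/dx_(m+i) act alike:
    both are minus the shift of q_i by one, times q_i + 1. *)
Lemma pair_step q N i :
  phi i (q i) *: D (ix n (wd i)) (D (iy n (wd i)) (elem C (mono q N) finset.set0))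
  = - ((q i).+1%:R * phi i (q i).+1) *: elem C (mono (bump1 i q) N) finset.set0.
Proof.
rewrite Dop_y // dx_elem mono_y; rewrite /phi; case: (ltnP i r) => hi.
  rewrite Dop_lo // linearZ /= xmul_elem scalerN scalerA -scaleNr mulrC bin_step.
  case: (ltnP (q i) (b i)) => h; first by rewrite mono_wd_shift.
  by rewrite bin_small // mulr0 oppr0 !scale0r.
rewrite Dop_hi // linearZ /= dx_elem mnmBE mnm1E eq_rlshift subn0 mono_x ltnNge hi /=.
rewrite !scalerA.
have -> : (-1) ^+ q i * ('C(a i, q i)%:R * 'C(b i, q i)%:R) * ((q i)`!)%:R
     * (b i - q i)%:R * (a i - q i)%:R = - ((q i).+1%:R *
       ((-1) ^+ (q i).+1 * ('C(a i, (q i).+1)%:R * 'C(b i, (q i).+1)%:R) * ((q i).+1`!)%:R)) :> C.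
  transitivity ((-1) ^+ q i * ((q i)`!)%:R * ((b i - q i)%:R * 'C(b i, q i)%:R)
     * ((a i - q i)%:R * 'C(a i, q i)%:R) : C); first by ring.
  by rewrite !bin_step factS natrM exprS; ring.
case: (ltnP (q i) (b i)) => h; last first.
  by rewrite ['C(b i, _)]bin_small // !(mulr0, mul0r) oppr0 !scale0r.
case: (ltnP (q i) (a i)) => h'; last first.
  by rewrite ['C(a i, _)]bin_small // !(mulr0, mul0r) oppr0 !scale0r.
by rewrite mono_wd_drop.
Qed.

Definition coef q l : C := \prod_i phi i (q i) * \prod_j psi C beta j (l j).

Definition term q l N : A :=
  coef q l *: blocks beta l (enum 'I_n) (elem C (mono q N) finset.set0).

Lemma prod_bump (J : finType) (F : J -> nat -> C) (i : J) (s : {ffun J -> nat}) :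
  \prod_j F j (bump1 i s j) = F i (s i).+1 * \prod_(j | j != i) F j (s j).
Proof.
rewrite (bigD1 i) //= ffunE eqxx addn1; congr (_ * _).
by apply: eq_bigr => j h; rewrite ffunE (negPf h) addn0.
Qed.

Lemma term_pair q l N i : D (ix n (wd i)) (D (iy n (wd i)) (term q l N))
  = - (q i).+1%:R *: term (bump1 i q) l N.
Proof.
rewrite /term !DopZ.
have -> f : D (ix n (wd i)) (D (iy n (wd i)) (blocks beta l (enum 'I_n) f))
    = blocks beta l (enum 'I_n) (D (ix n (wd i)) (D (iy n (wd i)) f)).
  rewrite !Dop_y // blocks_dx; case: (ltnP i r) => hi.
    by rewrite !Dop_lo // blocks_xmul linearN.
  by rewrite !Dop_hi // blocks_dx.
rewrite /coef (bigD1 i) //= prod_bump // -!mulrA.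
rewrite [phi i (q i) * (_ * _)]mulrC -[LHS]scalerA -[X in _ *: X = _]blocksZ pair_step blocksZ !scalerA.
by congr (_ *: _); ring.
Qed.

Lemma term_theta q l N j : D (iT m j) (D (iS m j) (term q l N))
  = - (l j).+1%:R *: term q (bump1 j l) N.
Proof.
rewrite /term !DopZ Dop_t Dop_s -/(pair_dtheta j _).
rewrite /coef [\prod_j psi _ _ _ _](bigD1 j) //= (prod_bump (psi C beta)) //.
rewrite [psi C beta j (l j) * _]mulrC -[LHS]scalerA -[X in _ *: X = _]scalerA.
rewrite pair_dtheta_blocks ?enum_uniq ?mem_enum //; last first.
  by move=> q'; rewrite dtheta_elem inE.
by rewrite !scalerA; congr (_ *: _); ring.
Qed.

Lemma dxZ i z (f : A) : dx i (z *: f) = z *: dx i f.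
Proof. exact: linearZ. Qed.

Lemma term_corner q l N : dx xm (dx ym (term q l N)) =
  ((b' + N)%:R * (a' + N)%:R) *: (coef q l *: blocks beta l (enum 'I_n)
     (elem C (mono q N - U_(ym) - U_(xm))%MM finset.set0)).
Proof.
rewrite /term !dxZ blocks_dx dx_elem blocksZ dxZ blocks_dx dx_elem blocksZ.
rewrite mono_ym mnmBE mnm1E eq_sym (negPf (xm_neq_ym)) subn0 mono_xm !scalerA.
by congr (_ *: _); ring.
Qed.

Lemma mono_corner q N : (mono q N.+1 - U_(ym) - U_(xm))%MM = mono q N.
Proof.
apply: mono_ext => [j|j||]; rewrite !mnmBE !monoE !mnm1E
  ?(inj_eq (@lshift_inj _ _)) ?(inj_eq (@rshift_inj _ _)) ?eq_lrshift ?eq_rlshift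
  ?[ord_max == _]eq_sym ?wd_max ?subn0 ?eqxx //; by rewrite addnS subn1.
Qed.

(** Equal to a'! b'! N! / ((a' + N)! (b' + N)!), so that d/dx_m d/dx_(2m) takes the term with N + 1
    to N + 1 times the term with N. *)
Definition weight N : C := ('C(a' + N, a')%:R * 'C(b' + N, b')%:R * (N`!)%:R)^-1.

Lemma weight_step N : weight N.+1 * ((b' + N.+1)%:R * (a' + N.+1)%:R) = N.+1%:R * weight N.
Proof.
have nz k : (0 < k)%N -> (k%:R != 0 :> C) by case: k => // k _; exact: natr_neq0.
have h (x : nat) : (x + N.+1)%:R * 'C(x + N, x)%:R = N.+1%:R * 'C(x + N.+1, x)%:R :> C.
  rewrite -!natrM; congr _%:R.
  by rewrite -[X in 'C(X, x)]/((x + N).+1.-1) -addnS mul_bin_down addKn.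
have n1 : 'C(a' + N, a')%:R != 0 :> C by apply: nz; rewrite bin_gt0 leq_addr.
have n2 : 'C(b' + N, b')%:R != 0 :> C by apply: nz; rewrite bin_gt0 leq_addr.
have n3 : 'C(a' + N.+1, a')%:R != 0 :> C by apply: nz; rewrite bin_gt0 leq_addr.
have n4 : 'C(b' + N.+1, b')%:R != 0 :> C by apply: nz; rewrite bin_gt0 leq_addr.
have n5 : (N`!)%:R != 0 :> C by apply: nz; rewrite fact_gt0.
have n6 : N.+1%:R != 0 :> C by apply: nz.
have ea : (a' + N.+1)%:R = N.+1%:R * 'C(a' + N.+1, a')%:R / 'C(a' + N, a')%:R :> C.
  by rewrite -h mulfK.
have eb : (b' + N.+1)%:R = N.+1%:R * 'C(b' + N.+1, b')%:R / 'C(b' + N, b')%:R :> C.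
  by rewrite -h mulfK.
rewrite /weight ea eb factS natrM; field.
by rewrite n1 n2 n3 n4 n5 -natr1 addrC in n6 *; rewrite n6.
Qed.

Definition vec q l N : A := weight N *: term q l N.

Hypothesis corner0 : (a' * b' = 0)%N.

Lemma vec_corner q l N : dx xm (dx ym (vec q l N)) = N%:R *: vec q l N.-1.
Proof.
rewrite /vec dxZ dxZ term_corner [LHS]scalerA; case: N => [|N].
  (* For N = 0 there is no lower term to produce; the derivative vanishes because the starting
     monomial lies on the boundary. *)
  have -> : (b' + 0)%:R * (a' + 0)%:R = 0 :> C by rewrite -natrM !addn0 mulnC corner0.
  by rewrite mulr0 !scale0r.
by rewrite weight_step mono_corner -scalerA.
Qed.

Definition lift_vector : A :=
  \sum_(q : {ffun 'I_p -> 'I_(mdeg alpha).+1}) \sum_(l : {ffun 'I_n -> bool})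
    vec (natf q) (natb l) (total (natf q) (natb l)).

Lemma phi_big i k : (mdeg alpha < k)%N -> phi i k = 0.
Proof.
move=> h; have hb : (b i < k)%N.
  by apply: leq_ltn_trans h; rewrite mdegE (bigD1 (rshift m (wd i))) //= leq_addr.
by rewrite /phi (bin_small hb); case: ifP => _; rewrite ?mulr0 ?mul0r.
Qed.

Lemma psi_big j k : (1 < k)%N -> psi C beta j k = 0.
Proof.
move=> h; rewrite /psi (@bin_small _ k) ?mul0r ?mulr0 //.
by apply: leq_ltn_trans h; exact: leq_b1.
Qed.

Lemma coef_eq0 q l : (exists i, phi i (q i) = 0) \/ (exists j, psi C beta j (l j) = 0) ->
  coef q l = 0.
Proof.
by rewrite /coef => -[[i h]|[j h]]; rewrite [X in X * _ = _](bigD1 i) || rewrite [X in _ * X = _](bigD1 j);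
  rewrite //= h !(mul0r, mulr0).
Qed.

(** The corner derivative multiplies a term by N and lowers N; the other pairs multiply it by - (q_i
    + 1) or - (l_j + 1) and raise q_i or l_j. Since N is the sum of all q_i and l_j, reindexing
    cancels everything. *)
Lemma lap_lift_vector : lapT lift_vector = 0.
Proof.
rewrite /lift_vector raddf_sum /=.
under eq_bigr => q _ do rewrite raddf_sum /=.
have e q l N : lapT (vec q l N) = N%:R *: vec q l N.-1
   - (\sum_i (q i).+1%:R *: vec (bump1 i q) l N + \sum_j (l j).+1%:R *: vec q (bump1 j l) N).
  rewrite lap_split // vec_corner /lap big_inner opprD -!sumrN; congr (_ + (_ + _));
    apply: eq_bigr => i _; rewrite /vec DopZ DopZ (term_pair, term_theta);
    by rewrite [LHS]scalerA [X in _ = - X]scalerA mulrN scaleNr mulrC.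
under eq_bigr => q _ do under eq_bigr => l _ do rewrite e.
under eq_bigr => q _ do rewrite sumrB.
rewrite sumrB; apply/eqP; rewrite subr_eq0; apply/eqP.
apply: (sum_bump_total (G := vec)) => q l N i h; rewrite /vec /term coef_eq0 ?scale0r ?scaler0 //.
  by left; exists i; exact: phi_big.
by right; exists i; exact: psi_big.
Qed.

End BasisVector.

Section BasisVectorForm.
Variables (alpha : 'X_{1..m + m}) (beta : {ffun 'I_(n + n) -> bool}).
Implicit Types (q : {ffun 'I_p -> nat}) (l : {ffun 'I_n -> nat}) (N : nat).
Local Notation a i := (alpha (lshift m (wd i))).
Local Notation b i := (alpha (rshift m (wd i))).
Local Notation a' := (alpha xm).
Local Notation b' := (alpha ym).
Local Notation mono := (mono alpha).

Lemma mono_prod q N : 'X_[C, mono q N] =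
  \prod_(i < p | (i < r)%N) ('X_(lshift m (wd i)) ^+ (a i + q i)
                            * 'X_(rshift m (wd i)) ^+ (b i - q i))
  * \prod_(i < p | (r <= i)%N) ('X_(lshift m (wd i)) ^+ (a i - q i)
                            * 'X_(rshift m (wd i)) ^+ (b i - q i))
  * ('X_xm ^+ (a' + N) * 'X_ym ^+ (b' + N)).
Proof.
rewrite mpolyXE_id big_split_ord /= !big_ord_recr /= mulrACA -big_split /=.
rewrite -/xm -/ym mono_xm mono_ym; congr (_ * _).
rewrite (bigID (fun i : 'I_p => (i < r)%N)) /=; congr (_ * _).
  by apply: eq_bigr => i h; rewrite -/(wd i) mono_x mono_y h.
apply: eq_big => [i|i h]; first by rewrite -leqNgt.
by rewrite -/(wd i) mono_x mono_y (negPf h).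
Qed.

Lemma coef_weight (q : {ffun 'I_p -> nat}) (l : {ffun 'I_n -> nat}) :
  let N := total q l in
  ((-1) ^+ (\sum_(i < p | (r <= i)%N) q i + \sum_j l j)%N
      * \prod_(i < p | (i < r)%N) 'C(b i, q i)%:R
      * \prod_(i < p | (r <= i)%N) ('C(a i, q i)%:R * 'C(b i, q i)%:R)
      * \prod_(j < n) ('C(beta (lshift n j), l j)%:R * 'C(beta (rshift n j), l j)%:R))
  / ('C(a' + N, a')%:R * 'C(b' + N, b')%:R
      * ((N`!)%:R / \prod_(i < p) ((q i)`!)%:R)
      * \prod_(i < p | (i < r)%N) ((q i)`!)%:R)
  = weight alpha N * coef alpha beta q l.
Proof.
move=> N; have nz k : (0 < k)%N -> (k%:R != 0 :> C) by case: k => // k _; exact: natr_neq0.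
rewrite /coef (bigID (fun i : 'I_p => (i < r)%N) xpredT (fun i => phi _ _ _)) /=.
have -> : \prod_(i < p | (i < r)%N) phi alpha i (q i)
    = \prod_(i < p | (i < r)%N) 'C(b i, q i)%:R.
  by apply: eq_bigr => i h; rewrite /phi h.
have -> : \prod_(i < p | ~~ (i < r)%N) phi alpha i (q i)
    = (-1) ^+ (\sum_(i < p | (r <= i)%N) q i)%N
      * \prod_(i < p | (r <= i)%N) ('C(a i, q i)%:R * 'C(b i, q i)%:R)
      * \prod_(i < p | (r <= i)%N) ((q i)`!)%:R.
  rewrite -prodrXr -!big_split /=; apply: eq_big => [i|i h]; first by rewrite -leqNgt.
  by rewrite /phi (negPf h).
have -> : \prod_j psi C beta j (l j) = (-1) ^+ (\sum_j l j)%N *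
    \prod_(j < n) ('C(beta (lshift n j), l j)%:R * 'C(beta (rshift n j), l j)%:R).
  by rewrite -prodrXr -big_split.
rewrite (bigID (fun i : 'I_p => (i < r)%N) xpredT (fun i => (q i)`!%:R)) /=.
rewrite [\prod_(i < p | ~~ _) _](eq_bigl (fun i : 'I_p => (r <= i)%N)); last first.
  by move=> i; rewrite -leqNgt.
rewrite exprD /weight.
have p0 (P : pred 'I_p) : \prod_(i | P i) ((q i)`!)%:R != 0 :> C.
  by apply/prodf_neq0 => i _; apply: nz; rewrite fact_gt0.
have n1 : 'C(a' + N, a')%:R != 0 :> C by apply: nz; rewrite bin_gt0 leq_addr.
have n2 : 'C(b' + N, b')%:R != 0 :> C by apply: nz; rewrite bin_gt0 leq_addr.
have n5 : (N`!)%:R != 0 :> C by apply: nz; rewrite fact_gt0.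
have p1 := p0 (fun i : 'I_p => (i < r)%N).
have p2 := p0 (fun i : 'I_p => (r <= i)%N).
field; rewrite n1 n2 n5 p1 p2 //.
Qed.

Lemma basis_vectorE : @basis_vector C p n r alpha beta = lift_vector alpha beta.
Proof.
apply: eq_bigr => q _; apply: eq_bigr => l _ /=.
have hN : (\sum_i q i + \sum_j l j)%N = total (natf q) (natb l).
  by congr (_ + _)%N; apply: eq_bigr => i _; rewrite ffunE.
rewrite /vec /term scalerA -coef_weight -hN -of_poly_elem mono_prod.
have en i : natf q i = q i by rewrite ffunE.
have eb i : natb l i = l i by rewrite ffunE.
under [X in _ = (_ / (_ * (_ / X) * _)) *: _]eq_bigr => i _ do rewrite en.
under [X in _ = (_ / (_ * _ * X)) *: _]eq_bigr => i _ do rewrite en.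
under [X in _ = ((-1) ^+ (X + _) * _ * _ * _ / _) *: _]eq_bigr => i _ do rewrite en.
under [X in _ = ((-1) ^+ (_ + X) * _ * _ * _ / _) *: _]eq_bigr => i _ do rewrite eb.
under [X in _ = ((-1) ^+ _ * X * _ * _ / _) *: _]eq_bigr => i _ do rewrite en.
under [X in _ = ((-1) ^+ _ * _ * X * _ / _) *: _]eq_bigr => i _ do rewrite en.
under [X in _ = ((-1) ^+ _ * _ * _ * X / _) *: _]eq_bigr => i _ do rewrite eb.
congr (_ *: _).
under [X in _ = blocks _ _ _ (of_poly _ (X * _ * _))]eq_bigr => i _ do rewrite en.
under [X in _ = blocks _ _ _ (of_poly _ (_ * X * _))]eq_bigr => i _ do rewrite en.
elim: (enum 'I_n) => //= j s IH.
by rewrite /block eb -IH.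
Qed.

Lemma supp_blocks (Q : 'X_{1..m + m} -> Prop) l s (f : A) :
  supp (fun al _ => Q al) f -> supp (fun al _ => Q al) (blocks beta l s f).
Proof.
have th (q : 'I_(n + n)) (g : A) : supp (fun al _ => Q al) g -> supp (fun al _ => Q al) (@theta C (m + m) (n + n) q g).
  move=> h al S; rewrite cf_theta; case: ifP => _; last by rewrite eqxx.
  by rewrite mulf_eq0 negb_or => /andP[_ /h].
have it k (q : 'I_(n + n)) (g : A) : supp (fun al _ => Q al) g ->
    supp (fun al _ => Q al) (iter k (@theta C (m + m) (n + n) q) g).
  by move=> h; elim: k => //= k IH; apply: th.
move=> h; elim: s => //= j s IH; apply: suppZ.
by apply: (it); apply: (it).
Qed.

Lemma total0P q l : total q l = 0%N -> q = [ffun=> 0%N] /\ l = [ffun=> 0%N].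
Proof.
move=> /eqP; rewrite addn_eq0 !sum_nat_eq0 => /andP[/forallP hq /forallP hl].
by split; apply/ffunP => i; rewrite ffunE; apply/eqP; [have := hq i|have := hl i].
Qed.

(** Terms with N > 0 are divisible by x_m x_(2m), so only q = 0, l = 0 meets the boundary. That term
    is the monomial itself, up to the sign z of reordering the theta's. *)
Lemma cf_lift_vector : exists2 z : C, z * z = 1 &
  forall al S, on_boundary al -> cf al S (lift_vector alpha beta)
    = z * ((al == alpha) && (S == theta_set beta))%:R.
Proof.
have [z z1 hz] := blocks0_elem C beta (mono [ffun=> 0%N] 0).
exists z => // al S hal.
have m0 : mono [ffun=> 0%N] 0 = alpha.
  apply: mono_ext => [i|i||]; rewrite !monoE ?ffunE ?addn0 ?subn0 //.
  by case: ifP.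
rewrite m0 in hz.
pose q0 : {ffun 'I_p -> 'I_(mdeg alpha).+1} := [ffun=> ord0].
pose l0 : {ffun 'I_n -> bool} := [ffun=> false].
have eq0 : natf q0 = [ffun=> 0%N] by apply/ffunP => i; rewrite !ffunE.
have el0 : natb l0 = [ffun=> 0%N] by apply/ffunP => i; rewrite !ffunE.
have t0 : total (natf q0) (natb l0) = 0%N.
  by rewrite eq0 el0 /total !big1 // => i _; rewrite ffunE.
have vz (q : {ffun 'I_p -> 'I_(mdeg alpha).+1}) (l : {ffun 'I_n -> bool}) : total (natf q) (natb l) != 0%N ->
    cf al S (vec alpha beta (natf q) (natb l) (total (natf q) (natb l))) = 0.
  move=> h; apply/eqP/contraT => hc.
  have : supp (fun be _ => be = mono (natf q) (total (natf q) (natb l)))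
      (vec alpha beta (natf q) (natb l) (total (natf q) (natb l))).
    by do 2 apply: suppZ; apply: supp_blocks; apply: supp_elem.
  move=> /(_ _ _ hc) e; move: hal; rewrite /on_boundary e mono_xm mono_ym.
  by case/orP; rewrite addn_eq0 (negPf h) andbF.
rewrite /lift_vector raddf_sum (bigD1 q0) //= [X in _ + X]big1 ?addr0; last first.
  move=> q hq; rewrite raddf_sum big1 // => l _; apply: vz; apply: contraNneq hq.
  move/total0P => [/ffunP h _]; apply/eqP/ffunP => i; apply: val_inj.
  by have := h i; rewrite !ffunE.
rewrite raddf_sum (bigD1 l0) //= [X in _ + X]big1 ?addr0; last first.
  move=> l hl; apply: vz; apply: contraNneq hl.
  move/total0P => [_ /ffunP h]; apply/eqP/ffunP => i.
  by have := h i; rewrite !ffunE; case: (l i).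
rewrite t0 /vec /term eq0 el0 m0 hz !linearZ /= cf_elem.
rewrite /weight /coef !big1.
- by rewrite !addn0 !binn fact0 !mulr1 invr1 !mul1r.
- by move=> j _; rewrite ffunE /psi !bin0 expr0 !mulr1.
- by move=> i _; rewrite ffunE /phi !bin0 expr0 fact0 !mulr1; case: ifP.
Qed.

End BasisVectorForm.

Lemma H_P k (f : A) : H_ k f <-> A_ k f /\ lapT f = 0.
Proof. by rewrite /Defs.H_ /= Delta_lap. Qed.

Lemma deg_split al S : deg al S = deg al finset.set0 + #|S|%:Z.
Proof.
rewrite /wt -addrA; congr (_ + _).
rewrite [X in _ = X + _]big1 ?add0r; last by move=> q _; rewrite inE mulr0.
rewrite -sum1_card (big_morph Posz PoszD (erefl _)) [RHS]big_mkcond.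
by apply: eq_bigr => q _; rewrite zsign_theta mul1r; case: (q \in S).
Qed.

Lemma deg_set0 al : deg al finset.set0 =
  \sum_(i < p) (zs (ix n (wd i)) * (al (lshift m (wd i)))%:Z + (al (rshift m (wd i)))%:Z)
  + ((al xm)%:Z + (al ym)%:Z).
Proof.
rewrite wtE [\sum_j _ * (lshift n j \in _)%:Z]big1 ?addr0; last first.
  by move=> j _; rewrite inE mulr0.
rewrite [\sum_j _ * (rshift n j \in _)%:Z]big1 ?addr0; last first.
  by move=> j _; rewrite inE mulr0.
rewrite !big_ord_recr /= zs_x ltnNge rp zs_y // !mul1r addrACA -big_split.
congr (_ + _); apply: eq_bigr => i _ /=.
by rewrite zs_y // mul1r.
Qed.

Lemma card_theta_set (beta : {ffun 'I_(n + n) -> bool}) :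
  #|theta_set beta| = (\sum_j beta j)%N.
Proof.
rewrite /theta_set cardsE -sum1_card big_mkcond; apply: eq_bigr => j _.
by change ((if beta j then 1 else 0) = beta j)%N; case: (beta j).
Qed.

Section OneVector.
Variables (alpha : 'X_{1..m + m}) (beta : {ffun 'I_(n + n) -> bool}).
Local Notation a i := (alpha (lshift m (wd i))).
Local Notation b i := (alpha (rshift m (wd i))).
Local Notation bt j := (nat_of_bool (beta (lshift n j))).
Local Notation bt' j := (nat_of_bool (beta (rshift n j))).

Lemma A_blocks k (l : {ffun 'I_n -> nat}) s (f : A) : A_ k f ->
  A_ (k + \sum_(j <- s) ((bt j - l j)%:Z + (bt' j - l j)%:Z)) (blocks beta l s f).
Proof.
have it d q e (g : A) : A_ e g -> A_ (e + d%:Z) (iter d (@theta C (m + m) (n + n) q) g).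
  move=> h; elim: d => [|d IH]; first by rewrite addr0.
  rewrite iterS -(Zop_theta r); have := A_Zop (rshift (m + m) q) IH.
  by congr (A_ _ _); lia.
move=> h; elim: s => [|j s IH]; first by rewrite big_nil addr0.
rewrite big_cons /=; apply: subspaceZ; first exact: A_subspace.
have := it _ (lshift n j) _ _ (it _ (rshift n j) _ _ IH).
by move=> /(_ (bt j - l j)%N (bt' j - l j)%N); congr (A_ _ _); ring.
Qed.

(** Unless the coefficient is zero, all truncated subtractions in the exponents are exact, and the
    degree can be added up. *)
Lemma A_vec (q : {ffun 'I_p -> nat}) (l : {ffun 'I_n -> nat}) :
  A_ (deg alpha (theta_set beta)) (vec alpha beta q l (total q l)).
Proof.
apply: subspaceZ; first exact: A_subspace.
have [h|h] := eqVneq (coef alpha beta q l) 0.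
  by rewrite /term h scale0r; exact: subspace0 (A_subspace _ _ _ _ _).
apply: subspaceZ; first exact: A_subspace.
have hphi i : phi alpha i (q i) != 0.
  by apply: contraNneq h => e; apply/eqP; apply: coef_eq0; left; exists i.
have hpsi j : psi C beta j (l j) != 0.
  by apply: contraNneq h => e; apply/eqP; apply: coef_eq0; right; exists j.
have hb (i : 'I_p) : (q i <= b i)%N.
  rewrite leqNgt; apply: contra (hphi i) => lt.
  by rewrite /phi bin_small // mulr0n !(mulr0, mul0r); case: ifP => _; rewrite eqxx.
have ha (i : 'I_p) : (r <= i)%N -> (q i <= a i)%N.
  move=> ri; rewrite leqNgt; apply: contra (hphi i) => lt.
  by rewrite /phi ltnNge ri /= bin_small // mulr0n !(mul0r, mulr0) eqxx.
have hl j : (l j <= bt j)%N.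
  rewrite leqNgt; apply: contra (hpsi j) => lt.
  by rewrite /psi ['C(bt j, _)]bin_small // mulr0n !(mul0r, mulr0) eqxx.
have hl' j : (l j <= bt' j)%N.
  rewrite leqNgt; apply: contra (hpsi j) => lt.
  by rewrite /psi ['C(bt' j, _)]bin_small // mulr0n !(mul0r, mulr0) eqxx.
have := A_blocks l (enum 'I_n) (A_elem (erefl (deg (mono alpha q (total q l)) finset.set0))).
congr (A_ _ _); rewrite [RHS]deg_split !deg_set0 !monoE big_enum /=.
have -> : (#|theta_set beta|)%:Z = \sum_j ((bt j)%:Z + (bt' j)%:Z).
  rewrite card_theta_set (big_morph Posz PoszD (erefl _)) big_split_ord /=.
  by rewrite -big_split.
have -> : \sum_(j < n) ((bt j - l j)%:Z + (bt' j - l j)%:Z)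
    = \sum_(j < n) ((bt j)%:Z + (bt' j)%:Z) - 2 * \sum_(j < n) (l j)%:Z.
  rewrite mulr_sumr -sumrB; apply: eq_bigr => j _.
  by have := hl j; have := hl' j; lia.
under eq_bigr => i _ do rewrite mono_x mono_y.
have -> : \sum_(i < p) (zs (ix n (wd i)) *
      (if (i < r)%N then (a i + q i)%N else (a i - q i)%N)%:Z + (b i - q i)%N%:Z)
   = \sum_(i < p) (zs (ix n (wd i)) * (a i)%:Z + (b i)%:Z) - 2 * \sum_(i < p) (q i)%:Z.
  rewrite mulr_sumr -sumrB; apply: eq_bigr => i _; rewrite zs_x /=.
  by have := hb i; have := ha i; case: ltnP => hi; lia.
rewrite (PoszD (alpha xm)) (PoszD (alpha ym)).
have -> : (total q l)%:Z = \sum_(i < p) (q i)%:Z + \sum_(j < n) (l j)%:Z.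
  by rewrite /total PoszD !(big_morph Posz PoszD (erefl _)).
ring.
Qed.

Lemma A_lift_vector : A_ (deg alpha (theta_set beta)) (lift_vector alpha beta).
Proof.
by apply: subspace_sum => [|q _ _]; [|apply: subspace_sum => [|l _ _]];
  try exact: A_subspace; exact: A_vec.
Qed.

End OneVector.

Definition lift_sign (ab : 'X_{1..m + m} * {ffun 'I_(n + n) -> bool}) : C :=
  cf ab.1 (theta_set ab.2) (lift_vector ab.1 ab.2).

Lemma lift_signP ab : on_boundary ab.1 -> lift_sign ab * lift_sign ab = 1 /\
  forall al S, on_boundary al -> cf al S (lift_vector ab.1 ab.2)
    = lift_sign ab * ((al == ab.1) && (S == theta_set ab.2))%:R.
Proof.
move=> hb; have [z z1 hz] := cf_lift_vector ab.1 ab.2.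
have -> : lift_sign ab = z by rewrite /lift_sign hz // !eqxx mulr1.
by [].
Qed.

Lemma basis_indexP k ab : @basis_index p n r k ab <->
  deg ab.1 (theta_set ab.2) = k /\ on_boundary ab.1.
Proof.
rewrite /basis_index /= -card_theta_set super_degE /on_boundary -muln_eq0.
by split => -[-> h]; split => //; apply/eqP.
Qed.

Lemma lift_vector_H k ab : @basis_index p n r k ab -> H_ k (lift_vector ab.1 ab.2).
Proof.
move=> h; have [<- _] := (basis_indexP _ _).1 h; apply/H_P; split.
  exact: A_lift_vector.
by apply: lap_lift_vector => //; exact: h.2.
Qed.

Definition indicator S : {ffun 'I_(n + n) -> bool} := [ffun q => q \in S].

Lemma theta_set_indicator S : theta_set (indicator S) = S.
Proof. by apply/setP => q; rewrite inE ffunE. Qed.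

Lemma indicator_theta_set beta : indicator (theta_set beta) = beta.
Proof. by apply/ffunP => q; rewrite ffunE inE. Qed.

Lemma H_subspace k : subspace (H_ k).
Proof.
split.
  by apply/H_P; split; [exact: subspace0 (A_subspace _ _ _ _ _)|exact: raddf0].
move=> a f g /H_P[f1 f2] /H_P[g1 g2]; apply/H_P; split.
  by apply: (A_subspace _ _ _ _ _).2.
by rewrite linearP /= f2 g2 scaler0 addr0.
Qed.

Lemma H_boundary_eq k (f g : A) : H_ k f -> H_ k g ->
  (forall al S, on_boundary al -> cf al S f = cf al S g) -> f = g.
Proof.
move=> hf hg h; apply/eqP; rewrite -subr_eq0; apply/eqP.
apply: (@boundary_inj) => //.
  by have /H_P[] := subspaceB (H_subspace k) hf hg.
by move=> al S hb; rewrite raddfB /= h // subrr.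
Qed.

Theorem harmonic_basis k : is_basis (@basis_index p n r k)
  (fun ab => @basis_vector C p n r ab.1 ab.2) (H_ k).
Proof.
split.
- by move=> ab h; rewrite basis_vectorE //; exact: lift_vector_H.
- move=> w hw.
  pose s := undup [seq (al, indicator T) | T <- enum {: {set 'I_(n + n)}},
                       al <- [seq al <- msupp (w T) | on_boundary al]].
  have hs al S : on_boundary al -> cf al S w != 0 -> (al, indicator S) \in s.
    move=> hb hc; rewrite mem_undup; apply/allpairsPdep; exists S, al.
    by rewrite mem_enum mem_filter hb mcoeff_msupp.
  have sP ab : ab \in s -> @basis_index p n r k ab.
    rewrite mem_undup => /allpairsPdep[S [al [_ + ->]]].
    rewrite mem_filter mcoeff_msupp => /andP[hb hc]; apply/basis_indexP.
    rewrite /= theta_set_indicator; split => //.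
    by apply: (A_elem_inv (f := w)) hc; have /H_P[] := hw.
  (* The boundary coefficient of the basis vector is a sign, its own inverse, so this product is the
     coordinate of w. *)
  exists s, (fun ab => lift_sign ab * cf ab.1 (theta_set ab.2) w); split => //.
  under eq_bigr => ab _ do rewrite basis_vectorE //.
  apply: (@H_boundary_eq k) => //.
    apply: subspace_sum => [|ab hab _]; first exact: H_subspace.
    by apply: subspaceZ; [exact: H_subspace|apply: lift_vector_H; exact: sP].
  move=> al S hb; rewrite raddf_sum /=.
  under eq_big_seq => ab hab do
    (rewrite linearZ /= ((lift_signP ((basis_indexP _ _).1 (sP _ hab)).2).2 _ _ hb) mulrAC
      mulrA ((lift_signP ((basis_indexP _ _).1 (sP _ hab)).2).1) mul1r).
  have hne ab : ab != (al, indicator S) ->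
      ((al == ab.1) && (S == theta_set ab.2))%:R = 0 :> C.
    case: andP => // -[/eqP e1 /eqP e2]; rewrite e1 e2 indicator_theta_set.
    by case: ab e1 e2 => ? ? /= _ _; rewrite eqxx.
  have [hin|hout] := boolP ((al, indicator S) \in s).
    rewrite (bigD1_seq (al, indicator S)) ?undup_uniq //= big1 ?addr0.
      by rewrite theta_set_indicator !eqxx mul1r.
    by move=> ab h; rewrite hne // mul0r.
  rewrite big_seq big1 => [|ab hab].
    by apply/eqP/contraT => /(hs _ _ hb); rewrite (negPf hout).
  by rewrite hne ?mul0r //; apply: contraNneq hout => <-.
- move=> s c us sP; under eq_bigr => ab _ do rewrite basis_vectorE //.
  move=> h0 ab hab; have [_ hb] := (basis_indexP _ _).1 (sP _ hab).
  have [z1 _] := lift_signP hb.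
  have z0 : lift_sign ab != 0.
    by apply: contra_eq_neq z1 => ->; rewrite mul0r eq_sym oner_neq0.
  have := congr1 (cf ab.1 (theta_set ab.2)) h0.
  rewrite raddf0 raddf_sum (bigD1_seq ab) //= big1_seq ?addr0.
    by rewrite linearZ /= -/(lift_sign ab) => /eqP; rewrite mulf_eq0 (negPf z0) orbF => /eqP.
  move=> ab' /andP[ne hab']; have [_ hb'] := (basis_indexP _ _).1 (sP _ hab').
  rewrite linearZ /= (lift_signP hb').2 //.
  case: andP => [[/eqP e1 /eqP e2]|_]; last by rewrite !mulr0.
  case/eqP: ne; case: ab' ab e1 e2 {hab hab' hb hb' z1 z0} => [al' be'] [al be] /= -> e2.
  by rewrite -(indicator_theta_set be) e2 indicator_theta_set.
Qed.

(** Restriction to the boundary is onto as well as injective: each boundary monomial is extended by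
    its basis vector. *)
Lemma harmonic_lift k (f : A) : A_ k f ->
  exists2 h, H_ k h & forall al S, on_boundary al -> cf al S h = cf al S f.
Proof.
move=> hf; apply: (elem_ind (P := fun f => exists2 h, H_ k h &
    forall al S, on_boundary al -> cf al S h = cf al S f)).
- by exists 0; [exact: subspace0 (H_subspace k)|].
- move=> a f1 f2 [h1 H1 e1] [h2 H2 e2]; exists (a *: h1 + h2).
    by apply: (H_subspace k).2.
  by move=> al S hb; rewrite !linearP /= e1 // e2.
move=> al S hc; have hk := A_elem_inv hf hc.
have [hb|hb] := boolP (on_boundary al); last first.
  exists 0; first exact: subspace0 (H_subspace k).
  move=> be T hbe; rewrite raddf0 cf_elem; case: (eqVneq be al) => //= e.
  by rewrite -e hbe in hb.
pose ab := (al, indicator S).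
have hi : @basis_index p n r k ab by apply/basis_indexP; rewrite /= theta_set_indicator.
have [z1 hz] := lift_signP (ab := ab) hb.
exists (lift_sign ab *: lift_vector ab.1 ab.2).
  by apply: subspaceZ; [exact: H_subspace|exact: lift_vector_H].
move=> be T hbe; rewrite linearZ /= hz // mulrA z1 mul1r cf_elem.
by rewrite /= theta_set_indicator.
Qed.

(* These signs make osp stable under taking adjoints and eta adjoint to Delta. *)
Definition rho a : C := ssign C
  (match split a with
   | inl i => if split i is inr j then (j < r)%N else false
   | inr q => if split q is inr _ then true else false
   end).

Lemma rho_x i : rho (ix n i) = 1.
Proof. by rewrite /rho /ix !split_lshift'. Qed.
Lemma rho_y i : rho (iy n i) = ssign C (i < r)%N.
Proof. by rewrite /rho /iy split_lshift' split_rshift'. Qed.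
Lemma rho_t j : rho (iT m j) = 1.
Proof. by rewrite /rho /iT split_rshift' split_lshift'. Qed.
Lemma rho_s j : rho (iS m j) = -1.
Proof. by rewrite /rho /iS !split_rshift'. Qed.

Lemma rho_sq a : rho a * rho a = 1. Proof. exact: ssign_sq. Qed.

(** * Adjoints and orthogonality *)

Local Notation form := (form rho).
Local Notation adj := (adj_sign r rho).

Lemma adj_x i : adj (ix n i) = ssign C (i < r)%N.
Proof.
rewrite /adj_sign {1}/ix split_lshift' rho_x /=.
by case: (i < r)%N; rewrite /ssign ?expr0 ?expr1.
Qed.
Lemma adj_y i : adj (iy n i) = ssign C (i < r)%N.
Proof.
rewrite /adj_sign {1}/iy split_lshift' rho_y /= ifF //.
by apply/negbTE; rewrite -leqNgt (leq_trans rm) // leq_addr.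
Qed.
Lemma adj_t j : adj (iT m j) = 1.
Proof. by rewrite /adj_sign {1}/iT split_rshift' rho_t. Qed.
Lemma adj_s j : adj (iS m j) = -1.
Proof. by rewrite /adj_sign {1}/iS split_rshift' rho_s. Qed.

(** Passing to adjoints reverses the two factors of each pair. For an even pair the adjoint signs
    agree; for an odd pair they are opposite, which offsets the sign of reversing anticommuting
    factors. *)
Lemma form_lap f g : form (lapT f) g = form f (mulT g).
Proof.
rewrite /lap /mulform formDl formDr !form_suml !form_sumr.
congr (_ + _); apply: eq_bigr => i _; rewrite !form_Dop ?rho_sq //; try exact: rho_sq.
  rewrite ZopZop !indexE /ssign expr0 scale1r adj_x adj_y mulrA ssign_sq mul1r //.
by rewrite ZopZop !indexE /ssign expr1 adj_t adj_s formZr; ring.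
Qed.

Definition adjoint_mx (X : gl) : gl := \matrix_(a, b) (adj a * adj b * X b a).

Lemma adjoint_osp X : osp X -> osp (adjoint_mx X).
Proof.
move=> /ospP hX; apply/ospP => a b; rewrite !mxE hX.
(* This is the compatibility of [rho] with the invariant form that lets the signed transpose
   preserve the skewness relation of osp. *)
have h c : sgs C c * sgs C (star c) * (adj c * adj (star c)) = 1.
  case: (indexP c) => i; rewrite /sgs !indexE ?adj_x ?adj_y ?adj_t ?adj_s /ssign
    ?expr0 ?expr1 -?signr_addb ?addbb ?expr0; ring.
have key (x x' y y' d d' e e' : C) : x * x = 1 -> y' * y' = 1 -> e' * e' = 1 ->
    d' * d' = 1 -> x * x' * (d * d') = 1 -> y * y' * (e * e') = 1 ->
    d * e * (y * x') = x * y' * (e' * d').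
  move=> h1 h2 h3 h4 h5 h6.
  transitivity (x * y' * (e' * d') * (x * x' * (d * d')) * (y * y' * (e * e'))).
    transitivity ((x * x) * (y' * y') * (e' * e') * (d' * d') * (d * e * (y * x'))).
      by rewrite h1 h2 h3 h4 !mul1r.
    by ring.
  by rewrite h5 h6 !mulr1.
have := key _ _ _ _ _ _ _ _ (sgs_sq C a) (sgs_sq C (star b)) (adj_sign_sq r rho_sq (star b))
  (adj_sign_sq r rho_sq (star a)) (h a) (h b).
rewrite /eps [odd_index b && _]andbC => e.
transitivity (- (ssign C (odd_index a && odd_index b) * (adj a * adj b * (sgs C b * sgs C (star a)))
  * X (star a) (star b))); first by ring.
by rewrite e; ring.
Qed.

Lemma form_gl_act X f g : form (gl_act r X f) g = form f (gl_act r (adjoint_mx X) g).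
Proof.
rewrite !gl_actE form_suml form_sumr.
under eq_bigr => b _ do rewrite form_suml.
under [RHS]eq_bigr => b _ do rewrite form_sumr.
rewrite [RHS]exchange_big; apply: eq_bigr => a _; apply: eq_bigr => b _.
rewrite formZl formZr (form_Zop r rho_sq) (form_Dop r rho_sq) mxE.
by ring.
Qed.

Definition perp (W : set A) : set A := [set h | forall u, W u -> form h u = 0].

Lemma perp_submodule (W : set A) : submodule W ->
  submodule (perp W).
Proof.
move=> [hW hX]; split.
  split; first by move=> u _; rewrite form0l.
  by move=> z h1 h2 e1 e2 u hu; rewrite formPl e1 // e2 // mulr0 addr0.
move=> X oX h hh u hu; rewrite form_gl_act; apply: hh.
by apply: hX => //; exact: adjoint_osp.
Qed.

Lemma mweight_neq0 al S : mweight rho al S != 0.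
Proof.
have rho0 a : rho a != 0.
  by apply: contra_eq_neq (rho_sq a) => ->; rewrite mul0r eq_sym oner_neq0.
rewrite /mweight mulf_neq0 //; apply/prodf_neq0 => i _ //.
apply: mulf_neq0; last exact: expf_neq0.
by rewrite (pcharf0P C).1 // -lt0n fact_gt0.
Qed.

(* The orthogonal of the harmonics is the image of eta: reduce modulo eta to
   a superpolynomial supported on the boundary and pair it with the harmonic
   extensions of its monomials. *)
Lemma perp_harmonics k f : A_ k f -> (forall h, H_ k h -> form h f = 0) ->
  exists2 g, A_ (k - 2) g & f = mulT g.
Proof.
move=> hf hperp; have [g hg hs] := mulform_division hf; exists g => //.
apply/eqP; rewrite -subr_eq0; apply/eqP; set ka := f - _ in hs *.
apply: cfP => al S; rewrite raddf0; apply/eqP/contraT => hc.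
have hk : A_ k ka.
  apply: subspaceB hf _; first exact: A_subspace.
  by rewrite -[k](subrK 2); apply: A_mulform.
have [h hh hb] := harmonic_lift (A_elem (A_elem_inv hk hc)).
have : form h ka = 0.
  rewrite /ka -scaleN1r addrC formPr (hperp _ hh) addr0.
  by rewrite -form_lap ((H_P k h).1 hh).2 form0l mulr0.
rewrite -[h](subrK (elem C al S)) formDl form_elem form_disjoint ?add0r.
  by move/eqP; rewrite mulf_eq0 (negPf (mweight_neq0 _ _)) (negPf hc).
move=> be T; rewrite raddfB /=; case: (eqVneq (cf be T ka) 0) => [->|/hs hbe].
  by rewrite mulr0.
by rewrite hb // subrr mul0r.
Qed.

Implicit Types (u : A) (s : bool) (U : set A) (k : int).

(** Interpolation: the product of T - la over the other eigenvalues la that occur in u projects u to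
    one eigenspace, where by assumption u has a single monomial. *)
Lemma subspace_eigen U (T : A -> A) (lam : 'X_{1..m + m} -> {set 'I_(n + n)} -> int) :
  subspace U -> (forall f, U f -> U (T f)) ->
  (forall al S f, cf al S (T f) = (lam al S)%:~R * cf al S f) ->
  forall u al0 S0, U u -> cf al0 S0 u != 0 ->
  (forall al S, cf al S u != 0 -> lam al S = lam al0 S0 -> al = al0 /\ S = S0) ->
  U (elem C al0 S0).
Proof.
move=> hU hT hlam u al0 S0 hu hc huniq.
pose L := [seq la <- [seq lam al B | B <- enum {: {set 'I_(n + n)}}, al <- msupp (u B)]
              | la != lam al0 S0].
pose proj (s : seq int) := foldr (fun la f => T f - la%:~R *: f) u s.
have hcf t al S : cf al S (proj t) = (\prod_(la <- t) (lam al S - la)%:~R) * cf al S u.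
  elim: t => [|la t IH]; first by rewrite big_nil mul1r.
  rewrite big_cons /= raddfB /= hlam linearZ /= IH intrB; ring.
have hp t : U (proj t).
  elim: t => //= la t IH; apply: subspaceB => //; first exact: hT.
  exact: subspaceZ.
pose c := (\prod_(la <- L) (lam al0 S0 - la)%:~R) * cf al0 S0 u.
have c0 : c != 0.
  rewrite mulf_neq0 // prodf_seq_neq0; apply/allP => la; rewrite mem_filter => /andP[h _].
  by rewrite /= intr_eq0_char0 // subr_eq0 eq_sym.
have -> : elem C al0 S0 = c^-1 *: proj L; last exact: subspaceZ.
apply: cfP => al S; rewrite cf_elem linearZ /= hcf.
case: (boolP ((al == al0) && (S == S0))) => [/andP[/eqP -> /eqP ->]|ne].
  by rewrite -/c mulVf.
case: (eqVneq (cf al S u) 0) => [->|h]; first by rewrite !mulr0.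
have hl : lam al S != lam al0 S0.
  by apply: contraNneq ne => /(huniq _ _ h) [-> ->]; rewrite !eqxx.
have : lam al S \in L.
  rewrite mem_filter hl; apply/allpairsPdep; exists S, al.
  by rewrite mem_enum mcoeff_msupp.
move=> hin; rewrite (_ : \prod_(la <- L) _ = 0) ?mul0r ?mulr0 //.
by apply/eqP; rewrite prodf_seq_eq0; apply/hasP; exists (lam al S); rewrite //= subrr eqxx.
Qed.

(** * Generating harmonics from one power *)

Definition uv s : 'I_(m + m) := if s then xm else ym.
Definition iu s : I := if s then ix n ord_max else iy n ord_max.

Lemma star_iu s : star (iu s) = iu (~~ s).
Proof. by case: s; rewrite /iu starE. Qed.

Lemma Zop_iu s f : Z (iu s) f = xmul (uv s) f.
Proof. by case: s; rewrite /iu ?Zop_hi ?Zop_y. Qed.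
Lemma Dop_iu s f : D (iu s) f = dx (uv s) f.
Proof. by case: s; rewrite /iu ?Dop_hi ?Dop_y. Qed.

Lemma zs_iu s : zs (iu s) = 1.
Proof. by case: s; rewrite /iu ?zs_x ?zs_y // ltnNge rp. Qed.

Lemma uvN s : uv s != uv (~~ s).
Proof. by case: s; rewrite /= ?[ym == _]eq_sym; exact: xm_neq_ym. Qed.

Definition om_u s : I -> int := if s then @om_xm else @om_ym.

Lemma wt_u s al S : wt (om_u s) al S = (al (uv s))%:Z.
Proof. by case: s; rewrite /om_u ?wt_xm ?wt_ym. Qed.

Lemma om_u_iu s : om_u s (iu s) = 1.
Proof. by case: s; rewrite /om_u /iu /om_xm /om_ym !omegaE eqxx. Qed.

Lemma om_u_neq s a : a != iu s -> om_u s a = 0.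
Proof.
by case: s; rewrite /om_u /iu /om_xm /om_ym; case: (indexP a) => i; rewrite !omegaE ?eq_indexE //;
   move/negPf ->.
Qed.

Definition above s (d : int) f : Prop := supp (fun al _ => d <= (al (uv s))%:Z) f.

Lemma above_Zop s d a f : above s d f -> above s (d + zs a * om_u s a) (Z a f).
Proof.
move=> h; have h' : supp (fun al S => d <= wt (om_u s) al S) f.
  by apply: sub_supp h => al S; rewrite wt_u.
have := supp_Zop (r := r) (a := a) (Q := fun x => d <= x) h'.
by apply: sub_supp => al S; rewrite wt_u lerBrDr.
Qed.

Lemma above_Dop s d a f : above s d f -> above s (d - zs a * om_u s a) (D a f).
Proof.
move=> h; have h' : supp (fun al S => d <= wt (om_u s) al S) f.
  by apply: sub_supp h => al S; rewrite wt_u.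
have := supp_Dop (r := r) (a := a) (Q := fun x => d <= x) h'.
by apply: sub_supp => al S; rewrite wt_u lerBlDr.
Qed.

Lemma above_elem s d al S : d <= (al (uv s))%:Z -> above s d (elem C al S).
Proof. by move=> h; apply: supp_elem. Qed.

Section Reach.
Variables (U : set A) (k : int) (s : bool).
Hypothesis hU : submodule U.
Local Notation u := (uv s).
Local Notation w := (uv (~~ s)).

Lemma act_gen a b f : U f -> U (Z a (D b f) - eps C a b *: Z (star b) (D (star a) f)).
Proof. by move=> h; rewrite -gl_act_gen; apply: hU.2 => //; exact: osp_gen_osp. Qed.

(** For al without w, every other monomial of f contains both x_m and x_(2m), so f has the boundary
    of the given monomial. The exact bound on the exponent of u is kept because each step of the
    induction lowers it by one. *)
Definition reach al S : Prop := exists2 f, U f &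
  above (~~ s) 1 (f - elem C al S) /\ above s ((al u)%:Z + 1) (f - elem C al S).

(** The operator Z a d/du trades one factor u for the variable a. The dual summand multiplies by w
    and does not lower the exponent of u, so it falls into the error term. *)
Lemma reach_step a al be S T (z : C) : z != 0 -> reach al S -> al w = 0%N -> al u != 0%N ->
  be w = 0%N -> (be u).+1 = al u ->
  a != iu s -> a != iu (~~ s) -> Z a (elem C (al - U_(u)) S) = z *: elem C be T ->
  reach be T.
Proof.
move=> z0 [f hf [hw hu]] alw alu bew beu as1 as2 hZ.
have := act_gen a (iu s) hf; rewrite Dop_iu star_iu Zop_iu => hf'.
set c := (al u)%:R : C; have c0 : c != 0 by rewrite /c (pcharf0P C).1.
pose O := f - elem C al S.
have eO : f = elem C al S + O by rewrite addrC subrK.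
have a1 : star a != iu s.
  by apply: contra_neq as2 => e; rewrite -star_iu -e starK.
have a2 : star a != iu (~~ s).
  by apply: contra_neq as1 => e; rewrite -[s]negbK -star_iu -e starK.
have key : (c * z)^-1 *: (Z a (dx u f) - eps C a (iu s) *: xmul w (D (star a) f))
    - elem C be T = (c * z)^-1 *: (Z a (dx u O)
       - eps C a (iu s) *: xmul w (D (star a) f)).
  have -> : dx u f = c *: elem C (al - U_(u)) S + dx u O.
    by rewrite [in LHS]eO raddfD /= dx_elem.
  rewrite ZopD ZopZ hZ scalerA -addrA scalerDr scalerA.
  by rewrite mulVf ?mulf_neq0 // scale1r addrAC subrr add0r.
have wO : above (~~ s) 1 O by [].
exists ((c * z)^-1 *: (Z a (dx u f) - eps C a (iu s) *: xmul w (D (star a) f))).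
  by apply: subspaceZ => //; exact: hU.1.
rewrite key; split; apply: suppZ; apply: suppB.
- have := above_Zop (a := a) (above_Dop (a := iu s) wO); rewrite Dop_iu.
  rewrite (om_u_neq as2) om_u_neq ?mulr0 ?subr0 ?addr0 //.
  by case: (s); rewrite /iu eq_indexE.
- apply: suppZ; rewrite -Zop_iu.
  have f0 : above (~~ s) 0 f by move=> ? ? _.
  have := above_Zop (a := iu (~~ s)) (above_Dop (a := star a) f0).
  by rewrite (om_u_neq a2) zs_iu om_u_iu mulr0 subr0 add0r mulr1.
- have := above_Zop (a := a) (above_Dop (a := iu s) hu); rewrite Dop_iu.
  rewrite (om_u_neq as1) om_u_iu zs_iu !mulr1 mulr0 addr0.
  by apply: sub_supp => ? ?; lia.
- apply: suppZ; rewrite -Zop_iu.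
  have f0 : above s (al u)%:Z f.
    rewrite eO; apply: suppD; first exact: above_elem.
    by apply: sub_supp hu => ? ?; lia.
  have := above_Zop (a := iu (~~ s)) (above_Dop (a := star a) f0).
  rewrite (om_u_neq a1) om_u_neq ?mulr0 ?subr0 ?addr0.
    by apply: sub_supp => ? ?; lia.
  by case: (s); rewrite /iu eq_indexE.
Qed.

Lemma reach_var (b : 'I_(m + m)) al S : (r <= b)%N -> b != u -> b != w ->
  reach al S -> al w = 0%N -> al u != 0%N -> reach (al - U_(u) + U_(b))%MM S.
Proof.
move=> rb bu bw h alw alu.
have uw := uvN s.
apply: (reach_step (a := lshift (n + n) b) (oner_neq0 C) h) => //.
- by rewrite mnmDE mnmBE !mnm1E (negPf uw) (negPf bw) alw.
- by rewrite mnmDE mnmBE !mnm1E eqxx (negPf bu) addn0 subn1 prednK // lt0n.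
- by case: (s) bu => bu; rewrite (inj_eq (@lshift_inj _ _)).
- by case: (s) bw => bw; rewrite (inj_eq (@lshift_inj _ _)).
- by rewrite Zop_x ltnNge rb /= xmul_elem scale1r.
Qed.

Lemma reach_theta q al S : q \notin S ->
  reach al S -> al w = 0%N -> al u != 0%N -> reach (al - U_(u))%MM (q |: S)%SET.
Proof.
move=> qS h alw alu; have uw := uvN s.
have t0 : theta_sign C q S != 0 by rewrite /theta_sign signr_eq0.
apply: (reach_step (a := rshift (m + m) q) t0 h) => //.
- by rewrite mnmBE alw.
- by rewrite mnmBE mnm1E eqxx subn1 prednK // lt0n.
- by case: (s); rewrite eq_rlshift.
- by case: (s); rewrite eq_rlshift.
- by rewrite Zop_theta theta_elem (negPf qS).
Qed.

End Reach.

Definition x0 : 'I_(m + m) := lshift m ord0.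

Definition pos_part k : nat := if k is Posz j then j else 0%N.
Definition neg_part k : nat := if k is Negz j then j.+1 else 0%N.

Lemma pos_negE k : k = (pos_part k)%:Z - (neg_part k)%:Z.
Proof. by case: k => j /=; lia. Qed.

(* x_m^k (or x_(2m)^k) for k >= 0 and x_1^(-k) for k < 0. *)
Definition vexp s k : 'X_{1..m + m} := (U_(x0) *+ neg_part k + U_(uv s) *+ pos_part k)%MM.
Definition vgen s k : A := elem C (vexp s k) finset.set0.

Definition psum (P : pred 'I_(m + m)) al : nat := (\sum_(i | P i) al i)%N.

Lemma psumDU P al i : psum P (al + U_(i))%MM = (psum P al + P i)%N.
Proof.
rewrite /psum; under eq_bigr => j _ do rewrite mnmDE mnm1E.
rewrite big_split /=; congr (_ + _)%N; case: (boolP (P i)) => h.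
  rewrite (bigD1 i) //= eqxx big1 ?addn0 // => j /andP[_ ji].
  by rewrite eq_sym (negPf ji).
by rewrite big1 // => j hj; case: eqVneq => // e; rewrite e hj in h.
Qed.

Lemma psumMU P i q : psum P (U_(i) *+ q)%MM = (P i * q)%N.
Proof.
elim: q => [|q IH]; first by rewrite muln0 /psum big1 // => j _; rewrite mulmnE muln0.
by rewrite mulmS addmC psumDU IH mulnS addnC.
Qed.

Lemma psum_eq0 P al : psum P al = 0%N -> forall i, P i -> al i = 0%N.
Proof.
by move=> /eqP; rewrite sum_nat_eq0 => /forallP h i hi; have := h i; rewrite hi => /eqP.
Qed.

Lemma psum_gt0 P al : psum P al != 0%N -> exists2 i, P i & al i != 0%N.
Proof.
case: (pickP (fun i => P i && (al i != 0%N))) => [i /andP[h1 h2] _|h]; first by exists i.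
by rewrite /psum big1 // => i hi; have := h i; rewrite hi => /negbT; rewrite negbK => /eqP.
Qed.

Definition low : pred 'I_(m + m) := fun i => (i < r)%N.
Definition high s : pred 'I_(m + m) := fun i => (r <= i)%N && (i != uv s).

Lemma uv_high s : (r <= uv s)%N.
Proof. by case: s => //=; rewrite (leq_trans rm) // leq_addr. Qed.

Lemma deg_psum s al S :
  deg al S = (psum (high s) al)%:Z + #|S|%:Z + (al (uv s))%:Z - (psum low al)%:Z.
Proof.
rewrite -super_degE /super_deg -!(big_morph Posz PoszD (erefl _)) -/(psum low al).
by rewrite (bigD1 (uv s)) ?uv_high //= -/(psum (high s) al) PoszD; ring.
Qed.

Lemma lowP i : low i -> exists2 j : 'I_m, i = lshift m j & (j < r)%N.
Proof.
rewrite /low; case: (split_ordP i) => j -> h; first by exists j.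
by move: h; rewrite ltnNge /= (leq_trans rm) // leq_addr.
Qed.

Lemma x0_low : low x0. Proof. exact: r0. Qed.

Lemma low_neq_uv s i : low i -> i != uv s.
Proof. by apply: contraTneq => ->; rewrite /low -leqNgt uv_high. Qed.

Lemma high_low s i : low i -> high s i = false.
Proof. by rewrite /low => h; rewrite /high leqNgt h. Qed.

Lemma high_uv s : high s (uv s) = false.
Proof. by rewrite /high eqxx andbF. Qed.

Lemma low_uv s : low (uv s) = false.
Proof. by apply/negbTE; rewrite /low -leqNgt uv_high. Qed.

(** Each summand of Delta differentiates by some x_(m+i) with i < m, by both x_m and x_(2m), or by
    both members of a theta pair. *)
Lemma lap_elem al S : (forall i, al (rshift m (wd i)) = 0%N) -> on_boundary al ->
  (forall j, ~~ ((lshift n j \in S) && (rshift n j \in S))) ->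
  lapT (elem C al S) = 0.
Proof.
move=> hy hb hS; rewrite lap_split // dx_elem linearZ /= dx_elem.
rewrite [X in X + _](_ : _ = 0); last first.
  rewrite mnmBE mnm1E [ym == _]eq_sym (negPf (xm_neq_ym)) subn0 scalerA -natrM.
  by case/orP: hb => /eqP ->; rewrite ?muln0 ?mul0n scale0r.
rewrite add0r /lap big_inner big1 ?add0r => [|i _]; last first.
  by rewrite Dop_y // dx_elem hy scale0r linear0.
rewrite big1 // => j _; rewrite Dop_t Dop_s dtheta_elem.
case: ifP => hr; last by rewrite linear0.
rewrite linearZ /= dtheta_elem !inE.
by have := hS j; rewrite hr andbT => /negPf ->; rewrite andbF scaler0.
Qed.

(** Each monomial of eta g contains some x_(m+i) with i < m, the product x_m x_(2m), or some theta.
    Hence the powers [vgen] are not in the image of eta. *)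
Lemma cf_mulform_elem al g : (forall i, al (rshift m (wd i)) = 0%N) -> on_boundary al ->
  cf al finset.set0 (mulT g) = 0.
Proof.
move=> hy hb; rewrite mulform_split // raddfD /= [X in X + _](_ : _ = 0); last first.
  rewrite !cf_xmul; case: eqVneq => // hx; move: hb; rewrite /on_boundary (negPf hx) /=.
  by rewrite mnmBE mnm1E (negPf (xm_neq_ym)) subn0 => ->.
rewrite add0r /mulform big_inner raddfD !raddf_sum !big1 ?addr0 // => i _ /=.
  by rewrite Zop_t cf_theta inE.
rewrite Zop_y //; case: (ltnP i r) => hi.
  by rewrite Zop_lo // cf_dx cf_xmul mnmDE mnm1E eq_lrshift addn0 hy mulr0.
by rewrite Zop_hi // !cf_xmul mnmBE mnm1E eq_lrshift subn0 hy; case: ifP.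
Qed.

Lemma vexp_y s k i : vexp s k (rshift m (wd i)) = 0%N.
Proof.
rewrite mnmDE !mulmnE !mnm1E eq_lrshift mul0n add0n.
case: s; rewrite /= ?eq_lrshift ?(inj_eq (@rshift_inj _ _)) //.
by rewrite eq_sym wd_max.
Qed.

Lemma vexp_uvN s k : vexp s k (uv (~~ s)) = 0%N.
Proof.
rewrite mnmDE !mulmnE !mnm1E (negPf (uvN s)) mul0n addn0.
by rewrite (negPf (low_neq_uv _ x0_low)).
Qed.

Lemma vexp_boundary s k : on_boundary (vexp s k).
Proof.
have := vexp_uvN s k; rewrite /on_boundary; case: s => /= ->; rewrite ?eqxx ?orbT //.
Qed.

Lemma psum_vexp P s k :
  psum P (vexp s k) = (P x0 * neg_part k + P (uv s) * pos_part k)%N.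
Proof.
rewrite -!psumMU /psum -big_split; apply: eq_bigr => i _.
by rewrite mnmDE.
Qed.

Lemma vexp_uv s k : vexp s k (uv s) = pos_part k.
Proof.
by rewrite mnmDE !mulmnE !mnm1E eqxx (negPf (low_neq_uv s x0_low)) mul1n.
Qed.

Lemma deg_vexp s k : deg (vexp s k) finset.set0 = k.
Proof.
rewrite (deg_psum s) cards0 !psum_vexp vexp_uv high_uv low_uv (high_low _ x0_low) x0_low.
by rewrite [RHS]pos_negE; lia.
Qed.

Section Submodule.
Variables (U : set A) (k : int) (s : bool).
Hypotheses (hU : submodule U) (vU : U (vgen s k)).
Local Notation u := (uv s).
Local Notation w := (uv (~~ s)).
Local Notation el al := (elem C al finset.set0).

Lemma mnm_addK al i : al i != 0%N -> (al - U_(i) + U_(i) = al)%MM.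
Proof. by rewrite -lep1mP => /submK. Qed.

(** Induction on the exponent of u, and for exponent 0 on the number of low variables other than
    x_1. The element acting as - u x_j adds a factor u and a low variable at once; the one acting as
    - d_1 x_j turns x_1 into x_j. The dual summands vanish, since they differentiate by variables
    that are absent. *)
Lemma pure_mem al : psum (high s) al = 0%N -> deg al finset.set0 = k -> U (el al).
Proof.
have [e] : exists e, al u = e by exists (al u).
elim: e al => [|e IHe] al hu hh hd.
  have hl : psum low al = neg_part k.
    move: hd; rewrite (deg_psum s) hh hu cards0; case: k => j /=; lia.
  have hp : pos_part k = 0%N.
    move: hd; rewrite (deg_psum s) hh hu cards0; case: k => j /=; lia.
  pose low' : pred 'I_(m + m) := fun i => low i && (i != x0).
  have [N] : exists N, psum low' al = N by exists (psum low' al).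
  elim: N al hu hh hd hl => [|N IHN] al hu hh hd hl hN.
    rewrite (_ : al = vexp s k) //; apply/mnmP => i.
    have hx : al x0 = neg_part k.
      by rewrite -hl /psum (bigD1 x0) ?x0_low //= -/(psum low' al) hN addn0.
    rewrite mnmDE !mulmnE !mnm1E hp muln0 addn0.
    case: (eqVneq x0 i) => [<-|ne]; first by rewrite mul1n.
    rewrite mul0n; case: (boolP (low i)) => hi.
      by apply: (psum_eq0 hN); rewrite /low' hi eq_sym.
    case: (eqVneq i u) => [->|niu]; first by [].
    by apply: (psum_eq0 hh); rewrite /high niu leqNgt hi.
  have [|i /andP[il inx] ai] := @psum_gt0 low' al; first by rewrite hN.
  pose be := (al - U_(i))%MM.
  have eal : al = (be + U_(i))%MM by rewrite mnm_addK.
  have niu : i != u by exact: low_neq_uv.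
  have hiF : high s i = false by exact: high_low.
  have hx0F : high s x0 = false by apply: high_low; exact: x0_low.
  have hbe : U (el (be + U_(x0))%MM).
    apply: IHN.
    - by rewrite mnmDE mnm1E (negPf (low_neq_uv s x0_low)) addn0 mnmBE hu.
    - by rewrite psumDU hx0F addn0; move: hh; rewrite eal psumDU hiF addn0.
    - rewrite -hd (deg_psum s) [in RHS](deg_psum s) eal !psumDU hiF hx0F il x0_low.
      by rewrite !mnmDE !mnm1E (negPf niu) (negPf (low_neq_uv s x0_low)).
    - by rewrite -hl eal !psumDU il x0_low.
    - by move: hN; rewrite eal !psumDU /low' il inx eqxx andbF addn0 /= addn1 => -[].
  have [j ej hj] := lowP il; have hU' := act_gen hU (ix n ord0) (ix n j) hbe.
  move: hU'; rewrite !star_x Zop_lo // Dop_lo // Dop_y // dx_elem.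
  have -> : (be + U_(x0))%MM (rshift m ord0) = 0%N.
    rewrite mnmDE mnm1E eq_lrshift addn0 mnmBE (_ : al _ = 0%N) //.
    case: (eqVneq (rshift m (@ord0 p)) u) => [-> //|ne].
    by apply: (psum_eq0 hh); rewrite /high ne andbT (leq_trans rm) // leq_addr.
  rewrite scale0r raddf0 scaler0 subr0 -ej xmul_elem raddfN /= dx_elem.
  rewrite -addmA [(U_(x0) + _)%MM]addmC addmA addmK -eal => /(subspaceZ hU.1).
  set c : C := _%:R; have c0 : c != 0.
    by rewrite /c (pcharf0P C).1 // !mnmDE mnm1E eqxx; lia.
  by move=> /(_ (- c^-1)); rewrite scalerN scaleNr opprK scalerA mulVf // scale1r.
have [hl|hl] := eqVneq (psum low al) 0%N.
  rewrite (_ : al = vexp s k) //; apply/mnmP => i.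
  have hk : k = e.+1%:Z by rewrite -hd (deg_psum s) hh hu hl cards0; lia.
  rewrite mnmDE !mulmnE !mnm1E hk /= muln0 add0n.
  case: (eqVneq u i) => [<-|ne]; first by rewrite mul1n.
  rewrite mul0n; case: (boolP (low i)) => hi; first exact: (psum_eq0 hl).
  by apply: (psum_eq0 hh); rewrite /high eq_sym ne andbT leqNgt.
have [i il ai] := psum_gt0 hl; have [j ej hj] := lowP il.
have niu : i != u by exact: low_neq_uv.
have hiF : high s i = false by exact: high_low.
have huF := high_uv s.
have lu := low_uv s.
pose be := (al - U_(i) - U_(u))%MM.
have eal : al = (be + U_(u) + U_(i))%MM.
  by rewrite /be !mnm_addK // mnmBE mnm1E (negPf niu) subn0 hu.
have hbe : U (el be).
  apply: IHe.
  - by move: hu; rewrite eal !mnmDE !mnm1E eqxx (negPf niu) addn0 addn1 => -[].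
  - by move: hh; rewrite eal !psumDU hiF huF !addn0.
  - move: hd; rewrite eal !(deg_psum s) !psumDU hiF huF il lu !mnmDE !mnm1E eqxx (negPf niu).
    by move=> <-; lia.
have := act_gen hU (iu s) (ix n j) hbe.
rewrite star_iu star_x Zop_iu // Dop_lo // Dop_iu // dx_elem.
have -> : be (uv (~~ s)) = 0%N.
  rewrite /be !mnmBE (_ : al _ = 0%N) //; apply: (psum_eq0 hh).
  by rewrite /high uv_high eq_sym uvN.
rewrite scale0r raddf0 scaler0 subr0 raddfN /= !xmul_elem -ej.
rewrite -addmA [(U_(i) + _)%MM]addmC addmA -eal => /(subspaceZ hU.1).
by move=> /(_ (-1)); rewrite scaleN1r opprK.
Qed.

(** Induction on the number of high variables and theta's. Replacing one of them by u keeps the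
    degree, and [reach_var] or [reach_theta] undoes the replacement. *)
Lemma reach_all al S : al w = 0%N -> deg al S = k -> reach U s al S.
Proof.
have [N] : exists N, (psum (high s) al + #|S|)%N = N.
  by exists (psum (high s) al + #|S|)%N.
have huF := high_uv s.
have lu := low_uv s.
have uw := uvN s.
elim: N al S => [|N IH] al S hN alw hd.
  move/eqP: hN; rewrite addn_eq0 cards_eq0 => /andP[/eqP hh /eqP S0].
  exists (elem C al S); first by rewrite S0; apply: pure_mem => //; rewrite -S0.
  by rewrite subrr; split; exact: supp0.
have [S0|[q qS]] := set_0Vmem S.
  have [|b /andP[rb bu] ab] := @psum_gt0 (high s) al.
    by move: hN; rewrite S0 cards0 addn0 => ->.
  have bw : b != w by apply: contraNneq ab => ->; rewrite alw.
  have hb : high s b by rewrite /high rb.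
  have lb : low b = false by rewrite /low ltnNge rb.
  pose be := (al - U_(b))%MM.
  have eal : al = (be + U_(b))%MM by rewrite mnm_addK.
  have := @reach_var U s hU b (be + U_(u))%MM S rb bu bw.
  rewrite addmK -eal; apply.
  - apply: IH.
    + by move: hN; rewrite eal !psumDU hb huF; lia.
    + by rewrite mnmDE mnm1E (negPf uw) addn0 mnmBE alw.
    + rewrite -hd [in RHS](deg_psum s) (deg_psum s) eal !psumDU hb huF lb lu.
      by rewrite !mnmDE !mnm1E eqxx (negPf bu); lia.
  - by rewrite mnmDE mnm1E (negPf uw) addn0 mnmBE alw.
  - by rewrite mnmDE mnm1E eqxx addn1.
have := @reach_theta U s hU q (al + U_(u))%MM (S :\ q)%SET.
rewrite addmK finset.setD1K //; apply.
- by rewrite finset.setD11.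
- apply: IH.
  + by move: hN; rewrite psumDU huF (cardsD1 q S) qS; lia.
  + by rewrite mnmDE mnm1E (negPf uw) alw.
  + rewrite -hd [in RHS](deg_psum s) (deg_psum s) !psumDU huF lu (cardsD1 q S) qS.
    by rewrite !mnmDE !mnm1E eqxx; lia.
- by rewrite mnmDE mnm1E (negPf uw) alw.
- by rewrite mnmDE mnm1E eqxx addn1.
Qed.

End Submodule.

(** The elements of U reached from the boundary monomials of h add up to a member of U with the
    boundary of h; both are harmonic, hence equal. *)
Lemma generated_mem U k h : submodule U -> U `<=` H_ k -> H_ k h ->
  (forall al S, on_boundary al -> cf al S h != 0 ->
     exists2 s, U (vgen s k) & al (uv (~~ s)) = 0%N) -> U h.
Proof.
move=> hU UH hh hb.
suff [h' hU' e] : exists2 h', U h' & forall al S, on_boundary al -> cf al S h' = cf al S h.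
  by rewrite -(H_boundary_eq (UH _ hU') hh e).
have hk al S : cf al S h != 0 -> deg al S = k.
  by apply: (A_elem_inv (f := h)); have /(H_P)[] := hh.
apply: (elem_ind (P := fun f => exists2 h', U h' &
   forall al S, on_boundary al -> cf al S h' = cf al S f)).
- by exists 0; [exact: subspace0 hU.1|].
- move=> z f1 f2 [h1 u1 e1] [h2 u2 e2]; exists (z *: h1 + h2); first exact: hU.1.2.
  by move=> al S hal; rewrite !linearP /= e1 // e2.
move=> al S hc; have [bd|nb] := boolP (on_boundary al); last first.
  exists 0; first exact: subspace0 hU.1.
  move=> be T hbe; rewrite raddf0 cf_elem; case: (eqVneq be al) => //= e.
  by rewrite -e hbe in nb.
have [s vs hw] := hb _ _ bd hc.
have [f fU [fw fu]] := reach_all hU vs hw (hk _ _ hc).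
exists f => // be T hbe; apply/eqP; rewrite -subr_eq0 -raddfB; apply/contraT => hne.
have := fw _ _ hne; have := fu _ _ hne; move: hbe; rewrite /on_boundary.
by case: (s) => /=; lia.
Qed.

(** Let H, L, Y be the total exponents of the high variables, of the x_i with i < r and of their
    duals. In degree k the eigenvalue is a constant minus H + |S| + w + (2L - x_1) + (3Y - x_(m+1)),
    with w, x_1, x_(m+1) read as exponents. At [vexp] this sum is [neg_part k], while 2L - x_1 >= L
    >= [neg_part k] always, so equality singles out [vexp]. With 2 in place of 3 all x_1^i u^j of
    degree k would share the eigenvalue. *)
Definition cartan_x s (i : 'I_m) : int :=
  3 * (i < r)%N%:Z - (i == ord0)%:Z + (-1) ^+ (~~ s) * (i == ord_max)%:Z.

Definition cartan_wt s : I -> int :=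
  omega (cartan_x s) (fun i => - cartan_x s i) (fun=> 0) (fun=> 0).

Definition cartan s : gl := \matrix_(a, b) ((cartan_wt s a)%:~R *+ (a == b)).

Lemma cartan_osp s : osp (cartan s).
Proof.
apply/ospP => a b; rewrite !mxE (inj_eq (inv_inj (@starK m n))) [b == a]eq_sym.
case: eqVneq => [<-|_]; last by rewrite !mulr0n mulr0.
rewrite !mulr1n (_ : eps C a a = 1); last first.
  by case: (indexP a) => i; rewrite /eps /sgs !indexE /ssign ?expr0 ?expr1; ring.
rewrite mulN1r -mulrNz; congr (_%:~R).
by case: (indexP a) => i; rewrite /cartan_wt !indexE !omegaE ?opprK ?oppr0.
Qed.

Definition cartan_eigen s al S : int := \sum_a cartan_wt s a * occ r a al S.

Lemma cf_cartan s al S f :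
  cf al S (gl_act r (cartan s) f) = (cartan_eigen s al S)%:~R * cf al S f.
Proof.
rewrite gl_actE raddf_sum rmorph_sum mulr_suml; apply: eq_bigr => a _ /=.
rewrite (bigD1 a) //= big1 ?addr0.
  by rewrite mxE eqxx mulr1n linearZ /= cf_ZopDop mulrA intrM.
by move=> b ba; rewrite mxE eq_sym (negPf ba) scale0r.
Qed.

Lemma cartan_eigenE s al S : cartan_eigen s al S =
  (al (uv s))%:Z - (al (uv (~~ s)))%:Z + (al x0)%:Z + (al (rshift m ord0))%:Z
  - 3 * \sum_(i < m | (i < r)%N) ((al (lshift m i))%:Z + (al (rshift m i))%:Z)
  + 1 - 3 * \sum_(i < m | (i < r)%N) 1.
Proof.
have -> : cartan_eigen s al S =
    \sum_i cartan_x s i * (occ r (ix n i) al S - occ r (iy n i) al S).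
  rewrite /cartan_eigen !big_split_ord /=.
  rewrite [X in _ + (X + _)]big1 ?[X in _ + (_ + X)]big1 ?addr0; last first.
  - by move=> j _; rewrite -/(iT m j) /cartan_wt omegaE mul0r.
  - by move=> j _; rewrite -/(iS m j) /cartan_wt omegaE mul0r.
  rewrite -big_split; apply: eq_bigr => i _ /=.
  by rewrite -/(ix n i) -/(iy n i) /cartan_wt !omegaE mulrBr mulNr.
have -> : \sum_i cartan_x s i * (occ r (ix n i) al S - occ r (iy n i) al S) =
   3 * (\sum_(i < m | (i < r)%N) (occ r (ix n i) al S - occ r (iy n i) al S))
   - (occ r (ix n ord0) al S - occ r (iy n ord0) al S)
   + (-1) ^+ (~~ s) * (occ r (ix n ord_max) al S - occ r (iy n ord_max) al S).
  rewrite (big_mkcond (fun i : 'I_m => (i < r)%N)) /= mulr_sumr.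
  have one (j : 'I_m) (F : 'I_m -> int) : F j = \sum_i (i == j)%:Z * F i.
    rewrite (bigD1 j) //= eqxx mul1r big1 ?addr0 // => i /negPf ->.
    by rewrite mul0r.
  rewrite (one ord0 (fun i => occ r (ix n i) al S - occ r (iy n i) al S)).
  rewrite (one ord_max (fun i => occ r (ix n i) al S - occ r (iy n i) al S)).
  rewrite mulr_sumr -sumrB -big_split; apply: eq_bigr => i _ /=.
  rewrite /cartan_x; case: (i < r)%N; first by rewrite mulr1; ring.
  by rewrite !mulr0; ring.
have lo (i : 'I_m) : (i < r)%N -> occ r (ix n i) al S - occ r (iy n i) al S
    = - ((al (lshift m i))%:Z + (al (rshift m i))%:Z + 1).
  by move=> hi; rewrite !(occ_index _ _ _ rm).1 (occ_index _ _ _ rm).2 zs_x zs_y // hi; lia.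
rewrite (eq_bigr _ lo) lo // sumrN big_split /=.
rewrite (occ_index _ _ _ rm).1 (occ_index _ _ _ rm).2 zs_x zs_y //= ltnNge rp /=.
by case: s => /=; rewrite ?expr0 ?expr1 /xm /ym /x0; ring.
Qed.

(* The eigenvalue bounds |al| so tightly that it is attained only at vexp. *)
Lemma cartan_unique s k al S : deg al S = k ->
  cartan_eigen s al S = cartan_eigen s (vexp s k) finset.set0 ->
  al = vexp s k /\ S = finset.set0.
Proof.
move=> hk; rewrite !cartan_eigenE (vexp_uv) (vexp_uvN).
have hs be : \sum_(i < m | (i < r)%N) ((be (lshift m i))%:Z + (be (rshift m i))%:Z)
    = (psum low be)%:Z + (\sum_(i < m | (i < r)%N) be (rshift m i))%N%:Z.
  rewrite big_split /= -!(big_morph Posz PoszD (erefl _)); congr (Posz _ + _).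
  rewrite /psum big_split_ord /= [X in _ = (_ + X)%N]big1 ?addn0 // => i.
  by rewrite /low ltnNge /= (leq_trans rm) // leq_addr.
rewrite !hs.
have vy (i : 'I_m) : (i < r)%N -> vexp s k (rshift m i) = 0%N.
  move=> hi; case: (ord_wdP i) hi => [j|] hi; first exact: vexp_y.
  by move: hi; rewrite ltnNge rp.
rewrite [X in _ = _ - 3 * (_ + Posz X) + _ - _]big1; last exact: vy.
rewrite (vy ord0) // psum_vexp (low_uv) (x0_low).
have -> : vexp s k x0 = neg_part k.
  rewrite mnmDE !mulmnE !mnm1E eqxx eq_sym (negPf (low_neq_uv s (x0_low))).
  by rewrite mul1n addn0.
have hd := deg_psum s al S; rewrite hk in hd.
have ha0 : (al x0 <= psum low al)%N.
  by rewrite /psum (bigD1 x0) ?x0_low //= leq_addr.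
have hb0 : (al (rshift m ord0) <= \sum_(i < m | (i < r)%N) al (rshift m i))%N.
  by rewrite (bigD1 ord0) //= leq_addr.
set YL := (\sum_(i < m | (i < r)%N) al (rshift m i))%N in hb0 *.
set c1 := \sum_(i < m | (i < r)%N) 1.
set H := psum (high s) al in hd *.
move=> he.
have [hH hS h1 h2 h3] : [/\ H = 0%N, #|S| = 0%N, al x0 = neg_part k,
    psum low al = neg_part k & al (uv s) = pos_part k].
  move: he hd ha0 hb0; move: (al (uv (~~ s))) (al (uv s)) (al x0) (al (rshift m ord0)).
  move: (psum low al) c1 YL H #|S|; case: k {hk vy} => k /= LO c1 YL H cS aw au a0 b0 he hd ha hb.
    by split; lia.
  by split; lia.
split; last by apply/eqP; rewrite -cards_eq0 hS.
apply/mnmP => i; rewrite mnmDE !mulmnE !mnm1E.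
case: (eqVneq x0 i) => [<-|ne].
  by rewrite eq_sym (negPf (low_neq_uv s (x0_low))) mul1n addn0.
rewrite mul0n add0n; case: (eqVneq (uv s) i) => [<-|nu]; first by rewrite mul1n.
rewrite mul0n; case: (boolP (low i)) => hi; last first.
  by apply: (psum_eq0 hH); rewrite /high eq_sym nu andbT leqNgt.
have : (\sum_(i | low i && (i != x0)) al i = 0)%N.
  by move: h2; rewrite /psum (bigD1 x0) ?x0_low //= h1; lia.
by move/psum_eq0; apply; rewrite hi eq_sym.
Qed.

Lemma vgen_mem U k s f : submodule U -> U `<=` H_ k -> U f ->
  cf (vexp s k) finset.set0 f != 0 -> U (vgen s k).
Proof.
move=> hU UH hf hc.
apply: (@subspace_eigen U (gl_act r (cartan s)) (cartan_eigen s) _ _ _ f) => //.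
- exact: hU.1.
- by move=> g hg; apply: hU.2 => //; exact: cartan_osp.
- exact: cf_cartan.
- move=> al S hne; apply: cartan_unique.
  by apply: (A_elem_inv (f := f)) hne; have /(H_P)[] := UH _ hf.
Qed.

Lemma H_submodule k : submodule (H_ k).
Proof.
split; first exact: H_subspace.
move=> X hX f /(H_P)[h1 h2]; apply/(H_P); split; first exact: A_gl_act.
by rewrite lap_gl_act // h2 raddf0.
Qed.

Lemma elem_H k al S : (forall i, al (rshift m (wd i)) = 0%N) -> on_boundary al ->
  (forall j, ~~ ((lshift n j \in S) && (rshift n j \in S))) -> deg al S = k ->
  H_ k (elem C al S).
Proof.
by move=> h1 h2 h3 h4; apply/(H_P); split; [exact: A_elem|exact: lap_elem].
Qed.

Lemma vgen_H k s : H_ k (vgen s k).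
Proof.
apply: elem_H; [exact: vexp_y|exact: (vexp_boundary s k)| |exact: (deg_vexp s k)].
by move=> j; rewrite inE.
Qed.

Section Swap.
Variables (U : set A) (k : int) (s : bool).
Hypotheses (hU : submodule U) (UH : U `<=` H_ k) (vU : U (vgen s k)).
Local Notation u := (uv s).
Local Notation w := (uv (~~ s)).

Lemma harmonic_elem_mem al S : H_ k (elem C al S) -> al w = 0%N -> U (elem C al S).
Proof.
move=> h hw; apply: (generated_mem hU UH h) => be T _.
rewrite cf_elem; case: (eqVneq be al) => [->|]; last by rewrite eqxx.
by exists s.
Qed.

(** The element that acts as w d/dtheta replaces a theta by w; its dual summand differentiates by u,
    which does not occur. *)
Lemma theta_to_w q S : U (elem C (U_(w) *+ q)%MM S) ->
  U (elem C (U_(w) *+ (q + #|S|))%MM finset.set0).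
Proof.
have [N] : exists N, #|S| = N by exists #|S|.
elim: N S q => [|N IH] S q hS hUe.
  by move/eqP: hS hUe; rewrite cards_eq0 => /eqP ->; rewrite cards0 addn0.
have [S0|[x xS]] := set_0Vmem S; first by rewrite S0 cards0 in hS.
have := act_gen hU (iu (~~ s)) (rshift (m + m) x) hUe.
rewrite star_iu negbK Dop_iu // Dop_theta dx_elem mulmnE mnm1E.
rewrite eq_sym (negPf (uvN s)) mul0n scale0r raddf0 scaler0 subr0 Zop_iu //.
rewrite dtheta_elem xS linearZ /= xmul_elem => /(subspaceZ hU.1).
move=> /(_ (theta_sign C x S)); rewrite scalerA theta_sign_sq scale1r -mulmSr => h.
have hc : #|S| = #|S :\ x|.+1%SET by rewrite (cardsD1 x S) xS.
have -> : (q + #|S| = q.+1 + #|S :\ x|%SET)%N by rewrite hc addSnnS.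
by apply: IH h; move: hS; rewrite hc => -[].
Qed.

Lemma x_to_w (j : 'I_m) t q : (r <= j)%N -> j != ord_max ->
  U (elem C (U_(lshift m j) *+ t + U_(w) *+ q)%MM finset.set0) ->
  U (elem C (U_(w) *+ (q + t))%MM finset.set0).
Proof.
move=> rj jm; elim: t q => [|t IH] q; first by rewrite add0m addn0.
have ju : lshift m j != u.
  by case: (s) => /=; rewrite ?eq_lrshift // (inj_eq (@lshift_inj _ _)).
move=> hUe; rewrite (_ : (q + t.+1 = q.+1 + t)%N); last by rewrite addSnnS.
apply: IH.
have := act_gen hU (iu (~~ s)) (ix n j) hUe.
rewrite star_iu negbK Dop_iu // dx_elem mnmDE !mulmnE !mnm1E.
rewrite (negPf ju) eq_sym (negPf (uvN s)) !mul0n scale0r raddf0 scaler0 subr0.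
rewrite Zop_iu // Dop_hi // dx_elem linearZ /= xmul_elem => /(subspaceZ hU.1).
set c : C := _%:R; have c0 : c != 0.
  by rewrite /c (pcharf0P C).1 // mnmDE !mulmnE !mnm1E eqxx mul1n.
move=> /(_ c^-1); rewrite scalerA mulVf // scale1r; congr (U (elem C _ _)).
apply/mnmP => i; rewrite !(mnmDE, mnmBE, mulmnE, mnm1E).
by case: (lshift m j == i); case: (w == i); rewrite ?mul1n ?mul0n; lia.
Qed.

End Swap.

Lemma vexp_neg s k : k <= 0 -> vexp s k = vexp (~~ s) k.
Proof.
by rewrite /vexp; case: k => j // hj; rewrite (_ : j = 0%N) //; lia.
Qed.

(** Passes through a harmonic monomial free of u and w: x_(r+1)^k if r < m - 1, otherwise theta_1
    ... theta_k, which contains no pair because k <= n. Being free of w it lies in U, and its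
    factors are then turned into w one by one. *)
Lemma vgen_swap U k s : submodule U -> U `<=` H_ k -> (r < p)%N \/ k <= n%:Z ->
  U (vgen s k) -> U (vgen (~~ s) k).
Proof.
move=> hU UH hr vU; case: (lerP k 0) => [/(vexp_neg s) e|k0].
  by rewrite /vgen -e.
case: k k0 UH vU hr => // k k0 UH vU hr.
have ew q : (U_(x0) *+ 0 + U_(uv (~~ s)) *+ q = U_(uv (~~ s)) *+ q)%MM.
  by rewrite mulm0n add0m.
rewrite /vgen /vexp /= ew; case: hr => hr.
  pose j := Ordinal (leqW hr : (r < m)%N).
  have jm : j != ord_max by rewrite -val_eqE /= neq_ltn hr.
  have ju : lshift m j != uv (~~ s).
    by case: (s) => /=; rewrite ?eq_lrshift // (inj_eq (@lshift_inj _ _)).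
  rewrite -[X in (_ *+ X)%MM]add0n; apply: (@x_to_w U s hU j k 0) => //=.
  have ez : (U_(lshift m j) *+ k + U_(uv (~~ s)) *+ 0 = U_(lshift m j) *+ k)%MM
      by rewrite mulm0n addm0.
  rewrite ez; apply: (@harmonic_elem_mem U k s hU UH vU); last first.
    by rewrite mulmnE mnm1E (negPf ju).
  apply: elem_H.
  - by move=> i; rewrite mulmnE mnm1E eq_lrshift.
  - by rewrite /on_boundary mulmnE mnm1E (inj_eq (@lshift_inj _ _)) (negPf jm).
  - by move=> i; rewrite inE.
  - rewrite (deg_psum (~~ s)) cards0 mulmnE mnm1E (negPf ju).
    by rewrite !psumMU /low /high /= ltnn leqnn ju !mul0n mul1n; lia.
pose S := [set q : 'I_(n + n) | (q < k)%N]%SET.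
have hS : #|S| = k.
  rewrite /S cardsE -sum1_card.
  rewrite -(big_ord_widen (n + n) (fun=> 1%N)) ?sum1_card ?card_ord //.
  by apply: leq_trans (leq_addr n n); rewrite -lez_nat.
have := @theta_to_w U s hU 0 S; rewrite mulm0n add0n hS; apply.
apply: (@harmonic_elem_mem U k s hU UH vU); last by rewrite mnm0E.
apply: elem_H.
- by move=> i; rewrite mnm0E.
- by rewrite /on_boundary mnm0E.
- by move=> j; rewrite !inE /=; lia.
- by rewrite deg_split hS (_ : deg 0%MM _ = 0) // wtE !big1 ?addr0 // => i _; rewrite ?mnm0E ?inE mulr0.
Qed.

Lemma H_generated U k s : submodule U -> U `<=` H_ k -> (r < p)%N \/ k <= n%:Z ->
  U (vgen s k) -> H_ k `<=` U.
Proof.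
move=> hU UH hr vU h hh; apply: (generated_mem hU UH hh) => al S hb _.
have vs s' : U (vgen s' k).
  by case: (eqVneq s s') => [<- //|]; rewrite -addbT => /negPf; case: s s' vU => -[] //= vU _;
    first exact: (vgen_swap hU UH hr vU); exact: (vgen_swap hU UH hr vU).
case/orP: hb => /eqP h0; first by exists false.
by exists true.
Qed.

(** * Submodules up to the critical degree *)

Definition crit : int := n%:Z - m%:Z + r%:Z + 1.

Lemma lap_mulform_A k f : A_ k f ->
  lapT (mulT f) = mulT (lapT f) + (k - crit + 1)%:~R *: f.
Proof.
move=> hf; apply: cfP => al S; rewrite cf_lap_mulform [X in _ = cf _ _ X]addrC.
rewrite [RHS](linearP (cf al S)) /= addrC; congr (_ + _).
case: (eqVneq (cf al S f) 0) => [->|h]; first by rewrite !mulr0.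
by rewrite weight_shiftT // (A_elem_inv hf h).
Qed.

Let hG := @A_subspace C m n r.
Let hE k v : A_ k v -> A_ (k - 2) (lapT v) := @A_lap C m n r xpredT k v.
Let hF k v : A_ k v -> A_ (k + 2) (mulT v) := @A_mulform C m n r xpredT k v.

Definition image_eta k : set A := [set f | exists2 g, A_ (k - 2) g & f = mulT g].

Lemma harmonic_image_low k f : k <= crit -> H_ k f -> image_eta k f -> f = 0.
Proof.
move=> kc /(H_P)[_ hl] [g hg e]; have [N hN] := lap_nilpotent xpredT rm g.
rewrite e in hl *; suff -> : g = 0 by rewrite raddf0.
exact: (harmonic_cap_image_low char0 hE lap_mulform_A kc hg hl hN).
Qed.

Lemma harmonic_image_high k (d : nat) f : k - crit = d.+1%:Z -> H_ k f ->
  image_eta k f -> exists2 h, H_ (2 * crit - k) h & f = iter d.+1 mulT h.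
Proof.
move=> kc /(H_P)[_ hl] [g hg e]; have [N hN] := lap_nilpotent xpredT rm g.
rewrite e in hl *.
have [h [h1 h2] h3] := harmonic_cap_image_high char0 hG hE hF lap_mulform_A kc hg hl hN.
by exists h => //; apply/(H_P).
Qed.

Lemma iter_mulform_H k (d : nat) h : k - crit = d%:Z -> H_ (2 * crit - k) h ->
  H_ k (iter d mulT h).
Proof.
move=> kc /(H_P)[h1 h2]; apply/(H_P).
exact: (raise_harmonic hF lap_mulform_A kc h1 h2).
Qed.

Lemma A_decomposition k f : k <= crit -> A_ k f ->
  exists2 g, A_ (k - 2) g & H_ k (f - mulT g).
Proof.
move=> kc hf; have [N hN] := lap_nilpotent xpredT rm f.
have [g hg e] := harmonic_decomposition char0 hG hE hF lap_mulform_A kc hf hN.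
exists g => //; apply/(H_P); split => //.
by apply: subspaceB => //; rewrite -[k](subrK 2); exact: hF.
Qed.

Lemma iter_mulform_inj d f : iter d mulT f = 0 -> f = 0.
Proof. by elim: d => //= d IH /(mulform_inj) /IH. Qed.

Lemma vgen_not_image k s : ~ image_eta k (vgen s k).
Proof.
move=> [g _] /(congr1 (cf (vexp s k) finset.set0)).
rewrite cf_elem !eqxx cf_mulform_elem //; last exact: (vexp_boundary).
  by move/eqP; rewrite oner_eq0.
exact: vexp_y.
Qed.

Lemma vgen_neq0 k s : vgen s k <> 0.
Proof.
move=> /(congr1 (cf (vexp s k) finset.set0)); rewrite cf_elem !eqxx raddf0.
by move/eqP; rewrite oner_eq0.
Qed.

Lemma vgen_perp U k s : (forall u, U u -> cf (vexp s k) finset.set0 u = 0) ->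
  perp U (vgen s k).
Proof. by move=> h u hu; rewrite form_elem h // mulr0. Qed.

Lemma submoduleI U W : submodule U -> submodule W -> submodule (U `&` W).
Proof.
move=> hU hW; split.
  split; first by split; [exact: subspace0 hU.1|exact: subspace0 hW.1].
  by move=> a u v [u1 u2] [v1 v2]; split; [exact: hU.1.2|exact: hW.1.2].
by move=> X hX v [v1 v2]; split; [exact: hU.2|exact: hW.2].
Qed.

(* If vgen is not in U, it lies in the orthogonal of U; as it generates H_k,
   U is orthogonal to H_k and hence contained in the image of eta. *)
Lemma submodule_full k U f : (r < p)%N \/ k <= n%:Z -> submodule U -> U `<=` H_ k ->
  U f -> ~ image_eta k f -> H_ k `<=` U.
Proof.
move=> hr hU UH Uf nf.
case: (boolp.pselect (U (vgen true k))) => [vU|nvU]; first exact: (H_generated hU UH hr vU).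
exfalso; apply: nf; apply: (perp_harmonics).
  by have /(H_P)[] := UH _ Uf.
have hperp : perp U (vgen true k).
  apply: vgen_perp => u hu; apply/eqP/contraT => hc; exfalso; apply: nvU.
  exact: (vgen_mem hU UH hu hc).
have hW := submoduleI (H_submodule k) (perp_submodule hU).
have WH : H_ k `&` perp U `<=` H_ k by move=> ? [].
have hv : (H_ k `&` perp U) (vgen true k).
  by split => //; exact: (vgen_H k true).
by move=> h hh; have [_] := H_generated hW WH hr hv hh; apply.
Qed.

Lemma gl_act0 X : gl_act r X (0 : A) = 0.
Proof. exact: raddf0. Qed.

Lemma zero_submodule : submodule [set 0].
Proof.
split; first by split=> // a u v -> ->; rewrite scaler0 addr0.
by move=> X _ v ->; exact: gl_act0.
Qed.

Lemma irreducible_zero U : irreducible U -> irreducible_quotient U [set 0].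
Proof.
move=> [hU U0 irr]; split=> //; first exact: zero_submodule.
  split; first by move=> _ ->; exact: (subspace0 hU.1).
  move=> h; apply: U0; apply/seteqP; split=> // _ ->; exact: (subspace0 hU.1).
by move=> W hW _ WU; exact: irr.
Qed.

Lemma nonzero_or U : submodule U -> U = [set 0] \/ exists2 f, U f & f <> 0.
Proof.
move=> hU; case: (boolp.pselect (exists2 f, U f & f <> 0)) => h; first by right.
left; apply/seteqP; split=> [f hf|_ ->]; last exact: (subspace0 hU.1).
by apply: boolp.contrapT => f0; apply: h; exists f.
Qed.

(** For r = m - 1 the critical value is n. *)
Lemma range_cond k : k <= crit -> (r < p)%N \/ k <= n%:Z.
Proof.
move=> kc; case: (ltnP r p) => h; [by left|right].
by move: kc; rewrite /crit; lia.
Qed.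

Lemma H_neq0 k : H_ k <> [set 0].
Proof.
move=> e; apply: (@vgen_neq0 k true).
by have := vgen_H k true; rewrite e.
Qed.

Lemma H_irreducible k : k <= crit -> irreducible (H_ k).
Proof.
move=> kc; split; [exact: H_submodule|exact: H_neq0|].
move=> U hU UH; have [->|[f hf f0]] := nonzero_or hU; [by left|right].
apply/seteqP; split=> //.
apply: (submodule_full (range_cond kc) hU UH hf) => hi; apply: f0.
exact: (harmonic_image_low kc (UH _ hf) hi).
Qed.

Lemma A_direct_sum k : k <= crit -> direct_sum (A_ k) (H_ k) (mulT @` A_ (k - 2)).
Proof.
move=> kc; split.
  apply/seteqP; split=> f.
    move=> hf; have [g hg hh] := A_decomposition kc hf.
    exists (f - mulT g) => //; exists (mulT g); last by rewrite subrK.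
    by exists g.
  case=> h /(H_P)[hh _] [_ [g hg <-] <-]; apply: subspaceD => //.
  by have := @A_mulform C m n r xpredT _ _ hg; rewrite subrK.
apply/seteqP; split=> [f [hf [g hg e]]|_ ->].
  by apply: (harmonic_image_low kc hf); exists g.
split; first exact: (subspace0 (H_submodule k).1).
by exists 0; [exact: (subspace0 (@A_subspace C m n r _))|rewrite raddf0].
Qed.

(** * Above the critical degree: the radical *)

Section Radical.
Variables (k : int) (d : nat).
Hypothesis kd : k - crit = d.+1%:Z.

(** The intersection of H_k with the image of eta. Since eta is adjoint to Delta, it is also the
    radical of the form restricted to H_k. *)
Definition radical : set A := iter d.+1 mulT @` H_ (2 * crit - k).

Lemma iter_mulform_gl_act X f t : osp X ->
  gl_act r X (iter t mulT f) = iter t mulT (gl_act r X f).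
Proof. by move=> oX; elim: t => //= t <-; rewrite mulform_gl_act. Qed.

Lemma radical_submodule : submodule radical.
Proof.
have hH := H_submodule (2 * crit - k); split.
  split; first by exists 0; [exact: (subspace0 hH.1)|rewrite iter0].
  move=> a _ _ [u hu <-] [v hv <-]; exists (a *: u + v); first exact: hH.1.2.
  by rewrite iterP.
move=> X hX _ [v hv <-]; exists (gl_act r X v); first exact: hH.2.
by rewrite iter_mulform_gl_act.
Qed.

Lemma radical_H : radical `<=` H_ k.
Proof. by move=> _ [h hh <-]; exact: (iter_mulform_H kd hh). Qed.

Lemma radical_image f : radical f -> image_eta k f.
Proof.
move=> [h hh <-]; exists (iter d mulT h) => //=.
have := graded_iterF (@A_mulform C m n r xpredT) d ((H_P _ _).1 hh).1.
by congr (A_ _ _); lia.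
Qed.

Lemma image_radical f : H_ k f -> image_eta k f -> radical f.
Proof.
move=> hf hi; have [h hh ->] := harmonic_image_high kd hf hi.
by exists h.
Qed.

Lemma vgen_not_radical s : ~ radical (vgen s k).
Proof. by move=> /radical_image; exact: (vgen_not_image). Qed.

(** The power of eta is injective and commutes with osp, so submodules pull back to the harmonics of
    degree 2c - k <= c, which are irreducible. *)
Lemma radical_irreducible : irreducible radical.
Proof.
have [hH H0 irr] := @H_irreducible (2 * crit - k) ltac:(lia).
split; first exact: radical_submodule.
  move=> e; apply: H0; apply/seteqP; split=> [h hh|_ ->]; last exact: (subspace0 hH.1).
  apply: (iter_mulform_inj (d := d.+1)).
  have : radical (iter d.+1 mulT h) by exists h.
  by rewrite e.
move=> U hU UR; pose W := H_ (2 * crit - k) `&` [set h | U (iter d.+1 mulT h)].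
have [||e|e] := irr W.
- split.
    split; first by split; [exact: (subspace0 hH.1)|rewrite /mkset iter0; exact: (subspace0 hU.1)].
    by move=> a u v [u1 u2] [v1 v2]; split; [exact: hH.1.2|rewrite /mkset iterP; exact: hU.1.2].
  move=> X hX v [v1 v2]; split; first exact: hH.2.
  by rewrite /mkset -iter_mulform_gl_act //; exact: hU.2.
- by move=> ? [].
- left; apply/seteqP; split=> [f hf|_ ->]; last exact: (subspace0 hU.1).
  have [h hh eh] := UR _ hf; have : W h by split => //; rewrite /mkset eh.
  by rewrite e => h0; rewrite -eh h0 iter0.
- right; apply/seteqP; split=> // _ [h hh <-].
  by move: hh; rewrite -e => -[].
Qed.

Lemma quotient_irreducible : (r < p)%N -> irreducible_quotient (H_ k) radical.
Proof.
move=> hr; split.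
- exact: H_submodule.
- exact: radical_submodule.
- split; first exact: radical_H.
  by move=> h; apply: (@vgen_not_radical true); apply: h; exact: vgen_H.
move=> U hU RU UH.
case: (boolp.pselect (exists2 f, U f & ~ image_eta k f)) => [[f hf nf]|h].
  right; apply/seteqP; split=> //.
  exact: (submodule_full (or_introl hr) hU UH hf nf).
left; apply/seteqP; split=> // f hf; apply: image_radical; first exact: UH.
by apply: boolp.contrapT => nf; apply: h; exists f.
Qed.

End Radical.

(** * The case r = m - 1 *)

Definition om_h : I -> int :=
  omega (fun i => (i == ord_max)%:Z) (fun i => - (i == ord_max)%:Z) (fun=> 0) (fun=> 0).

Lemma wt_h al S : wt om_h al S = (al xm)%:Z - (al ym)%:Z.
Proof.
rewrite wtE /om_h.
under eq_bigr => i _ do rewrite omega_x.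
under [X in _ + X + _ + _]eq_bigr => i _ do rewrite omega_y mulNr.
rewrite sumrN !sum_max [X in _ + X + _]big1 ?[X in _ + X]big1 ?addr0 // => i _;
  by rewrite ?omegaE mul0r.
Qed.

Definition balanced f : Prop := supp (fun al S => al xm = al ym) f.

Lemma om_h_pair i : zs (ix n i) * om_h (ix n i) + zs (iy n i) * om_h (iy n i) = 0.
Proof.
rewrite /om_h !omegaE zs_x zs_y //; case: eqVneq => [->|_]; last by rewrite oppr0 !mulr0.
by rewrite /= ltnNge rp.
Qed.

Lemma om_h_theta j : om_h (iT m j) + om_h (iS m j) = 0.
Proof. by rewrite /om_h !omegaE. Qed.

Lemma supp_h_lap (P : int -> Prop) f : supp (fun al S => P (wt om_h al S)) f ->
  supp (fun al S => P (wt om_h al S)) (lapT f).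
Proof.
move=> /(supp_lap (Q := xpredT) (fun i _ => om_h_pair i) om_h_theta).
by apply: sub_supp => al S; rewrite addr0.
Qed.

(** The omitted pair x_m, x_(2m) contributed the sum of its exponents plus 1, and c = n for r = m -
    1. *)
Lemma weight_shift_inner al S : r = p ->
  weight_shift r inner al S = deg al S - n%:Z - (al xm)%:Z - (al ym)%:Z.
Proof.
move=> erp; have := weight_shiftT al S rm; rewrite /weight_shift (bigD1 ord_max) //=.
rewrite !(occ_index _ _ _ rm).1 (occ_index _ _ _ rm).2 zs_x zs_y //= ltnNge rp /=.
rewrite -[\sum_(i < m | i != _) _]/(\sum_(i < m | inner i) _) -/xm -/ym.
by move: (\sum_(i < m | inner i) _) (\sum_(j < n) _) => a b; lia.
Qed.

Section Lefschetz.
Hypothesis erp : r = p.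

(** The sign of the grading is reversed because the inner part of eta is to play the lowering role
    of E; the critical value becomes 1 - n. *)
Definition inner_space (j : int) : set A :=
  [set g | A_ (- j) g /\ supp (fun al S => al xm = 0%N /\ al ym = 0%N) g].

Lemma inner_space_subspace j : subspace (inner_space j).
Proof.
split; first by split; [exact: (subspace0 (@A_subspace C m n r _))|exact: supp0].
move=> a u v [u1 u2] [v1 v2]; split; last exact: suppP.
exact: (@A_subspace C m n r _).2.
Qed.

Lemma supp_corner (T : A -> A) :
  (forall (P : int -> Prop) f, supp (fun al S => P (al xm)) f -> supp (fun al S => P (al xm)) (T f)) ->
  (forall (P : int -> Prop) f, supp (fun al S => P (al ym)) f -> supp (fun al S => P (al ym)) (T f)) ->
  forall f, supp (fun al S => al xm = 0%N /\ al ym = 0%N) f ->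
    supp (fun al S => al xm = 0%N /\ al ym = 0%N) (T f).
Proof.
move=> hx hy f hf.
have h1 := hx (fun d => d = 0) f _; have h2 := hy (fun d => d = 0) f _.
move=> al S h0; split; apply/eqP; rewrite -eqz_nat; apply/eqP.
  by apply: h1 h0 => be T' /hf[->].
by apply: h2 h0 => be T' /hf[_ ->].
Qed.

Lemma supp_ym_lap_inner (P : int -> Prop) f : supp (fun al S => P (al ym)) f ->
  supp (fun al S => P (al ym)) (lap r inner f).
Proof.
move=> hf; apply: (sub_supp (Q := fun al S => P (wt (@om_ym) al S + 0))).
  by move=> al S; rewrite wt_ym addr0.
apply: supp_lap => [i hi|j|]; rewrite /om_ym ?omegaE ?(negPf hi) ?mulr0 //.
by apply: sub_supp hf => al S; rewrite wt_ym.
Qed.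

Lemma inner_space_lap j g : inner_space j g -> inner_space (j + 2) (lap r inner g).
Proof.
move=> [h1 h2]; split; first by have := @A_lap C m n r inner _ _ h1; congr (A_ _ _); lia.
apply: supp_corner h2 => P f; [exact: supp_xm_lap_inner|exact: supp_ym_lap_inner].
Qed.

Lemma inner_space_mulform j g : inner_space j g -> inner_space (j - 2) (mulform r inner g).
Proof.
move=> [h1 h2]; split; first by have := @A_mulform C m n r inner _ _ h1; congr (A_ _ _); lia.
apply: supp_corner h2 => P f; [exact: supp_xm_mulform_inner|exact: supp_ym_mulform_inner].
Qed.

Lemma inner_commutator j g : inner_space j g ->
  mulform r inner (lap r inner g) = lap r inner (mulform r inner g) + (j - (1 - n%:Z) + 1)%:~R *: g.
Proof.
move=> [h1 h2]; apply: cfP => al S; rewrite [RHS]raddfD [X in _ = X + _]cf_lap_mulform -addrA.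
rewrite [X in _ + (_ + X)]linearZ /= -mulrDl -intrD.
case: (eqVneq (cf al S g) 0) => [->|h]; first by rewrite mulr0 addr0.
have [ex ey] := h2 _ _ h; rewrite weight_shift_inner // (A_elem_inv h1 h) ex ey.
by rewrite [X in X%:~R](_ : _ = 0) ?mul0r ?addr0 //; lia.
Qed.

(** As r = m - 1, each term of the inner part of eta differentiates by some x_i or multiplies by
    some theta_j with j <= n. Both lower the number of x's minus that of these theta's, which is at
    least - n. *)
Lemma mulform_inner_nilpotent f : exists N, iter N (mulform r inner) f = 0.
Proof.
pose om : I -> int := omega (fun=> 1) (fun=> 0) (fun=> -1) (fun=> 0).
apply: (locally_nilpotent (om := om) (B := - n%:Z)) => [al S|d g].
  rewrite wtE /om; under eq_bigr do rewrite omegaE mul1r.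
  under [X in _ + X + _ + _]eq_bigr do rewrite omegaE mul0r.
  under [X in _ + X + _]eq_bigr do rewrite omegaE mulN1r.
  under [X in _ + X]eq_bigr do rewrite omegaE mul0r.
  rewrite !big1_eq !addr0 sumrN.
  have : \sum_(j < n) (lshift n j \in S)%:Z <= n%:Z.
    rewrite -[X in _ <= X%:Z]card_ord -sum1_card (big_morph Posz PoszD (erefl _)).
    by apply: ler_sum => j _; case: (_ \in S).
  have : 0 <= \sum_(i < m) (al (lshift m i))%:Z by apply: sumr_ge0.
  by move=> h1 h2; rewrite -[- _]add0r; exact: lerB.
apply: (supp_mulform (P := fun x => x <= d) (t := -1)) => [i hi|j]; rewrite /om !omegaE //.
rewrite zs_x mulr1 mulr0 addr0 erp.
have : (i < p)%N by move: hi (ltn_ord i); rewrite /inner -val_eqE /= => hi; rewrite ltnS leq_eqVlt (negPf hi).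
by move=> ->.
Qed.

End Lefschetz.

Lemma exists_part (P : 'X_{1..m + m} -> bool) f :
  exists g, forall al S, cf al S g = cf al S f *+ P al.
Proof.
apply: (elem_ind (P := fun f => exists g, forall al S, cf al S g = cf al S f *+ P al)).
- by exists 0 => al S; rewrite raddf0 mul0rn.
- move=> a f1 f2 [g1 h1] [g2 h2]; exists (a *: g1 + g2) => al S.
  by rewrite !linearP /= h1 h2 mulrnDl mulrnAr.
move=> al S _; case: (boolP (P al)) => hP.
  exists (elem C al S) => be T; rewrite cf_elem.
  by case: (eqVneq be al) => [->|]; rewrite ?hP ?andbF ?mul0rn.
exists 0 => be T; rewrite raddf0 cf_elem.
by case: (eqVneq be al) => [->|]; rewrite ?(negPf hP) ?andbF ?mul0rn ?mulr0n.
Qed.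

Lemma crit_n : r = p -> crit = n%:Z.
Proof. by clear; rewrite /crit => ->; lia. Qed.

Section Critical.
Variables (k : int) (d : nat).
Hypotheses (erp : r = p) (kd : k - n%:Z = d.+1%:Z).

Let kcrit : k - crit = d.+1%:Z. Proof. by rewrite crit_n. Qed.

Local Notation radical := (radical k d).

Definition off_boundary f : Prop := supp (fun al S => ~~ on_boundary al) f.

Lemma off_boundary_corner f : off_boundary (xmul xm (xmul ym f)).
Proof.
move=> al S; rewrite cf_xmul; case: (eqVneq (al xm) 0%N) => [_|hx]; first by rewrite eqxx.
rewrite cf_xmul mnmBE mnm1E (negPf (xm_neq_ym)) subn0.
case: (eqVneq (al ym) 0%N) => [_|hy]; first by rewrite eqxx.
by rewrite /on_boundary negb_or hx hy.
Qed.

Lemma off_boundary_inner f : off_boundary f -> off_boundary (mulform r inner f).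
Proof.
move=> hf al S h0; rewrite /on_boundary negb_or; apply/andP; split.
  have := @supp_xm_mulform_inner (fun d => d != 0) f; apply; last exact: h0.
  by move=> be T /hf; rewrite negb_or => /andP[].
have := @supp_ym_mulform_inner (fun d => d != 0) f; apply; last exact: h0.
by move=> be T /hf; rewrite negb_or => /andP[].
Qed.

(** Monomials divisible by x_m x_(2m) are kept so by eta, and modulo them eta acts as its inner
    part. *)
Lemma iter_mulform_off t f g : off_boundary (f - g) ->
  off_boundary (iter t (mulT) f - iter t (mulform r inner) g).
Proof.
move=> h0; elim: t => //= t IH; rewrite mulform_split // -addrA -linearB.
by apply: suppD; [exact: off_boundary_corner|exact: off_boundary_inner].
Qed.

(* f is determined by its part free of x_m and x_(2m), and there hard Lefschetz
   applies to the operators in the remaining variables. *)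
Lemma balanced_radical f : H_ k f -> balanced f -> radical f.
Proof.
move=> hf bf; have [g hg] := exists_part (fun al => (al xm == 0%N) && (al ym == 0%N)) f.
have Ig : inner_space (- k) g.
  split=> [|al S]; last by rewrite hg; case: andP => [[/eqP -> /eqP ->]|]; rewrite ?mulr0n ?eqxx.
  apply/A_P => al S; rewrite hg; case: andP; rewrite ?mulr0n ?eqxx // => _ h0.
  by have /(H_P)[/A_P hA _] := hf; rewrite (hA _ _ h0) opprK.
have [N hN] := mulform_inner_nilpotent erp g.
have kd' : - k = 1 - n%:Z - 1 - d.+1%:Z by lia.
have [h [hA hs] gh] := lefschetz_onto char0 (@inner_space_subspace)
   (@inner_space_mulform erp) (@inner_space_lap erp)
   (@inner_commutator erp) kd' Ig hN.
have hA' : A_ (2 * crit - k) h by rewrite crit_n //; move: hA; congr (A_ _ _); lia.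
have [h' hh' bh] := harmonic_lift hA'; exists h' => //.
have hR := iter_mulform_H kcrit hh'.
apply/esym/(H_boundary_eq hf hR) => al S hb.
have hoff : off_boundary (h' - h).
  by move=> be T; rewrite raddfB /=; apply: contraNN => hbe; rewrite bh // subrr.
have := @iter_mulform_off d.+1 _ _ hoff al S.
rewrite raddfB /= -/(iter d.+1 _ _) -/(iter d.+1 _ h) -gh hg hb subr_eq0 => e.
have -> : cf al S f = cf al S f *+ ((al xm == 0%N) && (al ym == 0%N)).
  case: (eqVneq (cf al S f) 0) => [->|/bf e0]; first by rewrite mul0rn.
  by move: hb; rewrite /on_boundary -e0 orbb andbb => ->.
by apply/esym/eqP/contraT => /e.
Qed.

(** Delta preserves the weight [om_h], so the component of weight zero of a harmonic function is
    harmonic. *)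
Lemma balanced_part_H f g : H_ k f ->
  (forall al S, cf al S g = cf al S f *+ (al xm == al ym)) -> H_ k g.
Proof.
move=> /(H_P)[hA hl] hg; apply/(H_P); split.
  apply/A_P => al S; rewrite hg => h; move/A_P: hA; apply.
  by apply: contraNN h => /eqP ->; rewrite mul0rn.
have g0 : supp (fun al S => wt om_h al S = 0) g.
  by move=> al S; rewrite hg wt_h; case: (eqVneq (al xm) (al ym)) => [-> _|]; rewrite ?subrr ?mulr0n ?eqxx.
have g1 : supp (fun al S => wt om_h al S <> 0) (f - g).
  move=> al S; rewrite raddfB /= hg wt_h; case: (eqVneq (al xm) (al ym)) => [_|/eqP ne _].
    by rewrite mulr1n subrr eqxx.
  by clear - ne; lia.
have l0 := supp_h_lap (P := fun x => x = 0) g0.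
have l1 := supp_h_lap (P := fun x => x <> 0) g1.
apply: cfP => al S; rewrite raddf0; apply/eqP/contraT => h.
by case: (l1 al S _ (l0 _ _ h)); rewrite linearB /= hl sub0r raddfN oppr_eq0.
Qed.

(** The balanced part of h is harmonic with the same boundary, hence is h. *)
Lemma harmonic_lift_balanced f h : balanced f -> H_ k h ->
  (forall al S, on_boundary al -> cf al S h = cf al S f) -> balanced h.
Proof.
move=> bf hh e; have [g hg] := exists_part (fun al => al xm == al ym) h.
have -> : h = g.
  apply: (H_boundary_eq hh (balanced_part_H hh hg)) => al S hb.
  rewrite hg e //; case: (eqVneq (al xm) (al ym)) => [_|ne]; first by rewrite mulr1n.
  by apply/eqP/contraT => /bf /eqP; rewrite (negPf ne).
by move=> al S; rewrite hg; case: (eqVneq (al xm) (al ym)) => //; rewrite mulr0n eqxx.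
Qed.

Local Notation gen s := (generated osp (@gl_act C m n r) [set vgen s k]).

Lemma generated_submodule F : submodule (generated osp (@gl_act C m n r) F).
Proof.
split.
  split; first by move=> W [hW _]; exact: (subspace0 hW.1).
  by move=> a u v hu hv W hW; apply: hW.1.1.2; [exact: hu|exact: hv].
by move=> X hX v hv W hW; apply: hW.1.2 => //; exact: hv.
Qed.

Lemma gen_sub s U : submodule U -> U (vgen s k) -> gen s `<=` U.
Proof. by move=> hU hv; apply: smallest_sub => // _ ->. Qed.

Lemma vgen_gen s : gen s (vgen s k).
Proof. by move=> U [_]; apply. Qed.

Lemma gen_H s : gen s `<=` H_ k.
Proof. by apply: gen_sub; [exact: H_submodule|exact: vgen_H]. Qed.

Lemma both_generate U : submodule U -> U `<=` H_ k ->
  U (vgen true k) -> U (vgen false k) -> H_ k `<=` U.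
Proof.
move=> hU UH ht hf h hh; apply: (generated_mem hU UH hh) => al S hb _.
by case/orP: hb => /eqP h0; [exists false|exists true].
Qed.

Lemma vgen_or_perp U s : submodule U -> U `<=` H_ k -> ~ U (vgen s k) -> perp U (vgen s k).
Proof.
move=> hU UH nU; apply: vgen_perp => u hu; apply/eqP/contraT => hc.
by case: nU; exact: (vgen_mem hU UH hu hc).
Qed.

Lemma perp_radical U : U `<=` H_ k -> H_ k `<=` @perp U -> U `<=` radical.
Proof.
move=> UH hp f hf; apply: (image_radical kcrit (UH _ hf)).
apply: (perp_harmonics); first by have /(H_P)[] := UH _ hf.
by move=> h hh; exact: hp.
Qed.

Lemma perpI_both U : submodule U -> perp U (vgen true k) -> perp U (vgen false k) ->
  H_ k `<=` perp U.
Proof.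
move=> hU h1 h2 h hh.
have hW := submoduleI (H_submodule k) (perp_submodule hU).
have WH : H_ k `&` perp U `<=` H_ k by move=> ? [].
have wv s : perp U (vgen s k) -> (H_ k `&` perp U) (vgen s k).
  by move=> hv; split => //; exact: vgen_H.
by have [] := both_generate hW WH (wv _ h1) (wv _ h2) hh.
Qed.

(** Among the matrix units only E_(2m,m) lowers the weight by two, and skewness forces that entry of
    X to vanish. *)
Lemma gl_act_om_h X f (t : int) : osp X -> supp (fun al S => t <= wt om_h al S) f ->
  supp (fun al S => t - 1 <= wt om_h al S) (gl_act r X f).
Proof.
move=> /ospP oX hf; rewrite gl_actE; apply: supp_sum => a _; apply: supp_sum => b _.
case: (boolP ((a == iy n ord_max) && (b == ix n ord_max))) => [/andP[/eqP -> /eqP ->]|hab].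
  have := oX (iy n ord_max) (ix n ord_max); rewrite !starE.
  rewrite (_ : eps C _ _ = 1) => [|].
    move/eqP; rewrite mulN1r -addr_eq0 -mulr2n -mulr_natl mulf_eq0 (negPf two_neq0) /= => /eqP ->.
    by rewrite scale0r; exact: supp0.
  by rewrite /eps /sgs !indexE /ssign ?expr0 ?expr1; ring.
apply: suppZ.
have h1 := supp_Dop (r := r) (a := b) (Q := fun x => t <= x) hf.
have := supp_Zop (r := r) (a := a) (Q := fun x => t <= x + zs b * om_h b) h1.
apply: sub_supp => al S; suff : zs a * om_h a - zs b * om_h b >= -1 by lia.
have zl c : zs c * om_h c = (c == ix n ord_max)%:Z - (c == iy n ord_max)%:Z.
  case: (indexP c) => i; rewrite /om_h !omegaE !eq_indexE ?zs_x ?zs_y ?mulr0 //.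
    case: (eqVneq i ord_max) => [->|_]; last by rewrite mulr0.
    by rewrite /= ltnNge rp.
  by rewrite mul1r sub0r.
rewrite !zl; move: hab; rewrite negb_and.
case: (eqVneq a (ix n ord_max)) => [->|_].
  by rewrite eq_indexE; case: (b == ix n _); case: (b == iy n _).
by case: (a == iy n _); case: (b == ix n _); case: (b == iy n _).
Qed.

Definition upper : set A := [set f | H_ k f /\
  exists2 g, radical g & supp (fun al S => 1 <= wt om_h al S) (f - g)].

(* An element of osp lowers the weight by at most one, and the part of weight
   zero that it may create is harmonic, hence in the radical. *)
Lemma upper_submodule : submodule upper.
Proof.
have hH := H_submodule k.
have hR := radical_submodule k d.
split.
  split.
    split; first exact: (subspace0 hH.1).
    exists 0; first exact: (subspace0 hR.1).
    by rewrite subr0; exact: supp0.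
  move=> a u v [uH [u' hu su]] [vH [v' hv sv]]; split; first exact: hH.1.2.
  exists (a *: u' + v'); first exact: hR.1.2.
  by rewrite opprD addrACA -scalerBr; exact: suppP.
move=> X hX f [hf [f' hf' sf]]; split; first exact: hH.2.
have [g hg] := exists_part (fun al => al xm == al ym) (gl_act r X (f - f')).
have hX' : H_ k (gl_act r X (f - f')).
  apply: hH.2 => //; apply: (subspaceB hH.1) => //; exact: (radical_H kcrit hf').
have gR : radical g.
  apply: balanced_radical; first exact: (balanced_part_H hX' hg).
  by move=> al S; rewrite hg; case: (eqVneq (al xm) (al ym)) => //; rewrite mulr0n eqxx.
exists (gl_act r X f' + g).
  by apply: (subspaceD hR.1) => //; exact: hR.2.
rewrite opprD addrA -[_ - gl_act r X f'](linearB (gl_act r X)).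
move=> al S; rewrite raddfB /= hg; case: (eqVneq (al xm) (al ym)) => [_|ne].
  by rewrite mulr1n subrr eqxx.
rewrite mulr0n subr0 => /(gl_act_om_h hX sf); rewrite wt_h; lia.
Qed.

Lemma upper_vgen : upper (vgen true k).
Proof.
split; first exact: vgen_H.
exists 0; first exact: (subspace0 (radical_submodule k d).1).
rewrite subr0; apply: supp_elem; rewrite wt_h.
have := vexp_uv true k; have := vexp_uvN true k => /= -> ->.
by case: (k) kd => [j|j] /=; lia.
Qed.

(** The monomial x_(2m)^k does not occur in the image of eta, so subtracting a member of the radical
    cannot remove it; its weight - k is negative. *)
Lemma upper_vgenN : ~ upper (vgen false k).
Proof.
move=> [_ [g /radical_image gR /(_ (vexp false k) finset.set0)]].
have [g' _ ->] := gR kcrit.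
rewrite raddfB /= cf_elem !eqxx cf_mulform_elem //; last exact: (vexp_boundary).
  rewrite subr0 => /(_ (oner_neq0 _)); rewrite wt_h.
  have := vexp_uv false k; have := vexp_uvN false k => /= -> ->.
  by case: (k) kd => [j|j] /=; lia.
exact: vexp_y.
Qed.

Lemma vgenN_gen : ~ gen true (vgen false k).
Proof. by move/(gen_sub upper_submodule upper_vgen)/upper_vgenN. Qed.

(** By irreducibility one nonzero common element suffices: the harmonic extension of x_(m+1)^k. It
    is balanced, hence in the radical, and its boundary contains neither x_m nor x_(2m), hence it is
    generated by x_m^k. *)
Lemma radical_gen : radical `<=` gen true.
Proof.
have hg := generated_submodule [set vgen true k].
have hR := radical_submodule k d.
have [_ _ irr] := radical_irreducible kcrit.
have [|e0|<-] := irr (radical `&` gen true) (submoduleI hR hg).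
- by move=> ? [].
- exfalso.
  pose be : 'X_{1..m + m} := (U_(rshift m ord0) *+ pos_part k)%MM.
  have be_u s : be (uv s) = 0%N.
    rewrite mulmnE mnm1E; case: s => /=; first by rewrite eq_rlshift.
    have -> : (rshift m ord0 == ym) = false; last by [].
    rewrite (inj_eq (@rshift_inj _ _)); apply/negbTE; rewrite -val_eqE /=.
    by rewrite eq_sym -lt0n; exact: leq_trans r0 rp.
  have hA : A_ k (elem C be finset.set0).
    apply: A_elem; rewrite (deg_psum true) cards0 be_u !psumMU.
    have -> : low (rshift m ord0) = false.
      by apply/negbTE; rewrite /low -leqNgt (leq_trans rm) // leq_addr.
    have -> : high true (rshift m ord0).
      by rewrite /high eq_rlshift andbT (leq_trans rm) // leq_addr.
    by case: (k) kd => j /=; lia.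
  have [h hh bh] := harmonic_lift hA.
  have bb : balanced (elem C be finset.set0).
    apply: supp_elem; exact: (etrans (be_u true) (esym (be_u false))).
  have h1 : radical h.
    by apply: balanced_radical => //; exact: (harmonic_lift_balanced bb hh bh).
  have h2 : gen true h.
    apply: (generated_mem hg (@gen_H true) hh) => al S hb.
    rewrite bh // cf_elem; case: andP => [[/eqP -> _] _|_]; last by rewrite eqxx.
    by exists true; [exact: vgen_gen|exact: be_u].
  have : (radical `&` gen true) h by split.
  rewrite e0 => /(congr1 (cf be finset.set0)); rewrite bh; last first.
    by rewrite /on_boundary (be_u true).
  by rewrite cf_elem !eqxx raddf0 => /eqP; rewrite oner_eq0.
- by move=> f [].
Qed.

(** A submodule U of <v> without v is orthogonal to v. It does not contain v' either, as <v> does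
    not, so it is orthogonal to v' too. Together v and v' generate H_k, so U lies in the radical. *)
Lemma gen_quotient_radical : irreducible_quotient (gen true) radical.
Proof.
have hS := generated_submodule [set vgen true k].
split; first exact: hS.
- exact: radical_submodule.
- split; first exact: radical_gen.
  by move=> h; exact: (vgen_not_radical kcrit (h _ (@vgen_gen true))).
move=> U hU RU UG; have UH : U `<=` H_ k := subset_trans UG (@gen_H true).
case: (boolp.pselect (U (vgen true k))) => [hv|nv]; [right|left];
  apply/seteqP; split=> //; first exact: gen_sub.
apply: perp_radical => //; apply: (perpI_both hU); apply: (vgen_or_perp hU UH) => // hv.
exact: (vgenN_gen (UG _ hv)).
Qed.

Lemma sum_submodule U W : submodule U -> submodule W ->
  submodule [set u + w | u in U & w in W].
Proof.
move=> hU hW; split.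
  split.
    exists 0; first exact: (subspace0 hU.1).
    by exists 0; [exact: (subspace0 hW.1)|rewrite addr0].
  move=> a _ _ [u hu [w hw <-]] [u' hu' [w' hw' <-]].
  exists (a *: u + u'); first exact: hU.1.2.
  by exists (a *: w + w'); [exact: hW.1.2|rewrite scalerDr addrACA].
move=> X hX _ [u hu [w hw <-]]; exists (gl_act r X u); first exact: hU.2.
by exists (gl_act r X w); [exact: hW.2|rewrite raddfD].
Qed.

Lemma H_gen_sum : H_ k `<=` [set u + w | u in gen true & w in gen false].
Proof.
have hS s := generated_submodule [set vgen s k].
have h0 s : gen s 0 by exact: (subspace0 (hS s).1).
apply: (both_generate (sum_submodule (hS true) (hS false))).
- move=> _ [u hu [w hw <-]]; apply: (subspaceD (H_submodule k).1).
    exact: (gen_H hu).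
  exact: (gen_H hw).
- by exists (vgen true k); [exact: vgen_gen|exists 0; rewrite ?addr0].
- by exists 0; last by exists (vgen false k); [exact: vgen_gen|rewrite add0r].
Qed.

(** If U contains <v> but not v', then v' and hence <v'> is orthogonal to U. Thus the intersection
    of U with <v'> is orthogonal to v, which is in U, and to v', so it lies in the radical and in
    <v>. An element of U is a + b with a in <v> and b in <v'>; then b is in U, and so in <v>. *)
Lemma H_quotient_gen : irreducible_quotient (H_ k) (gen true).
Proof.
have hS s := generated_submodule [set vgen s k].
split; first exact: H_submodule.
- exact: hS.
- split; first exact: gen_H.
  by move=> h; apply: vgenN_gen; apply: h; exact: vgen_H.
move=> U hU GU UH; have Uv : U (vgen true k) := GU _ (@vgen_gen true).
case: (boolp.pselect (U (vgen false k))) => [hv|nv]; [right|left]; apply/seteqP; split=> //.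
  exact: both_generate.
have Up : gen false `<=` perp U.
  by apply: (gen_sub (perp_submodule hU)); exact: (vgen_or_perp hU UH).
have hW := submoduleI hU (hS false).
have WR : U `&` gen false `<=` radical.
  apply: perp_radical; first by move=> u [/UH].
  apply: (perpI_both hW) => u [hu hg].
    by rewrite formC; exact: (Up _ hg _ Uv).
  by exact: (Up _ (@vgen_gen false) _ hu).
move=> f hf; have [a ha [b hb e]] := H_gen_sum (UH _ hf).
rewrite -e; apply: (subspaceD (hS true).1 ha); apply: radical_gen; apply: WR; split=> //.
rewrite (_ : b = f - a); last by rewrite -e addrC addKr.
by apply: (subspaceB hU.1) => //; exact: GU.
Qed.

End Critical.

End Modules.

(** * Assembling the statement over the complex numbers *)

Lemma complex_char0 (R : realType) : [pchar R[i]] =i pred0.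
Proof. exact: pchar_num. Qed.

Lemma x_last_pow_vgen (C : fieldType) p n (k : int) : 0 <= k ->
  x_last_pow C p n `|k|%N = vgen C p n true k.
Proof.
case: k => // k _; rewrite /x_last_pow /vgen /vexp /= mulm0n add0m -of_poly_elem mpolyXn.
by [].
Qed.

Theorem theorem2p4 (R : realType) (p n r : nat) (k : int)
    (hn : (0 < n)%N) (hr : (0 < r < p.+1)%N) :
  let C : fieldType := R[i] in
  let m1 := p.+1 in
  let c : int := n%:Z - m1%:Z + r%:Z + 1 in
  let A := @A_ C m1 n r in
  let H := @H_ C m1 n r in
  let eta := @eta_op C m1 n r in
  let g := @osp C m1 n in
  let act := @gl_act C m1 n r in
  [/\ k <= c ->
        irreducible g act (H k) /\
        direct_sum (A k) (H k) (eta @` A (k - 2)),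
      c < k -> (r < m1 - 1)%N ->
        composition_series g act (H k)
          [:: iter `|k - c|%N eta @` H (- k + 2 * c); [set 0]],
      c < k -> r = (m1 - 1)%N ->
        composition_series g act (H k)
          [:: generated g act [set @x_last_pow C p n `|k|%N];
              iter `|k - n%:Z|%N eta @` H (- k + 2 * n%:Z); [set 0]]
    & is_basis (@basis_index p n r k)
        (fun ab => @basis_vector C p n r ab.1 ab.2) (H k)].
Proof.
move=> C m1 c A H eta g act.
have char0 : [pchar C] =i pred0 := @complex_char0 R.
have two_neq0 : (2%:R : C) != 0 by rewrite natr_neq0.
have /andP[r0 rp] := hr; rewrite ltnS in rp.
have etaE : eta = mulform r xpredT.
  by apply: boolp.funext => f; rewrite /eta eta_mulform //; exact: leqW.
have dE x : c < x -> exists d, `|x - c|%N = d.+1 /\ x - c = d.+1%:Z.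
  move=> cx; exists `|x - c|%N.-1; clear - cx; lia.
split.
- move=> kc; split; first exact: H_irreducible.
  by rewrite etaE; exact: A_direct_sum.
- move=> ck hrp; rewrite /m1 subn1 /= in hrp.
  have [d [-> kd]] := dE _ ck; rewrite etaE addrC.
  split; first exact: quotient_irreducible.
  split=> //; apply: irreducible_zero; exact: radical_irreducible.
- move=> ck erp; rewrite /m1 subn1 /= in erp.
  have cn : c = n%:Z by exact: crit_n.
  have [d [ed kd]] := dE _ ck; rewrite cn in ed kd ck.
  rewrite x_last_pow_vgen; last by apply: ltW; apply: le_lt_trans ck.
  rewrite ed etaE addrC -cn.
  split; first exact: (H_quotient_gen char0 two_neq0 r0 rp erp kd).
  split; first exact: (gen_quotient_radical char0 two_neq0 r0 rp erp kd).
  split=> //; apply: irreducible_zero; apply: radical_irreducible => //.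
  by rewrite -/(crit p n r) (crit_n n erp).
exact: harmonic_basis.
Qed.
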